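(* Let $B\subset\mathbb R^d$ be a compact convex set containing a neighbourhood of $0$. Let $Z=N$ and $\tilde Z=\tilde N$ be two Poisson cluster point processes in $\mathbb R^d$ with the same intensity, based on the same Poisson process $\Pi$ and with typical clusters $L_0$ and $\tilde L_0$, respectively. Let $L$ be a (finite) point process on $\mathbb R^d$ and assume that $L_0$ is distributed as $WL=\{Wx:x\in L\}$ for a random variable $W>0$ independent of $L$, and that $\tilde L_0$ is distributed as $\tilde WL$ for a random variable $\tilde W\ge0$ independent of $L$. If $\tilde W$ is stochastically smaller than $W$, i.e. $P(\tilde W>t)\le P(W>t)$ for all $t\ge0$, then $Z<_{h-B}\tilde Z$, i.e. the directed $B$-relative empty space hazards satisfy $r_B(t,C)\ge\tilde r_B(t,C)$ for all $t\ge0$ and all Borel sets $C\subset\mathbb R^d$.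
   Context: Distances. $B^*:=\{-x:x\in B\}$. For $x\in\mathbb R^d$ and $K\subset\mathbb R^d$, $d_B(x,K):=\inf\{t\ge 0:(x+tB)\cap K\ne\emptyset\}$ (with $\inf\emptyset=\infty$). If $0<d_B(x,K)<\infty$ and $(x+d_B(x,K)B)\cap K=\{y\}$ is a single point, then $u_B(K,x):=(x-y)/d_B(x,K)\in\partial B^*$. Empty space hazard. For a stationary random closed set $Z$ for which $u_B(Z,0)$ is a.s. well defined on $\{0<d_B(0,Z)<\infty\}$ (this holds here), put $u_B(Z,0):=u_0$ for a fixed $u_0\in\partial B^*$ if $0\in Z$ or $d_B(0,Z)=\infty$, and let $F_B(t,C):=P(d_B(0,Z)\le t,\ u_B(Z,0)\in C)$, $F_B(t):=F_B(t,\mathbb R^d)$. $F_B(\cdot,C)$ is absolutely continuous on $(0,\infty)$; $f_B(\cdot,C)$ denotes its density, taken in the right-continuous version on $[0,\infty)$ (the right-hand derivative of $F_B(\cdot,C)$). The hazard is $r_B(t,C):=f_B(t,C)/(1-F_B(t))$, with $a/0:=0$; $\tilde r_B$ is the hazard of $\tilde Z$. Poisson cluster point process. $N=\bigcup_{x\in\Pi}(L_x+x)$, where $\Pi$ is a stationary Poisson process with intensity $\lambda_\Pi\in(0,\infty)$ and, given $\Pi$, the $L_x$ are i.i.d. finite random point sets distributed as the typical cluster $L_0$; $\gamma:=E\,\mathrm{card}\,L_0\in(0,\infty)$; $N$ has intensity $\lambda_\Pi\gamma$. Standing assumption for both $L_0$ and $\tilde L_0$: the measure $E\big[\sum_{x,y\in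 L_0,\,x\ne y}\mathbf 1\{x-y\in\cdot\}\big]$ (and its analogue for $\tilde L_0$) is absolutely continuous with respect to Lebesgue measure. *)

(* Defs.v *)
From HB Require Import structures.
From mathcomp Require Import all_boot all_order all_algebra.
From mathcomp Require Import all_classical all_reals all_analysis.
Import Order.TTheory GRing.Theory Num.Theory.
Import numFieldNormedType.Exports.

Set Implicit Arguments.
Unset Strict Implicit.
Unset Printing Implicit Defensive.

Local Open Scope classical_set_scope.
Local Open Scope ring_scope.

Definition borel (R : realType) (d : nat) :=
  g_sigma_algebraType (@open 'rV[R]_d).

(* Lebesgue measure on the Borel sets of R^d, as an iterated integral over the
   coordinates (Tonelli); only its values on Borel sets are meaningful. *)
Fixpoint lebesgue_rV (R : realType) (d : nat) : set (borel R d) -> \bar R :=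
  match d with
  | 0%N => fun A => \d_((0 : 'rV[R]_0) : borel R 0) A
  | n.+1 => fun A => (\int[lebesgue_measure]_x
      lebesgue_rV [set v : 'rV[R]_n | A (row_mx (x%:M : 'M[R]_1) v)])%E
  end.

(* A point pattern in R^d is a set of points, and a point process is a random
   variable with values in [config R d], i.e. all its (extended) counts
   card (K `&` A), A Borel, are measurable. *)
Definition counting_event (R : realType) (d : nat) : set (set (set 'rV[R]_d)) :=
  [set E | exists (A : set (borel R d)) (k : nat), measurable A /\
     E = [set K | counting (K `&` A) = k%:R%:E :> \bar R]].

Definition config (R : realType) (d : nat) :=
  g_sigma_algebraType (@counting_event R d).

Definition locally_finite (R : realType) (d : nat) (K : set 'rV[R]_d) :=
  forall A : set 'rV[R]_d, compact A -> finite_set (K `&` A).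

Section gauge.
Context (R : realType) (d : nat) (B : set 'rV[R]_d).
Implicit Types (x y : 'rV[R]_d) (K : set 'rV[R]_d).

Definition reflected : set 'rV[R]_d := [set - x | x in B].

Definition homothet x (t : R) : set 'rV[R]_d := [set x + t *: b | b in B].

Definition gauge_dist x K : \bar R :=
  ereal_inf [set t%:E | t in [set t : R | 0 <= t /\ homothet x t `&` K !=set0]].

Definition contact_point x K y :=
  homothet x (fine (gauge_dist x K)) `&` K = [set y].

(* The value is [u0] whenever the contact direction is not defined: for
   distance 0 or +oo, and also if the contact point is not unique. *)
Definition contact_dir (u0 : 'rV[R]_d) K x : 'rV[R]_d :=
  if pselect ((0 < gauge_dist x K < +oo)%E /\ exists y, contact_point x K y)
  is left _
  then (fine (gauge_dist x K))^-1 *: (x - xget 0 (contact_point x K))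
  else u0.

End gauge.

Definition right_derivative (R : realType) (f : R -> R) (t : R) : R :=
  lim ((h^-1 * (f (t + h) - f t)) @[h --> 0^'+]).

Section empty_space.
Context (disp : measure_display) (Omega : measurableType disp) (R : realType).
Context (d : nat) (P : probability Omega R).
Context (B : set 'rV[R]_d) (u0 : 'rV[R]_d) (Z : Omega -> set 'rV[R]_d).

Definition empty_space_fun (t : R) (C : set 'rV[R]_d) : R :=
  fine (P [set w | (gauge_dist B 0 (Z w) <= t%:E)%E /\
                   C (contact_dir B u0 (Z w) 0)]).

Definition empty_space_density (t : R) (C : set 'rV[R]_d) : R :=
  right_derivative (empty_space_fun ^~ C) t.

(* [x / 0 = 0] in MathComp. *)
Definition empty_space_hazard (t : R) (C : set 'rV[R]_d) : R :=
  empty_space_density t C / (1 - empty_space_fun t setT).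

End empty_space.

Section processes.
Context (disp : measure_display) (Omega : measurableType disp) (R : realType).
Context (P : probability Omega R).

Definition same_law d' (T : measurableType d') (X Y : Omega -> T) :=
  forall E, measurable E -> P (X @^-1` E) = P (Y @^-1` E).

Definition independent2 d1 d2 (T1 : measurableType d1) (T2 : measurableType d2)
    (X : Omega -> T1) (Y : Omega -> T2) :=
  forall E F, measurable E -> measurable F ->
    (P (X @^-1` E `&` Y @^-1` F) = P (X @^-1` E) * P (Y @^-1` F))%E.

Definition mutually_independent d' (T : measurableType d')
    (X : nat -> Omega -> T) :=
  forall (n : nat) (E : nat -> set T), (forall i, measurable (E i)) ->
    P (\bigcap_(i < n) X i @^-1` E i) = (\prod_(i < n) P (X i @^-1` E i))%E.

Definition independent_sequences d1 d2 (T1 : measurableType d1)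
    (T2 : measurableType d2) (X : nat -> Omega -> T1) (Y : nat -> Omega -> T2) :=
  forall (n : nat) (E : nat -> set T1) (F : nat -> set T2),
    (forall i, measurable (E i)) -> (forall i, measurable (F i)) ->
    (P ((\bigcap_(i < n) X i @^-1` E i) `&` (\bigcap_(i < n) Y i @^-1` F i)) =
     P (\bigcap_(i < n) X i @^-1` E i) * P (\bigcap_(i < n) Y i @^-1` F i))%E.

Context (d : nat).

Definition stationary_poisson (lambda : R) (Pi : {RV P >-> config R d}) :=
  (forall w, locally_finite (Pi w)) /\
  forall (n : nat) (A : 'I_n -> set (borel R d)) (k : 'I_n -> nat),
    (forall i, measurable (A i)) ->
    (forall i, lebesgue_rV (A i) < +oo)%E ->
    trivIset setT A ->
    P [set w | forall i, counting (Pi w `&` A i) = (k i)%:R%:E :> \bar R] =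
    (\prod_(i < n) ((lambda * fine (lebesgue_rV (A i))) ^+ k i / (k i)`!%:R *
                    expR (- (lambda * fine (lebesgue_rV (A i))))))%:E.

Definition finite_point_process (L : {RV P >-> config R d}) :=
  forall w, finite_set (L w).

Definition mean_card (L : {RV P >-> config R d}) : \bar R :=
  (\int[P]_w counting (L w : set 'rV[R]_d))%E.

Definition unit_cube : set 'rV[R]_d := [set x | forall j, 0 <= x ord0 j <= 1].

Definition intensity (N : {RV P >-> config R d}) : \bar R :=
  (\int[P]_w counting (N w `&` unit_cube))%E.

(* A |-> E [ sum_(x, y in L, x <> y) 1 {x - y \in A} ]. *)
Definition difference_measure (L : {RV P >-> config R d}) :
    set (borel R d) -> \bar R :=
  fun A => (\int[P]_w counting [set p : 'rV[R]_d * 'rV[R]_d |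
    [/\ L w p.1, L w p.2, p.1 <> p.2 & A (p.1 - p.2)%R]])%E.

Definition typical_cluster (L0 : {RV P >-> config R d}) :=
  [/\ finite_point_process L0,
      (0 < mean_card L0 < +oo)%E &
      difference_measure L0 `<< @lebesgue_rV R d].

(* [x n] enumerates the points of Pi, without repetition (Pi is a.s. infinite),
   and [L n] is the cluster attached to the point [x n]. *)
Definition poisson_cluster_process (Pi L0 N : {RV P >-> config R d}) :=
  (forall w, locally_finite (N w)) /\
  exists (x : nat -> {RV P >-> borel R d}) (L : nat -> {RV P >-> config R d}),
    [/\ (\forall w \ae P, set_bij setT (Pi w : set 'rV[R]_d) (fun n => x n w)),
        (forall n, finite_point_process (L n)) /\
        (forall n, same_law (L n) L0),
        mutually_independent L,
        independent_sequences L x &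
        (\forall w \ae P, (N w : set 'rV[R]_d) =
           \bigcup_n [set (y : 'rV[R]_d) + x n w | y in L n w])].

Definition dilated (W : Omega -> R) (L : Omega -> config R d) :
    Omega -> config R d :=
  fun w => [set W w *: (x : 'rV[R]_d) | x in L w].

End processes.

(* Main.v *)
(* Write [g] for the gauge of [B].  A Poisson cluster process with typical
   cluster [L0] misses a Borel set [A] with probability
   [exp (- lambda * \int P ((L0 + z) meets A) dz)].  When [A] grows from
   [{g <= a}] to [{g <= b}], only the points of a cluster met before all the
   others matter: [y] in [L0] is exposed in the direction [u] if
   [g (a u + (y' - y)) > a] for all the other points [y'] of [L0].  Hitting the
   shell [{a < g <= b}] twice has probability [o(b - a)], so the directed hazard
   at [a] is [lambda * d * a^(d-1)] times the integral, over the directions [u]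
   with [- u] in [C], of the mean number of exposed points of [L0].

   It remains to compare mean numbers of exposed points.  The exposed points of
   [w l] at level [a] correspond to those of [l] at level [a / w], and by
   convexity of [B] there are more and more of them as [w > 0] increases.  At
   [w = 0] a nonempty cluster shrinks to a single exposed point, while for
   [w > 0] a nonempty cluster without ties always has an exposed point.  Hence
   this number is, up to a null set, a nondecreasing function of the dilation
   factor, which gives the inequality under stochastic domination. *)

(* The Poisson process is known only through the joint law of its counts and an enumeration of its
   points. The void probability is therefore a limit of finite products over the enumeration:
   independence of the clusters makes each factor [1 - hit_prob], and the limit is a Laplace
   functional.

   A shell of positive thickness sees exposed points only approximately. Hence [exposed] has a level
   [s] and a separate threshold [c]: on the shell from [a] to [b], the pairs [b, b] and
   [a, 2 * a - b] bound the gain from below and from above. As [b] decreases to [a] both tend to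
   [a, a]; for the second pair ties must be excluded, which absolute continuity of the difference
   measure does.

   Double hits are estimated by first moments alone: for every finite partition into cells, the
   hitting probabilities of the cells add up to at most the first order term for the whole shell.
   Integrals over directions are volume integrals over the cone [shell B C 0 1], and [d * a^(d-1)]
   appears as the sum of the [a ^+ (d.-1 - i) * a ^+ i], which covers [a = 0] too. *)
Require Import Defs.
From HB Require Import structures.
From mathcomp Require Import all_boot all_order all_algebra finmap.
From mathcomp Require Import all_classical all_reals all_analysis.
From mathcomp Require Import measurable_realfun.
From mathcomp Require Import ring lra.
Import Order.TTheory GRing.Theory Num.Theory.
Import numFieldNormedType.Exports.
Local Open Scope classical_set_scope.
Local Open Scope ring_scope.
Set Implicit Arguments.
Unset Strict Implicit.
Unset Printing Implicit Defensive.

(** * Borel sets and Lebesgue measure on R^d *)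

(* [pushforward m f] carries its measure structure only together with a proof that [f] is measurable. *)
Definition image_measure d d' (T1 : measurableType d) (T2 : measurableType d')
    (R : realType) (m : {measure set T1 -> \bar R}) (f : T1 -> T2)
    (mf : measurable_fun setT f) : {measure set T2 -> \bar R} :=
  measure_function_pushforward__canonical__measure_function_Measure m mf.

Section borel_rV.
Context (R : realType).

(** Boxes with rational centres and radii [1 / n.+1] form a countable family. In [measurable_rV],
    the preimage of an open set thus becomes a countable union of finite intersections of coordinate
    events. *)
Lemma open_box_basis d (U : set 'rV[R]_d) : open U ->
  U = \bigcup_(p in [set p : {ffun 'I_d -> rat} * nat |
         [set x : 'rV[R]_d | forall j, `|x ord0 j - ratr (p.1 j)| < p.2.+1%:R^-1] `<=` U])
       [set x : 'rV[R]_d | forall j, `|x ord0 j - ratr (p.1 j)| < p.2.+1%:R^-1].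
Proof.
move=> oU; apply/seteqP; split; last by move=> x [p] /=; apply.
move=> x Ux; have /nbhs_ballP[e /= e0 xeU] := open_nbhs_nbhs (conj oU Ux).
(* Half of [e], because the triangle inequality below passes through the rational centre. *)
have [n ne] : exists n : nat, n.+1%:R^-1 < e / 2 :> R.
  have [n _ /(_ n (leqnn n)) H] := near_infty_natSinv_lt (PosNum (divr_gt0 e0 (ltr0n _ 2))).
  by exists n.
have H j : exists q : rat, `|x ord0 j - ratr q| < n.+1%:R^-1.
  have /rat_in_itvoo[q] : x ord0 j - n.+1%:R^-1 < x ord0 j + n.+1%:R^-1.
    by rewrite ltrBlDr -addrA ltrDl -mulr2n mulrn_wgt0.
  rewrite in_itv/= => /andP[h1 h2]; exists q.
  by rewrite ltr_distl ltrBlDr h2 -ltrBlDr h1.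
have [q Hq] := choice H.
exists ([ffun j => q j], n) => /=; last by move=> j; rewrite ffunE.
move=> y Hy; apply: xeU; split => // i j; rewrite ord1.
have := Hy j; have := Hq j; rewrite ffunE /ball/= => h1 h2.
apply: (le_lt_trans (ler_distD (ratr (q j)) _ _)).
rewrite [e]splitr; apply: ltrD; first exact: lt_trans h1 ne.
by rewrite distrC; exact: lt_trans h2 ne.
Qed.

Lemma measurable_coord d (j : 'I_d) :
  measurable_fun setT (fun v : borel R d => (v : 'rV[R]_d) ord0 j : measurableTypeR R).
Proof.
apply: (measurability _ (RGenOInfty.measurableE R)).
move=> _ [_ [r ->] <-]; rewrite setTI.
apply: sub_sigma_algebra.
have : open ((fun v : 'rV[R]_d => v ord0 j) @^-1` `]r, +oo[%classic).
  apply: open_comp; last exact: interval_open.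
  by move=> v _; exact: coord_continuous.
by [].
Qed.

Lemma measurable_rV dT (T : measurableType dT) d (f : T -> 'rV[R]_d) :
  (forall j, measurable_fun setT (fun t => f t ord0 j)) ->
  measurable_fun setT (f : T -> borel R d).
Proof.
move=> mf; apply: (@measurability _ _ _ (borel R d) _ _ (@open 'rV[R]_d)) => //.
move=> _ [U oU <-]; rewrite setTI (open_box_basis oU) preimage_bigcup.
rewrite bigcup_mkcond; apply: countable_bigcupT_measurable => // p.
case: ifPn => // _.
rewrite (_ : _ @^-1` _ = \bigcap_(j in [set: 'I_d])
    ((fun t => f t ord0 j) @^-1` ball (ratr (p.1 j) : R) p.2.+1%:R^-1)); last first.
  by apply/seteqP; split => [t /= + j _|t /= + j]; move=> /(_ j);
    rewrite /ball/= distrC => //; exact.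
apply: fin_bigcap_measurable => [|j _]; first exact: finite_finset.
by rewrite -[X in measurable X]setTI; apply: mf => //; exact: measurable_ball.
Qed.

Lemma open_borel d (A : set 'rV[R]_d) : open A -> measurable (A : set (borel R d)).
Proof. exact: sub_sigma_algebra. Qed.

Lemma closed_borel d (A : set 'rV[R]_d) : closed A -> measurable (A : set (borel R d)).
Proof. by move=> cA; rewrite -(setCK A); apply: measurableC; apply: open_borel; apply: closed_openC. Qed.

Lemma set1_borel d (x : 'rV[R]_d) : measurable ([set x] : set (borel R d)).
Proof. by apply: closed_borel; apply: accessible_closed_set1; apply: hausdorff_accessible; exact: norm_hausdorff. Qed.

Lemma finite_borel d (K : set 'rV[R]_d) : finite_set K -> measurable (K : set (borel R d)).
Proof.
move=> fK; apply: countable_measurable; last exact: finite_set_countable.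
exact: set1_borel.
Qed.

Section operations.
Context dT (T : measurableType dT) (d : nat).
Implicit Types f g : T -> 'rV[R]_d.

Lemma measurable_rV_coord f (j : 'I_d) : measurable_fun setT (f : T -> borel R d) ->
  measurable_fun setT (fun t => f t ord0 j).
Proof. by move=> mf; exact: (measurableT_comp (measurable_coord j) mf). Qed.

Lemma measurable_rVD f g : measurable_fun setT (f : T -> borel R d) ->
  measurable_fun setT (g : T -> borel R d) ->
  measurable_fun setT ((fun t => f t + g t) : T -> borel R d).
Proof.
move=> mf mg; apply: measurable_rV => j; under eq_fun do rewrite mxE.
by apply: measurable_funD; exact: measurable_rV_coord.
Qed.

Lemma measurable_rVN f : measurable_fun setT (f : T -> borel R d) ->
  measurable_fun setT ((fun t => - f t) : T -> borel R d).
Proof.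
move=> mf; apply: measurable_rV => j; under eq_fun do rewrite mxE.
by apply: measurable_funN; exact: measurable_rV_coord.
Qed.

Lemma measurable_rVB f g : measurable_fun setT (f : T -> borel R d) ->
  measurable_fun setT (g : T -> borel R d) ->
  measurable_fun setT ((fun t => f t - g t) : T -> borel R d).
Proof. by move=> mf mg; apply: measurable_rVD => //; exact: measurable_rVN. Qed.

Lemma measurable_rVZ (h : T -> R) f : measurable_fun setT h ->
  measurable_fun setT (f : T -> borel R d) ->
  measurable_fun setT ((fun t => h t *: f t) : T -> borel R d).
Proof.
move=> mh mf; apply: measurable_rV => j; under eq_fun do rewrite mxE.
by apply: measurable_funM => //; exact: measurable_rV_coord.
Qed.

Lemma measurable_eq_rV f g : measurable_fun setT (f : T -> borel R d) ->
  measurable_fun setT (g : T -> borel R d) -> measurable [set t | f t = g t].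
Proof.
move=> mf mg; rewrite (_ : [set t | _] = setT `&` (fun t => f t - g t) @^-1` [set 0]).
  by apply: (measurable_rVB mf mg) => //; exact: set1_borel.
rewrite setTI; apply/seteqP; split => t /=; first by move=> ->; rewrite subrr.
by move/eqP; rewrite subr_eq0 => /eqP.
Qed.

End operations.

Lemma measurable_row_mx n :
  measurable_fun setT ((fun p => row_mx ((p.1 : R)%:M : 'M[R]_1) (p.2 : 'rV[R]_n)) :
    (measurableTypeR R * borel R n)%type -> borel R n.+1).
Proof.
apply: (@measurable_rV _ _ n.+1) => j; case: (@splitP 1 n j) => k jk.
  rewrite (_ : (fun _ => _) = fst) //; apply/funext => p.
  rewrite (_ : j = lshift n k); last exact/val_inj.
  by rewrite (row_mxEl ((p.1 : R)%:M : 'M[R]_1)) ord1 mxE ord1 eqxx mulr1n.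
rewrite (_ : (fun _ => _) = (fun v : borel R n => (v : 'rV[R]_n) ord0 k) \o snd).
  exact: (measurableT_comp (measurable_coord k)).
apply/funext => p; rewrite (_ : j = rshift 1 k); last exact/val_inj.
by rewrite (row_mxEr ((p.1 : R)%:M : 'M[R]_1)).
Qed.

End borel_rV.

Section lebesgue_rV_measure.
Context (R : realType).
Local Open Scope ereal_scope.

Lemma lebesgue_rVS n (A : set (borel R n.+1)) :
  lebesgue_rV A = \int[lebesgue_measure]_x
    lebesgue_rV [set v : 'rV[R]_n | A (row_mx (x%:M : 'M[R]_1) v)].
Proof. by []. Qed.

Definition cube n (k : nat) : set 'rV[R]_n :=
  [set v | forall j, (v ord0 j \in `[- k%:R, k%:R])%R].
Arguments cube : clear implicits.

Lemma measurable_cube n k : measurable (cube n k : set (borel R n)).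
Proof.
rewrite (_ : cube n k = \bigcap_(j in [set: 'I_n])
  ((fun v : borel R n => (v : 'rV[R]_n) ord0 j) @^-1` `[(- k%:R)%R, k%:R%R]%classic)).
  apply: fin_bigcap_measurable => [|j _]; first exact: finite_finset.
  rewrite -[X in measurable X]setTI; apply: measurable_coord => //.
by apply/seteqP; split => [t /= + j _|t /= + j]; move=> /(_ j) //; apply.
Qed.

Lemma cube_cover n : \bigcup_k cube n k = setT.
Proof.
rewrite -subTset => v _.
pose m := \big[Order.max/0%R]_(j < n) `|v ord0 j|%R.
have [k] : exists k : nat, (m <= k%:R)%R.
  exists (Num.bound m); apply/ltW/archi_boundP.
  by rewrite /m; elim/big_ind: _ => // x y x0 y0; rewrite le_max x0.
move=> mk; exists k => // j; rewrite in_itv/= -ler_norml.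
by apply: le_trans mk; rewrite /m; apply: le_bigmax_cond.
Qed.

(** The iterated integral is identified with the image of a product measure. Sigma-finiteness is
    carried through the induction because the product in the next dimension requires it; the finite
    measure of cubes is what preserves it. *)
Lemma lebesgue_rV_measureP n : exists mu : {sigma_finite_measure set (borel R n) -> \bar R},
  (forall A, measurable A -> mu A = lebesgue_rV A) /\ forall k, mu (cube n k) < +oo.
Proof.
elim: n => [|n [mu [muE mu_cube]]].
  exists (\d_((0%R : 'rV[R]_0) : borel R 0)); split => // k.
  by rewrite (le_lt_trans (probability_le1 _ _)) ?ltry//; exact: measurable_cube.
pose phi : measurableTypeR R * borel R n -> borel R n.+1 :=
  fun p => row_mx (((p.1 : R)%:M)%R : 'M[R]_1) (p.2 : 'rV[R]_n).
have mphi : measurable_fun setT phi := @measurable_row_mx R n.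
pose nu : {measure set (borel R n.+1) -> \bar R} := image_measure (lebesgue_measure \x mu) mphi.
have nuE A : measurable A -> nu A = lebesgue_rV A.
  move=> mA; rewrite lebesgue_rVS /nu /= /pushforward /product_measure1 /=.
  apply: eq_integral => x _; rewrite muE.
    by congr (lebesgue_rV _); apply/seteqP; split => v /=; rewrite /xsection /= inE.
  by apply: measurable_xsection; rewrite -[X in measurable X]setTI; exact: (mphi measurableT _ mA).
have nu_cube k : nu (cube n.+1 k) < +oo.
  rewrite nuE; last exact: measurable_cube.
  rewrite lebesgue_rVS.
  have cubeS (x : R) v : cube n.+1 k (row_mx (x%:M : 'M[R]_1) v) <->
      `[(- k%:R)%R, k%:R%R]%classic x /\ cube n k v.
    split=> [H|[Hx Hv] j].
      split=> [|j].
        have := H (lshift n (ord0 : 'I_1)); rewrite (row_mxEl (x%:M : 'M[R]_1)).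
        by rewrite mxE ord1 eqxx mulr1n.
      by have := H (@rshift 1 n j); rewrite (row_mxEr (x%:M : 'M[R]_1)).
    case: (@splitP 1 n j) => i ji.
      rewrite (_ : j = lshift n i); last exact/val_inj.
      by rewrite (row_mxEl (x%:M : 'M[R]_1)) ord1 mxE ord1 eqxx mulr1n.
    rewrite (_ : j = rshift 1 i); last exact/val_inj.
    by rewrite (row_mxEr (x%:M : 'M[R]_1)).
  pose I : set (measurableTypeR R) := `[(- k%:R)%R, k%:R%R]%classic.
  have mI : measurable I by exact: measurable_itv.
  (* A section of the cube is a cube of one dimension less or empty, according to the first
     coordinate. *)
  rewrite (eq_integral (fun x => mu (cube n k) * (\1_I x)%:E)).
    rewrite ge0_integralZl//; last first.
      exact/measurable_EFinP/measurable_indic.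
    rewrite integral_indic//= setIT; apply: lte_mul_pinfty => //.
      by rewrite ge0_fin_numE.
    by apply: compact_finite_measure; exact: segment_compact.
  move=> x _; rewrite indicE; have [xk|xk] := boolP (x \in _).
    rewrite mule1 muE; last exact: measurable_cube.
    congr (lebesgue_rV _); apply/seteqP; split => v /=; first by case/cubeS.
    by move=> kv; apply/cubeS; split => //; rewrite inE in xk.
  rewrite mule0 (_ : [set v | _] = set0).
    by rewrite -muE ?measure0.
  by apply/seteqP; split => v //= /cubeS[/mem_set]; rewrite (negbTE xk).
have nu_sf : sigma_finite setT nu.
  exists (fun k => cube n.+1 k); first by rewrite cube_cover.
  by move=> k; split; [exact: measurable_cube|exact: nu_cube].
pose nu' : {sigma_finite_measure set (borel R n.+1) -> \bar R} :=
  HB.pack (nu : set _ -> \bar R) (Measure.on nu) (Measure_isSigmaFinite.Build _ _ _ nu nu_sf).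
by exists nu'.
Qed.
End lebesgue_rV_measure.
Arguments cube : clear implicits.

Section lebesgue_rV_instance.
Context (R : realType) (d : nat).
Local Open Scope ereal_scope.
Let leb : set (borel R d) -> \bar R := @lebesgue_rV R d.

Lemma lebesgue_rV0 : leb set0 = 0.
Proof. by have [mu [muE _]] := lebesgue_rV_measureP R d; rewrite /leb -muE// measure0. Qed.

(** The measure interface asks for this on all sets, Borel or not, so the argument goes through the
    definition and not through [lebesgue_rV_measureP]. *)
Lemma lebesgue_rV_ge0 A : 0 <= leb A.
Proof.
rewrite /leb; elim: d A => [|n IH] A /=; first exact: measure_ge0.
by apply: integral_ge0 => x _; exact: IH.
Qed.

Lemma lebesgue_rV_sigma_additive : semi_sigma_additive leb.
Proof.
have [mu [muE _]] := lebesgue_rV_measureP R d.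
move=> F mF tF mU; rewrite [leb _](esym (muE _ mU)).
rewrite (_ : (fun n => _) = (fun n => \sum_(0 <= i < n) mu (F i))).
  exact: measure_semi_sigma_additive.
by apply/funext => n; apply: eq_bigr => i _; rewrite muE.
Qed.

HB.instance Definition _ := isMeasure.Build _ _ _ (@lebesgue_rV R d)
  lebesgue_rV0 lebesgue_rV_ge0 lebesgue_rV_sigma_additive.

Lemma lebesgue_rV_cube k : lebesgue_rV (cube R d k : set (borel R d)) < +oo.
Proof.
have [mu [muE mu_cube]] := lebesgue_rV_measureP R d.
by rewrite -muE//; exact: measurable_cube.
Qed.

Lemma lebesgue_rV_sigma_finite : sigma_finite setT leb.
Proof.
exists (fun k => cube R d k); first by rewrite cube_cover.
by move=> k; split; [exact: measurable_cube|exact: lebesgue_rV_cube].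
Qed.

HB.instance Definition _ := Measure_isSigmaFinite.Build _ _ _ (@lebesgue_rV R d)
  lebesgue_rV_sigma_finite.

End lebesgue_rV_instance.

Section affine.
Context (R : realType).
Local Open Scope ereal_scope.
Implicit Types r : R.

(** The pushforward rescaled by [r] agrees with Lebesgue measure on half-open intervals, and
    uniqueness extends this to all Borel sets. *)
Lemma lebesgue_measure_affine r c (A : set (measurableTypeR R)) : (0 < r)%R -> measurable A ->
  lebesgue_measure ([set x | A (r * x + c)%R] : set (measurableTypeR R)) =
  r^-1%:E * lebesgue_measure A.
Proof.
move=> r0 mA; have rN0 : r != 0%R by rewrite gt_eqF.
pose f : measurableTypeR R -> measurableTypeR R := fun x => (r * x + c)%R.
have mf : measurable_fun setT f.
  by apply: measurable_funD => //; exact: mulrl_measurable.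
pose nu : {measure set (measurableTypeR R) -> \bar R} :=
  mscale (NngNum (ltW r0)) (image_measure lebesgue_measure mf).
suff nuE : lebesgue_measure A = nu A.
  rewrite [in RHS]nuE /nu /= /mscale /= muleA -EFinM mulVf// mul1e.
  by rewrite /pushforward.
apply: (@lebesgue_measure_unique _ nu) => // _ [[a b]] _ <- /=.
rewrite /nu /mscale/= /pushforward.
rewrite (_ : f @^-1` _ = `]((a - c) / r)%R, ((b - c) / r)%R]%classic); last first.
  apply/seteqP; split => x /=; rewrite !in_itv /f /=.
    by rewrite ltr_pdivrMr// ler_pdivlMr// ltrBlDr lerBrDr mulrC.
  by rewrite ltr_pdivrMr// ler_pdivlMr// ltrBlDr lerBrDr mulrC.
rewrite !lebesgue_measure_itv/= !lte_fin.
rewrite ltr_pM2r ?invr_gt0// ltrD2r; case: ifPn => // ab; last by rewrite mule0.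
rewrite -!EFinB -EFinM; congr EFin; field.
by [].
Qed.

Lemma ge0_integral_affine r c (f : measurableTypeR R -> \bar R) : (0 < r)%R ->
  measurable_fun setT f -> (forall x, 0 <= f x) ->
  \int[lebesgue_measure]_x f (r * x + c)%R =
  r^-1%:E * \int[lebesgue_measure]_x f x.
Proof.
move=> r0 mf f0.
pose g : measurableTypeR R -> measurableTypeR R := fun x => (r * x + c)%R.
have mg : measurable_fun setT g.
  by apply: measurable_funD => //; exact: mulrl_measurable.
have rV0 : (0 <= r^-1)%R by rewrite invr_ge0 ltW.
have := @ge0_integral_pushforward _ _ _ _ R g mg lebesgue_measure setT f measurableT mf (fun y _ => f0 y).
rewrite preimage_setT /comp /= => <-.
rewrite -(ge0_integral_mscale _ _ (NngNum rV0)) //.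
apply: eq_measure_integral => A mA _.
exact: lebesgue_measure_affine.
Qed.

Lemma measurable_lebesgue_rV_section n (A : set (borel R n.+1)) : measurable A ->
  measurable_fun setT (fun x : measurableTypeR R =>
    lebesgue_rV [set v : 'rV[R]_n | A (row_mx (x%:M : 'M[R]_1) v)]).
Proof.
move=> mA; have mB : measurable ((fun p : measurableTypeR R * borel R n =>
    row_mx ((p.1 : R)%:M : 'M[R]_1) (p.2 : 'rV[R]_n) : borel R n.+1) @^-1` A).
  by rewrite -[X in measurable X]setTI; apply: measurable_row_mx.
have := measurable_fun_xsection (@lebesgue_rV R n) mB.
apply: eq_measurable_fun => x _ /=; congr (lebesgue_rV _).
by apply/seteqP; split => v; rewrite /xsection /= inE.
Qed.

(** Induction on [d]: a section of the affine preimage is the affine preimage of a section, which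
    yields [r^-1 ^+ n]; the change of variables in the first coordinate yields the last factor. *)
Lemma lebesgue_rV_affine d r c (A : set (borel R d)) : (0 < r)%R -> measurable A ->
  lebesgue_rV ([set x : 'rV[R]_d | A (r *: x + c)%R] : set (borel R d)) =
  (r^-1 ^+ d)%:E * lebesgue_rV A.
Proof.
move=> r0; elim: d c A => [|n IH] c A mA.
  have E (x y : 'rV[R]_0) : x = y by rewrite (thinmx0 x) (thinmx0 y).
  rewrite expr0 mul1e /=; congr (\d_ _ _); apply/seteqP.
  by split => x /=; rewrite (E (r *: x + c)%R x).
rewrite !lebesgue_rVS.
pose c0 : R := c ord0 ord0.
pose c' : 'rV[R]_n := @rsubmx _ 1 1 n c.
have cE : c = row_mx (c0%:M : 'M[R]_1) c'.
  rewrite -[LHS](@hsubmxK _ 1 1 n c) (_ : @lsubmx _ 1 1 n c = c0%:M)//.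
  by apply/matrixP => i j; rewrite !ord1 !mxE eqxx mulr1n; congr (c _ _); exact/val_inj.
have secE (x : R) : [set v : 'rV[R]_n | A (r *: row_mx (x%:M : 'M[R]_1) v + c)%R] =
    [set v : 'rV[R]_n | [set w : 'rV[R]_n | A (row_mx ((r * x + c0)%:M : 'M[R]_1) w)] (r *: v + c')%R].
  by apply/seteqP; split => v /=;
    rewrite cE scale_row_mx add_row_mx scale_scalar_mx -raddfD.
have mS (x : R) : measurable ([set w : 'rV[R]_n | A (row_mx (x%:M : 'M[R]_1) w)] : set (borel R n)).
  have mB : measurable ((fun p : measurableTypeR R * borel R n =>
      row_mx ((p.1 : R)%:M : 'M[R]_1) (p.2 : 'rV[R]_n) : borel R n.+1) @^-1` A).
    by rewrite -[X in measurable X]setTI; apply: measurable_row_mx.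
  have := measurable_xsection x mB.
  by congr measurable; apply/seteqP; split => v; rewrite /xsection /= inE.
under eq_integral => x _ do rewrite secE IH//.
have rV0 : (0 <= r^-1 ^+ n)%R by rewrite exprn_ge0// invr_ge0 ltW.
have mG := measurable_lebesgue_rV_section mA.
rewrite ge0_integralZl//; last first.
  by apply: (measurableT_comp mG); apply: measurable_funD => //; exact: mulrl_measurable.
rewrite (ge0_integral_affine c0 r0 mG)//.
by rewrite muleA -EFinM exprS mulrC.
Qed.

Lemma ge0_integral_rV_affine d r c (f : borel R d -> \bar R) : (0 < r)%R ->
  measurable_fun setT f -> (forall x, 0 <= f x) ->
  \int[@lebesgue_rV R d]_x f (r *: (x : 'rV[R]_d) + c)%R =
  (r^-1 ^+ d)%:E * \int[@lebesgue_rV R d]_x f x.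
Proof.
move=> r0 mf f0.
pose g : borel R d -> borel R d := fun x => (r *: (x : 'rV[R]_d) + c)%R.
have mg : measurable_fun setT g.
  by apply: measurable_rVD => //; apply: measurable_rVZ.
have rV0 : (0 <= r^-1 ^+ d)%R by rewrite exprn_ge0// invr_ge0 ltW.
have := @ge0_integral_pushforward _ _ _ _ R g mg (@lebesgue_rV R d) setT f measurableT mf (fun y _ => f0 y).
rewrite preimage_setT /comp /= => <-.
rewrite -(ge0_integral_mscale _ _ (NngNum rV0)) //.
apply: eq_measure_integral => A mA _.
exact: lebesgue_rV_affine.
Qed.

End affine.

(** * Gauges *)

(** The Minkowski functional of [B], written with [homothet] to match [gauge_dist]. It need not be
    symmetric, since [B] need not be. *)
Definition gauge (R : realType) d (B : set 'rV[R]_d) (z : 'rV[R]_d) : R :=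
  inf [set t | 0 <= t /\ homothet B 0 t z].

Section gauge.
Context (R : realType) (d : nat) (B : set 'rV[R]_d).
Hypothesis B_compact : compact B.
Hypothesis B_convex : convex_set (B : set (convex_lmodType 'rV[R]_d)).
Hypothesis B_nbhs0 : nbhs (0 : 'rV[R]_d) B.
Local Notation g := (gauge B).
Implicit Types (z w : 'rV[R]_d) (s t : R).

Lemma body_conv x y k : B x -> B y -> 0 <= k -> k <= 1 -> B (k *: x + (1 - k) *: y).
Proof.
move=> Bx By k0 k1.
have k01 : (0 <= k <= 1) by rewrite k0.
have := @B_convex x y (Itv01 k0 k1); rewrite !inE => /(_ Bx By).
by [].
Qed.

Lemma body0 : B 0. Proof. exact: nbhs_singleton. Qed.

Lemma homothet0E t z : homothet B 0 t z <-> exists2 b, B b & z = t *: b.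
Proof. by split=> [[b Bb <-]|[b Bb ->]]; exists b; rewrite ?add0r. Qed.

(** The sets [t B] increase with [t]: a point of [s B] is [t] times a convex combination of a point
    of [B] and [0]. *)
Lemma homothet_le s t z : 0 <= s -> s <= t -> homothet B 0 s z -> homothet B 0 t z.
Proof.
move=> s0 st /homothet0E[b Bb ->]; apply/homothet0E.
have [t0|t0] := eqVneq t 0.
  by exists 0; [exact: body0|rewrite scaler0 (_ : s = 0) ?scale0r//; apply/eqP; rewrite eq_le s0 -t0 st].
have tp : 0 < t by rewrite lt_def t0 (le_trans s0 st).
exists ((s / t) *: b); last by rewrite scalerA mulrCA mulfV// mulr1.
have := body_conv Bb body0 (divr_ge0 s0 (ltW tp)) _.
by rewrite scaler0 addr0 ler_pdivrMr// mul1r; apply.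
Qed.

Lemma ball_body : exists2 e : R, 0 < e & forall z, `|z| < e -> B z.
Proof.
have /nbhs_ballP[e /= e0 eB] := B_nbhs0; exists e => // z ze; apply: eB.
by rewrite -ball_normE /= sub0r normrN.
Qed.

Lemma body_bounded : exists2 M : R, 0 < M & forall z, B z -> `|z| <= M.
Proof.
have [N [_ HN]] := compact_bounded B_compact.
exists (`|N| + 1); first by rewrite ltr_wpDl.
by apply: HN; rewrite (le_lt_trans (ler_norm N))// ltrDl.
Qed.

(** The factor [2] puts the rescaled vector at norm [e / 2], strictly inside the ball of radius
    [e]. *)
Lemma norm_homothet e z : 0 < e -> (forall z, `|z| < e -> B z) ->
  homothet B 0 (2 / e * `|z|) z.
Proof.
move=> e0 eB; apply/homothet0E; have [->|z0] := eqVneq z 0.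
  by exists 0; [exact: body0|rewrite scaler0].
have nz : 0 < `|z| by rewrite normr_gt0.
exists ((2 / e * `|z|)^-1 *: z); last first.
  by rewrite scalerA mulfV ?scale1r// gt_eqF// mulr_gt0// divr_gt0.
apply: eB; rewrite normrZ normfV gtr0_norm; last by rewrite mulr_gt0// divr_gt0.
rewrite invfM -mulrA mulVf ?gt_eqF// mulr1 invf_div ltr_pdivrMr// ltr_pMr//.
by rewrite ltr1n.
Qed.

Lemma gauge_set_has_inf z : has_inf [set t | 0 <= t /\ homothet B 0 t z].
Proof.
split; last by exists 0 => t [].
have [e e0 eB] := ball_body.
exists (2 / e * `|z|); split; last exact: norm_homothet.
by rewrite mulr_ge0// divr_ge0// ltW.
Qed.

Lemma gauge_ge0 z : 0 <= g z.
Proof. by apply: lb_le_inf => [|t []//]; have [] := gauge_set_has_inf z. Qed.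

Lemma gauge_le_homothet z t : 0 <= t -> homothet B 0 t z -> g z <= t.
Proof. by move=> t0 Bt; apply: ge_inf => //; have [] := gauge_set_has_inf z. Qed.

Lemma gauge_lt_homothet z t : g z < t -> homothet B 0 t z.
Proof.
move=> gt; have e0 : 0 < t - g z by rewrite subr_gt0.
have [s [s0 Bs]] := inf_adherent e0 (gauge_set_has_inf z).
by rewrite addrC subrK => st; apply: homothet_le Bs => //; exact: ltW.
Qed.

(** The infimum is attained. If it is [0], boundedness of [B] forces [z = 0]; otherwise
    [(g z)^-1 *: z] is a limit of points of the closed set [B]. *)
Lemma homothet_gauge z : homothet B 0 (g z) z.
Proof.
have [g0|g0] := eqVneq (g z) 0.
  have [M M0 HM] := body_bounded.
  have z0 : z = 0.
    apply/eqP; rewrite -normr_le0; apply/ler_addgt0Pr => e e0; rewrite add0r.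
    have : g z < e / M by rewrite g0 divr_gt0.
    move=> /gauge_lt_homothet/homothet0E[b /HM bM ->].
    rewrite normrZ gtr0_norm ?divr_gt0//.
    by rewrite -mulrA ler_piMr// ?(ltW e0)// mulrC ler_pdivrMr ?mul1r.
  by apply/homothet0E; exists 0; [exact: body0|rewrite z0 scaler0].
have gp : 0 < g z by rewrite lt_def g0 gauge_ge0.
apply/homothet0E; exists ((g z)^-1 *: z); last by rewrite scalerA mulfV// scale1r.
have Bc : closed B by apply: compact_closed => //; exact: norm_hausdorff.
pose u (n : nat) : 'rV[R]_d := (g z + n.+1%:R^-1)^-1 *: z.
have uB n : B (u n).
  have gn : g z < g z + n.+1%:R^-1 by rewrite ltrDl invr_gt0.
  have /homothet0E[b Bb zE] := gauge_lt_homothet gn.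
  by rewrite /u {2}zE scalerA mulVf ?scale1r// gt_eqF// (lt_trans gp).
have uc : u n @[n --> \oo] --> (g z)^-1 *: z.
  apply: cvgZr_tmp; apply: cvgV => //.
  rewrite -[X in _ --> X]addr0; apply: cvgD; first exact: cvg_cst.
  exact: cvg_harmonic.
by apply: (closed_cvg _ Bc _ _ uc); exact: nearW.
Qed.

Lemma gauge_leP z t : 0 <= t -> (g z <= t) <-> exists2 b, B b & z = t *: b.
Proof.
move=> t0; rewrite -homothet0E; split; last exact: gauge_le_homothet.
by move=> gt; apply: homothet_le gt (homothet_gauge z); exact: gauge_ge0.
Qed.

Lemma gauge0 : g 0 = 0.
Proof.
apply/eqP; rewrite eq_le gauge_ge0 andbT; apply/(gauge_leP _ (lexx 0)).
by exists 0; [exact: body0|rewrite scaler0].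
Qed.

Lemma gauge_eq0 z : (g z == 0) = (z == 0).
Proof.
apply/eqP/eqP => [g0|->]; last exact: gauge0.
by have /homothet0E[b _ ->] := homothet_gauge z; rewrite g0 scale0r.
Qed.

Lemma gauge_gt0 z : (0 < g z) = (z != 0).
Proof. by rewrite lt_def gauge_eq0 gauge_ge0 andbT. Qed.

Lemma gaugeZ_le r z : 0 <= r -> g (r *: z) <= r * g z.
Proof.
move=> r0; apply/gauge_leP; first by rewrite mulr_ge0// gauge_ge0.
have /homothet0E[b Bb {1}->] := homothet_gauge z.
by exists b => //; rewrite scalerA.
Qed.

Lemma gaugeZ r z : 0 <= r -> g (r *: z) = r * g z.
Proof.
move=> r0; have [->|rN0] := eqVneq r 0; first by rewrite scale0r mul0r gauge0.
have rp : 0 < r by rewrite lt_def rN0.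
apply/eqP; rewrite eq_le gaugeZ_le//= -ler_pdivlMl//.
have rV0 : 0 <= r^-1 by rewrite invr_ge0.
by rewrite (le_trans _ (gaugeZ_le _ rV0))// scalerA mulVf// scale1r.
Qed.

Lemma gaugeD z w : g (z + w) <= g z + g w.
Proof.
have /homothet0E[b Bb] := homothet_gauge z.
have /homothet0E[c Bc] := homothet_gauge w.
move: (g z) (g w) (gauge_ge0 z) (gauge_ge0 w) => s t s0 t0 -> ->.
apply/gauge_leP; first exact: addr_ge0.
have [st0|st0] := eqVneq (s + t) 0.
  exists 0; first exact: body0.
  move: st0 => /eqP; rewrite paddr_eq0// => /andP[/eqP-> /eqP->].
  by rewrite !scale0r scaler0 addr0.
have stp : 0 < s + t by rewrite lt_def st0 addr_ge0.
(* The weights of the convex combination are proportional to the two gauges. *)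
exists (s / (s + t) *: b + (1 - s / (s + t)) *: c).
  apply: body_conv => //; first by rewrite divr_ge0// ltW.
  by rewrite ler_pdivrMr// mul1r lerDl.
rewrite scalerDr !scalerA mulrCA mulfV// mulr1 mulrBr mulrCA mulfV// !mulr1.
by rewrite addrAC subrr add0r.
Qed.

Lemma gauge_le_norm : exists2 M : R, 0 < M & forall z, g z <= M * `|z|.
Proof.
have [e e0 eB] := ball_body; exists (2 / e); first by rewrite divr_gt0.
move=> z; apply: gauge_le_homothet; last exact: norm_homothet.
by rewrite mulr_ge0// divr_ge0// ltW.
Qed.

Lemma norm_le_gauge : exists2 M : R, 0 < M & forall z, `|z| <= M * g z.
Proof.
have [M M0 HM] := body_bounded; exists M => // z.
have /homothet0E[b /HM bM {1}->] := homothet_gauge z.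
by rewrite normrZ ger0_norm ?gauge_ge0// mulrC ler_wpM2r// gauge_ge0.
Qed.

Lemma gauge_ball_compact t : 0 <= t -> compact [set z | g z <= t].
Proof.
move=> t0; rewrite (_ : [set z | _] = *:%R t @` B); last first.
  apply/seteqP; split => z /=; first by move/gauge_leP => /(_ t0)[b Bb ->]; exists b.
  by case=> b Bb <-; apply/gauge_leP => //; exists b.
apply: continuous_compact => //; apply: continuous_subspaceT.
exact: scaler_continuous.
Qed.

Lemma closed_gauge_ball t : closed [set z | g z <= t].
Proof.
have [t0|t0] := leP 0 t.
  by apply: compact_closed; [exact: norm_hausdorff|exact: gauge_ball_compact].
rewrite (_ : [set z | _] = set0); first exact: closed0.
by apply/seteqP; split => z //= gt; have := gauge_ge0 z; rewrite leNgt (le_lt_trans gt t0).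
Qed.

Lemma measurable_gauge : measurable_fun setT (g : borel R d -> measurableTypeR R).
Proof.
apply: (measurability _ (RGenOInfty.measurableE R)).
move=> _ [_ [t ->] <-]; rewrite setTI.
rewrite (_ : _ @^-1` _ = ~` [set z | g z <= t]); last first.
  by apply/seteqP; split => z /=; rewrite in_itv/= andbT ltNge; move/negP.
by apply: measurableC; apply: closed_borel; exact: closed_gauge_ball.
Qed.

Lemma lebesgue_gauge_ball t : (lebesgue_rV ([set z | (g z <= t)%R] : set (borel R d)) < +oo)%E.
Proof.
have [M M0 HM] := norm_le_gauge.
have [k kt] : exists k : nat, M * t <= k%:R.
  by exists (Num.bound `|M * t|); rewrite (le_trans (ler_norm _))// ltW// archi_boundP.
have sub : [set z | g z <= t] `<=` cube R d k.
  move=> z /= gt j; rewrite in_itv/= -ler_norml.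
  apply: le_trans kt; apply: le_trans (_ : `|z| <= _).
    by rewrite [leRHS]/Num.norm/= mx_normrE; apply: (le_bigmax_cond _ (fun i => `|z i.1 i.2|) (j := (ord0, j))).
  by rewrite (le_trans (HM z))// ler_pM2l.
apply: le_lt_trans (lebesgue_rV_cube R d k); apply: le_measure => //; rewrite inE.
  by apply: closed_borel; exact: closed_gauge_ball.
exact: measurable_cube.
Qed.

End gauge.

(** * Counting points of random finite sets *)

Section counting.
Context (T : choiceType) (R : realType).
Local Open Scope ereal_scope.
Implicit Types K A : set T.

Lemma counting_finite K : finite_set K ->
  counting K = (#|` fset_set K|)%:R%:E :> \bar R.
Proof. by move=> fK; rewrite /counting asboolT. Qed.

Lemma counting_ge0 K : 0 <= counting K :> \bar R.
Proof. by rewrite /counting; case: ifP => _; rewrite ?lee_fin// leey. Qed.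

Lemma counting_nat K : counting K = +oo :> \bar R \/ exists k : nat, counting K = k%:R%:E :> \bar R.
Proof. by rewrite /counting; case: ifP => _; [right; eexists|left]. Qed.

Lemma counting_sum K A : finite_set K ->
  counting (K `&` A) = \sum_(y <- fset_set K) (\1_A y)%:E :> \bar R.
Proof.
move=> fK; have fKA : finite_set (K `&` A) by exact: finite_setIl.
rewrite (counting_finite fKA) sumEFin; congr EFin.
rewrite (eq_bigr (fun y => (y \in A)%:R)); last by move=> y _; rewrite indicE.
rewrite -natr_sum -big_mkcond sum1_count -size_filter; congr (_%:R).
apply/esym/perm_size/uniq_perm; rewrite ?filter_uniq// => y.
by rewrite mem_filter !in_fset_set// in_setI andbC.
Qed.

Lemma counting_eq0 K : (counting K = 0 :> \bar R) <-> K = set0.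
Proof.
split=> [|->]; last by rewrite counting_finite ?fset_set0.
rewrite /counting; case: ifPn => // /asboolP fK [] /eqP.
by rewrite pnatr_eq0 cardfs_eq0 => /eqP H; rewrite -(fset_setK fK) H; apply/seteqP; split.
Qed.

Lemma le_counting K A : K `<=` A -> counting K <= counting A :> \bar R.
Proof.
move=> KA; rewrite /counting; case: ifPn => fK; case: ifPn => fA; rewrite ?leey//.
  by rewrite lee_fin ler_nat; apply: fsubset_leq_card; rewrite -fset_set_sub//; exact/asboolP.
move/asboolP: fA => fA; move/asboolP: fK => []; exact: sub_finite_set fA.
Qed.

Lemma counting_ge1 K : K !=set0 -> 1 <= counting K :> \bar R.
Proof.
move=> [x Kx]; rewrite /counting; case: ifPn => [/asboolP fK|_]; last by rewrite leey.
by rewrite lee_fin ler1n cardfs_gt0; apply/fset0Pn; exists x; rewrite in_fset_set//; exact: mem_set.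
Qed.
End counting.

Section config_measurability.
Context (R : realType) (d : nat).
Local Open Scope ereal_scope.

(** The generating events prescribe finite counts; the value [+oo] is reached as the complement of
    their countable union. *)
Lemma measurable_counting_config (A : set (borel R d)) : measurable A ->
  measurable_fun setT (fun K : config R d => counting ((K : set 'rV[R]_d) `&` A) : \bar R).
Proof.
move=> mA _ S mS; rewrite setTI.
pose c := fun K : config R d => counting ((K : set 'rV[R]_d) `&` A) : \bar R.
have mk k : measurable (c @^-1` [set k%:R%:E] : set (config R d)).
  by apply: sub_sigma_algebra; exists A, k.
rewrite (_ : _ @^-1` _ = (\bigcup_(k in [set k : nat | S k%:R%:E]) c @^-1` [set k%:R%:E]) `|`
    (if `[< S +oo >] then ~` (\bigcup_k c @^-1` [set k%:R%:E]) else set0)).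
  apply: measurableU; first exact: bigcup_measurable.
  by case: ifPn => _ //; apply: measurableC; exact: bigcup_measurable.
apply/seteqP; split => K /=.
  move=> SK; have [Ky|[k Kk]] := counting_nat R ((K : set 'rV[R]_d) `&` A).
    right; rewrite ifT; last by apply/asboolP; rewrite -Ky.
    by move=> [k _]; rewrite /c /= Ky.
  by left; exists k => //=; rewrite -Kk.
move=> [[k Sk /=]|]; first by rewrite /c => ->.
case: ifPn => // /asboolP Sy H.
have [->//|[k Kk]] := counting_nat R ((K : set 'rV[R]_d) `&` A).
by exfalso; apply: H; exists k.
Qed.

Section kernel.
Context dX (X : measurableType dX) (phi : X -> config R d).
Hypothesis mphi : measurable_fun setT phi.
Hypothesis fphi : forall x, finite_set (phi x : set 'rV[R]_d).

Let Kc (x : X) : {measure set (borel R d) -> \bar R} :=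
  mrestr (counting : {measure set (borel R d) -> \bar R}) (finite_borel (fphi x)).

(** The counting measures on the sets [phi x] have no common bound on their mass. Setting them to
    zero beyond [n] points gives a finite kernel, for which section measurability is available; for
    each [x] the cut-off is inactive once [n] is large. *)
Let kern (n : nat) (x : X) : {measure set (borel R d) -> \bar R} :=
  if counting (phi x : set 'rV[R]_d) <= n%:R%:E :> \bar R then Kc x else mzero.

Lemma measurable_count_rv (A : set (borel R d)) : measurable A ->
  measurable_fun setT (fun x => counting ((phi x : set 'rV[R]_d) `&` A) : \bar R).
Proof. by move=> mA; exact: (measurableT_comp (measurable_counting_config mA) mphi). Qed.

Let measurable_kern n U : measurable U -> measurable_fun setT (kern n ^~ U).
Proof.
move=> mU; rewrite (_ : kern n ^~ U = fun x =>
   if counting (phi x : set 'rV[R]_d) <= n%:R%:E :> \bar R then counting ((phi x : set 'rV[R]_d) `&` U) else 0).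
  apply: measurable_fun_ifT => //; last exact: measurable_count_rv.
  have := measurable_count_rv measurableT.
  under eq_fun do rewrite setIT.
  by move=> mc; apply: measurable_fun_lee.
by apply/funext => x; rewrite /kern; case: ifPn => // _; rewrite /Kc /= /mrestr setIC.
Qed.

HB.instance Definition _ n := isKernel.Build _ _ X (borel R d) R (kern n) (measurable_kern n).

Let kern_uub n : measure_fam_uub (kern n).
Proof.
exists n.+1%:R => x; rewrite /kern; case: ifPn => [xn|_]; last by rewrite /= lte_fin.
by rewrite /Kc /= /mrestr setTI (le_lt_trans xn)// lte_fin ltr_nat.
Qed.

HB.instance Definition _ n := @Kernel_isFinite.Build _ _ X (borel R d) R (kern n) (kern_uub n).

Lemma measurable_count_section (E : set (X * borel R d)) : measurable E ->
  measurable_fun setT (fun x => counting ((phi x : set 'rV[R]_d) `&` [set y | E (x, y)]) : \bar R).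
Proof.
move=> mE.
apply: (emeasurable_fun_cvg (fun n x => kern n x (xsection E x))).
  by move=> n; apply: measurable_fun_xsection_finite_kernel; exact: mem_set.
move=> x _; apply: cvg_near_cst.
have [k xk] : exists k : nat, counting (phi x : set 'rV[R]_d) = k%:R%:E :> \bar R.
  by rewrite counting_finite//; eexists.
exists k => // n /= kn; rewrite /kern xk lee_fin ler_nat kn /Kc /= /mrestr.
by rewrite setIC xsectionE.
Qed.

Lemma measurable_exists_section (E : set (X * borel R d)) : measurable E ->
  measurable [set x | exists2 y, phi x y & E (x, y)].
Proof.
move=> mE.
rewrite (_ : [set x | _] = setT `&` [set x | 1 <= counting ((phi x : set 'rV[R]_d) `&` [set y | E (x, y)]) :> \bar R]).
  exact: (emeasurable_fun_c_infty measurableT (measurable_count_section mE)).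
rewrite setTI; apply/seteqP; split => x /=.
  by move=> [y xy Exy]; apply: counting_ge1; exists y.
move=> c1; apply: contrapT => nex.
suff /counting_eq0 c0 : (phi x : set 'rV[R]_d) `&` [set y | E (x, y)] = set0.
  by move: c1; rewrite (c0 R) lee_fin ler10.
by apply/seteqP; split => y // [xy Exy]; apply: nex; exists y.
Qed.

Lemma measurable_forall_section (E : set (X * borel R d)) : measurable E ->
  measurable [set x | forall y, phi x y -> E (x, y)].
Proof.
move=> mE; have := measurableC (measurable_exists_section (measurableC mE)).
congr measurable; apply/seteqP; split => x /=.
  by move=> H y xy; apply: contrapT => nE; apply: H; exists y.
by move=> H [y xy nE]; apply: nE; exact: H.
Qed.

End kernel.

(** A change of variables made separately for each point [y], by translation invariance. It replaces
    the cluster centre [x] by the position [x + y] of the selected point. *)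
Lemma tonelli_counting (K : set 'rV[R]_d) (E : set (borel R d * borel R d)) :
  finite_set K -> measurable E ->
  \int[@lebesgue_rV R d]_x counting (K `&` [set y | E ((x : 'rV[R]_d) + y, y)%R]) =
  \int[@lebesgue_rV R d]_z counting (K `&` [set y | E (z, y)]).
Proof.
move=> fK mE.
have mE1 (y : 'rV[R]_d) : measurable ([set z | E (z, y)] : set (borel R d)).
  have := measurable_ysection (y : borel R d) mE.
  by rewrite ysectionE.
have mE2 (y : 'rV[R]_d) : measurable ([set z | E (z + y, y)%R] : set (borel R d)).
  have m : measurable_fun setT ((fun z : borel R d => (z : 'rV[R]_d) + y)%R : _ -> borel R d).
    exact: measurable_rVD.
  by rewrite -[X in measurable X]setTI; exact: (m measurableT _ (mE1 y)).
have int1 (x : 'rV[R]_d) : counting (K `&` [set y | E (x + y, y)%R]) =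
    \sum_(y <- fset_set K) (\1_[set z | E (z + y, y)%R] x)%:E :> \bar R.
  by rewrite counting_sum.
have int2 (x : 'rV[R]_d) : counting (K `&` [set y | E (x, y)]) =
    \sum_(y <- fset_set K) (\1_[set z | E (z, y)] x)%:E :> \bar R.
  by rewrite counting_sum.
under eq_integral do rewrite int1.
under [RHS]eq_integral do rewrite int2.
rewrite !ge0_integral_sum//; last 2 first.
- by move=> y; apply/measurable_EFinP; exact: measurable_indic.
- by move=> y; apply/measurable_EFinP; exact: measurable_indic.
apply: eq_bigr => y _; rewrite !integral_indic// !setIT.
have := lebesgue_rV_affine y (@ltr01 R) (mE1 y).
rewrite invr1 expr1n mul1e => aff; rewrite -[RHS]aff /=; congr lebesgue_rV.
by apply/seteqP; split => z /=; rewrite scale1r.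
Qed.

End config_measurability.

(** * Void probabilities *)

Section discrete_independence.
Context d (T : measurableType d) (R : realType) (P : probability T R).
Local Open Scope ereal_scope.

(** Only the joint mass function is given. The indicators of [Y k = m k] are replaced by [f k (Y k)]
    one coordinate at a time, by summing over the value of that coordinate. *)
Lemma integral_prod_discrete n (Y : 'I_n -> T -> nat) (p f : 'I_n -> nat -> R) (s : 'I_n -> R) :
  (forall k m, measurable (Y k @^-1` [set m])) ->
  (forall k m, (0 <= p k m)%R) -> (forall k m, (0 <= f k m)%R) ->
  (forall m : 'I_n -> nat, P [set w | forall k, Y k w = m k] = (\prod_k p k (m k))%:E) ->
  (forall k, \sum_(0 <= m <oo) (f k m * p k m)%:E = (s k)%:E) ->
  \int[P]_w (\prod_k f k (Y k w))%:E = (\prod_k s k)%:E.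
Proof.
move=> mY p0 f0 PY fs.
(* In [F j] and [S j] the first [j] factors are already replaced; the other ones still carry the
   prescribed values [m]. *)
pose F (j : nat) (m : 'I_n -> nat) w := (\prod_(k < n)
  (if (k < j)%N then f k (Y k w) else (Y k w == m k)%:R))%R.
pose S (j : nat) (m : 'I_n -> nat) := (\prod_(k < n) (if (k < j)%N then s k else p k (m k)))%R.
have mYf k (h : nat -> R) : measurable_fun setT (fun w => h (Y k w)).
  move=> _ B mB; rewrite setTI.
  rewrite (_ : _ @^-1` _ = \bigcup_(i in [set i | B (h i)]) (Y k @^-1` [set i])).
    by apply: bigcup_measurable => i _; exact: mY.
  by apply/seteqP; split => w /=; [move=> Bw; exists (Y k w)|move=> [i /= Bi ->]].
have mF j m : measurable_fun setT (F j m).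
  apply: measurable_prod => k _.
  by exact: (mYf k (fun i => if (k < j)%N then f k i else (i == m k)%:R)).
have F0 j m w : (0 <= F j m w)%R by apply: prodr_ge0 => k _; case: ifP.
suff H j : (j <= n)%N -> forall m, \int[P]_w (F j m w)%:E = (S j m)%:E.
  have := H n (leqnn n) (fun=> 0%N).
  under eq_integral do rewrite /F.
  by rewrite /S; under eq_integral do under eq_bigr do rewrite ltn_ord;
    under [in RHS]eq_bigr do rewrite ltn_ord.
elim: j => [_ m|j IH jn m].
  rewrite /S -PY /F.
  have mD : measurable [set w | forall k, Y k w = m k].
    rewrite (_ : mkset _ = \bigcap_(k in [set: 'I_n]) (Y k @^-1` [set m k])).
      by apply: fin_bigcap_measurable => [|k _]; [exact: finite_finset|exact: mY].
    by apply/seteqP; split => w /= H k => [_|]; [exact: H|exact: (H k I)].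
  rewrite -[X in _ = P X]setIT -integral_indic//; apply: eq_integral => w _; congr EFin.
  rewrite indicE; case: (boolP (w \in _)) => [/set_mem /= H|/negP wn].
    by rewrite big1// => k _; rewrite H eqxx.
  have [k /eqP km] : exists k, Y k w <> m k by apply/existsNP => H; apply: wn; exact: mem_set.
  by rewrite (bigD1 k)//= (negbTE km) mul0r.
pose jj := Ordinal jn.
(* Prescribing the value [i] at coordinate [j] and summing over [i] against [f jj i] recovers
   [f jj (Y jj)]. *)
pose upd i : 'I_n -> nat := fun k => if k == jj then i else m k.
have FE w : (F j.+1 m w)%:E = \sum_(0 <= i <oo) ((f jj i)%:E * (F j (upd i) w)%:E).
  pose G := (\prod_(k < n | k != jj) (if (k < j.+1)%N then f k (Y k w) else (Y k w == m k)%:R))%R.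
  have FG i : F j (upd i) w = ((Y jj w == i)%:R * G)%R.
    rewrite /F (bigD1 jj)//= ltnn /upd eqxx; congr (_ * _)%R.
    apply: eq_bigr => k kj; rewrite (negbTE kj) ltnS [in RHS]leq_eqVlt.
    by rewrite (_ : (k == j :> nat) = false)//; apply/negbTE; rewrite -val_eqE in kj.
  rewrite (nneseriesD1 (n := Y jj w))//; last by move=> k _; rewrite -EFinM lee_fin mulr_ge0.
  rewrite eseries0 ?adde0.
    by rewrite FG eqxx mul1r -EFinM /F (bigD1 jj)//= leqnn.
  by move=> i _ /andP[_ iY]; rewrite FG eq_sym (negbTE iY) mul0r mule0.
under eq_integral do rewrite FE.
rewrite integral_nneseries//; last 2 first.
- move=> i; apply/measurable_funeM/measurable_EFinP; exact: mF.
- by move=> i w _; rewrite -EFinM lee_fin mulr_ge0.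
pose G := (\prod_(k < n | k != jj) (if (k < j.+1)%N then s k else p k (m k)))%R.
have SG i : S j (upd i) = (p jj i * G)%R.
  rewrite /S (bigD1 jj)//= ltnn /upd eqxx; congr (_ * _)%R.
  apply: eq_bigr => k kj; rewrite (negbTE kj) ltnS [in RHS]leq_eqVlt.
  by rewrite (_ : (k == j :> nat) = false)//; apply/negbTE; rewrite -val_eqE in kj.
have s0 k : (0 <= s k)%R.
  by rewrite -lee_fin -fs; apply: nneseries_ge0 => i _ _; rewrite lee_fin mulr_ge0.
have G0 : (0 <= G)%R by apply: prodr_ge0 => k _; case: ifP.
transitivity (\sum_(0 <= i <oo) (G%:E * (f jj i * p jj i)%:E)).
  apply: eq_eseriesr => i _; rewrite ge0_integralZl//; last 3 first.
  - by apply/measurable_EFinP; exact: mF.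
  - by move=> w _; rewrite lee_fin.
  - by rewrite lee_fin.
  by rewrite (IH (ltnW jn)) SG -!EFinM; congr EFin; ring.
rewrite nneseriesZl; last by move=> i _; rewrite lee_fin mulr_ge0.
by rewrite fs -EFinM /S (bigD1 jj)//= leqnn mulrC.
Qed.

(** The probability generating function at [q] of the Poisson law with mean [a]. *)
Lemma nneseries_poisson (q a : R) : (0 <= q)%R -> (0 <= a)%R ->
  \sum_(0 <= m <oo) (q ^+ m * (a ^+ m / m`!%:R * expR (- a)))%:E = (expR (- ((1 - q) * a)))%:E.
Proof.
move=> q0 a0.
have -> : expR (- ((1 - q) * a)) = (expR (- a) * expR (q * a))%R.
  by rewrite -expRD; congr expR; ring.
transitivity (\sum_(0 <= m <oo) ((expR (- a))%:E * (exp_coeff (q * a) m)%:E)).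
  by apply: eq_eseriesr => m _; rewrite -EFinM /exp_coeff /= exprMn; congr EFin; ring.
rewrite nneseriesZl; last by move=> i _; rewrite lee_fin exp_coeff_ge0// mulr_ge0.
rewrite EFinM; congr (_ * _).
have c : cvgn (series (exp_coeff (q * a))) by exact: is_cvg_series_exp_coeff.
rewrite /expR -EFin_lim//; congr (limn _); apply/funext => n.
by rewrite /= /series /= sumEFin.
Qed.
End discrete_independence.

Lemma cvg_toEFin (R : realType) T (F : set_system T) {FF : Filter F} (u : T -> R) (a : R) :
  u x @[x --> F] --> a -> (u x)%:E @[x --> F] --> a%:E.
Proof. by move=> ua; apply: cvg_EFin; first exact: nearW. Qed.

Section bounded_convergence.
Context d (T : measurableType d) (R : realType) (P : probability T R).
Local Open Scope ereal_scope.

Lemma cvg_integral_01 (f_ : nat -> T -> R) (f : T -> R) :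
  (forall n, measurable_fun setT (f_ n)) -> measurable_fun setT f ->
  (forall n w, (0 <= f_ n w <= 1)%R) ->
  {ae P, forall w, (f_ n w @[n --> \oo] --> f w)%R} ->
  \int[P]_w (f_ n w)%:E @[n --> \oo] --> \int[P]_w (f w)%:E.
Proof.
move=> mf_ mf f01 ff.
have [] := @dominated_convergence _ _ _ P setT measurableT
  (fun n w => (f_ n w)%:E) (fun w => (f w)%:E) (cst 1) => //.
- by move=> n; exact/measurable_EFinP.
- exact/measurable_EFinP.
- by apply: filterS ff => w /= H _; apply: cvg_EFin => //; exact: nearW.
- apply/integrableP; split => //; rewrite /= (eq_integral (cst 1)).
    by rewrite integral_cst//= mul1e; rewrite [ltLHS](@probability_setT _ _ _ P) ltry.
  by move=> w _; rewrite /= normr1.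
- by apply: aeW => w n _ /=; rewrite lee_fin ger0_norm; case/andP: (f01 n w).
Qed.
End bounded_convergence.

Section enumeration.
Variable (T : choiceType).

(** Only finitely many indices fall in [A], so counting along the enumeration is eventually exact.
    This links the enumerated points to the counts, whose law is known. *)
Lemma count_enumeration (S A : set T) (e : nat -> T) : set_bij setT S e ->
  finite_set (S `&` A) ->
  \forall m \near \oo, (\sum_(i < m) (e i \in A) = #|` fset_set (S `&` A)|)%N.
Proof.
move=> [eS einj eonto] fSA.
have imI : S `&` A = e @` (e @^-1` A).
  apply/seteqP; split => [y [/eonto[i _ <-] Ay]|_ [i Ai <-]]; first by exists i.
  by split => //; exact: eS.
have fI : finite_set (e @^-1` A).
  rewrite (_ : e @^-1` A = e @^-1` (S `&` A)); last first.
    by apply/seteqP; split => i /= => [Ai|[]//]; split => //; exact: eS.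
  by apply: finite_preimage => // i j _ _; apply: einj; rewrite inE.
exists (\max_(i <- fset_set (e @^-1` A)) i).+1 => // m /= Hm.
have -> : fset_set (S `&` A) = (e @` fset_set (e @^-1` A))%fset.
  by rewrite imI fset_set_image.
rewrite card_imfset/=; last by move=> i j; apply: einj; rewrite inE.
rewrite -(big_mkord xpredT (fun i => e i \in A : nat)) -big_mkcond/= sum1_count -size_filter.
apply/perm_size/uniq_perm; rewrite ?filter_uniq ?iota_uniq ?fset_uniq// => i.
rewrite mem_filter mem_index_iota in_fset_set//= [RHS](_ : _ = (e i \in A)); last first.
  by apply/idP/idP => [/set_mem/mem_set|/set_mem/mem_set].
have [/= iA|//] := boolP (e i \in A).
apply: leq_trans Hm; rewrite ltnS; apply: leq_bigmax_seq => //.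
by rewrite in_fset_set//; apply/mem_set/set_mem.
Qed.
End enumeration.

(** * Laplace functional of the Poisson process *)

Section laplace.
Context disp (Omega : measurableType disp) (R : realType) (P : probability Omega R).
Context (d : nat) (lambda : R) (lambda_gt0 : 0 < lambda).
Context (Pi : {RV P >-> config R d}) (Pi_poisson : stationary_poisson lambda Pi).
Context (x : nat -> {RV P >-> borel R d}).
Hypothesis x_enum : \forall w \ae P, set_bij setT (Pi w : set 'rV[R]_d) (fun n => x n w).
Local Open Scope ereal_scope.

Lemma cube_compact k : compact (cube R d k).
Proof. by apply: (@rV_compact R d (fun=> `[(- k%:R)%R, k%:R%R]%classic)) => i; exact: segment_compact. Qed.

Lemma measurable_comp_x (f : borel R d -> R) i : measurable_fun setT f ->
  measurable_fun setT (fun w => f (x i w)).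
Proof. by move=> mf; exact: measurableT_comp. Qed.

Lemma measurable_prod_x (f : borel R d -> R) n : measurable_fun setT f ->
  measurable_fun setT (fun w => (\prod_(i < n) f (x i w))%R).
Proof. by move=> mf; apply: measurable_prod => i _; exact: measurable_comp_x. Qed.

Lemma prod_x01 (f : borel R d -> R) n w : (forall z, (0 <= f z <= 1)%R) ->
  (0 <= \prod_(i < n) f (x i w) <= 1)%R.
Proof.
move=> f01; apply/andP; split; first by apply: prodr_ge0 => i _; case/andP: (f01 (x i w)).
by apply: prodr_ile1 => i _; exact: f01.
Qed.

(** For almost every outcome the product over the first [m] points is eventually the product of the
    [q k] raised to the counts in the [A k]. Bounded convergence then reduces the limit to
    independent Poisson counts and their generating functions. *)
Lemma laplace_simple n (A : 'I_n -> set (borel R d)) (q : 'I_n -> R) (M : nat) :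
  (forall k, measurable (A k)) -> (forall k, A k `<=` cube R d M) -> trivIset setT A ->
  (forall k, (0 <= q k <= 1)%R) ->
  \int[P]_w (\prod_(i < m) \prod_(k < n) (if x i w \in A k then q k else 1))%:E
    @[m --> \oo] -->
  (expR (- (lambda * \sum_(k < n) (1 - q k) * fine (lebesgue_rV (A k)))))%:E.
Proof.
move=> mA AM tA q01; have [Pilf Pifidi] := Pi_poisson.
pose Y k w := #|` fset_set ((Pi w : set 'rV[R]_d) `&` A k)|.
have finY k w : finite_set ((Pi w : set 'rV[R]_d) `&` A k).
  apply: sub_finite_set (Pilf w _ (@cube_compact M)) => y [? Ay]; split => //; exact: (AM _ _ Ay).
have YE k w m : Y k w = m <-> counting ((Pi w : set 'rV[R]_d) `&` A k) = m%:R%:E :> \bar R.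
  rewrite counting_finite//; split => [<-//|[] /eqP]; rewrite eqr_nat => /eqP.
  by [].
have mY k m : measurable (Y k @^-1` [set m]).
  have := @measurable_counting_config R d _ (mA k).
  move=> mc; have := measurableT_comp mc (measurable_funPT Pi).
  move=> /(_ measurableT [set m%:R%:E] (emeasurable_set1 _)); rewrite setTI.
  by congr measurable; apply/seteqP; split => w /=; rewrite YE.
have Alty k : lebesgue_rV (A k) < +oo.
  apply: le_lt_trans (lebesgue_rV_cube R d M); apply: le_measure => //; rewrite inE//.
  exact: measurable_cube.
have -> : (expR (- (lambda * \sum_(k < n) (1 - q k) * fine (lebesgue_rV (A k)))))%:E =
    \int[P]_w (\prod_(k < n) q k ^+ Y k w)%:E.
  pose a k := (lambda * fine (lebesgue_rV (A k)))%R.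
  have a0 k : (0 <= a k)%R by rewrite mulr_ge0// ?(ltW lambda_gt0)// fine_ge0.
  have := @integral_prod_discrete _ _ _ P n Y
    (fun k m => a k ^+ m / m`!%:R * expR (- a k))%R (fun k m => q k ^+ m)%R
    (fun k => expR (- ((1 - q k) * a k)))%R mY.
  move=> -> //.
  - rewrite -expR_sum; congr ((expR _)%:E).
    by rewrite sumrN mulr_sumr; congr (- _)%R; apply: eq_bigr => k _; rewrite /a mulrCA.
  - by move=> k m; rewrite mulr_ge0// ?expR_ge0// divr_ge0// exprn_ge0.
  - by move=> k m; rewrite exprn_ge0//; case/andP: (q01 k).
  - move=> m; rewrite -(Pifidi n A m mA Alty tA); congr (P _).
    by apply/seteqP; split => w /= H k; apply/YE.
  - by move=> k; rewrite nneseries_poisson//; case/andP: (q01 k).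
have mQ : measurable_fun setT (fun z : borel R d => \prod_(k < n) (if z \in A k then q k else 1))%R.
  apply: measurable_prod => k _; apply: measurable_fun_ifT => //.
  apply: (measurable_fun_bool true); rewrite setTI.
  by rewrite (_ : _ @^-1` _ = A k)//; apply/seteqP; split => z /= H; [exact: set_mem|exact: mem_set].
have Q01 z : (0 <= \prod_(k < n) (if z \in A k then q k else 1) <= 1)%R.
  by apply/andP; split; [apply: prodr_ge0 => k _|apply: prodr_ile1 => k _];
    case: ifP => _; rewrite ?ler01 ?lexx//; case/andP: (q01 k).
apply: cvg_integral_01.
- by move=> m; exact: (measurable_prod_x _ mQ).
- apply: measurable_prod => k _.
  move=> _ B mB; rewrite setTI.
  rewrite (_ : _ @^-1` _ = \bigcup_(i in [set i | B (q k ^+ i)%R]) (Y k @^-1` [set i])).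
    by apply: bigcup_measurable => i _; exact: mY.
  by apply/seteqP; split => w /=; [move=> Bw; exists (Y k w)|move=> [i /= Bi ->]].
- by move=> m w; exact: (prod_x01 _ _ Q01).
- apply: filterS x_enum => w xw; apply: cvg_near_cst.
  have : \forall m \near \oo, forall k, (\sum_(i < m) (x i w \in A k) = Y k w)%N.
    by apply: filter_forall => k; exact: (count_enumeration xw (finY k w)).
  apply: filterS => m Hm; rewrite exchange_big/=; apply: eq_bigr => k _.
  rewrite -Hm; elim/big_rec2 : _ => [|i y1 y2 _ ->]; first by rewrite expr0.
  by rewrite exprD; case: ifP => _; rewrite ?expr1 ?expr0.
Qed.

End laplace.

Section laplace_general.
Import HBNNSimple.
Context disp (Omega : measurableType disp) (R : realType) (P : probability Omega R).
Context (d : nat) (lambda : R) (lambda_gt0 : 0 < lambda).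
Context (Pi : {RV P >-> config R d}) (Pi_poisson : stationary_poisson lambda Pi).
Context (x : nat -> {RV P >-> borel R d}).
Hypothesis x_enum : \forall w \ae P, set_bij setT (Pi w : set 'rV[R]_d) (fun n => x n w).
Local Open Scope ereal_scope.
Let leb := @lebesgue_rV R d.

Let V (f : borel R d -> R) n := \int[P]_w (\prod_(i < n) (1 - f (x i w)))%:E.

Let V_nonincr (f : borel R d -> R) : measurable_fun setT f -> (forall z, (0 <= f z <= 1)%R) ->
  {homo V f : n m / (n <= m)%N >-> m <= n}.
Proof.
move=> mf f01 n m nm.
have g01 z : (0 <= 1 - f z <= 1)%R.
  by case/andP: (f01 z) => ? ?; rewrite subr_ge0 lerBlDr lerDl; apply/andP.
have mg : measurable_fun setT (fun z => 1 - f z)%R by apply: measurable_funB.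
apply: ge0_le_integral => //.
- by move=> w _; rewrite lee_fin; case/andP: (prod_x01 x m w g01).
- by apply/measurable_EFinP; exact: (measurable_prod_x x m mg).
- by apply/measurable_EFinP; exact: (measurable_prod_x x n mg).
- move=> w _; rewrite lee_fin -(subnKC nm) big_split_ord /=.
  apply: ler_piMr; first by apply: prodr_ge0 => i _; case/andP: (g01 (x i w)).
  by apply: prodr_ile1 => i _; exact: g01.
Qed.

Let V_anti (f g : borel R d -> R) n : measurable_fun setT f -> measurable_fun setT g ->
  (forall z, (0 <= f z)%R) -> (forall z, (f z <= g z)%R) -> (forall z, (g z <= 1)%R) ->
  V g n <= V f n.
Proof.
move=> mf mg f0 fg g1; apply: ge0_le_integral => //.
- by move=> w _; rewrite lee_fin; apply: prodr_ge0 => i _; rewrite subr_ge0.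
- apply/measurable_EFinP; apply: (measurable_prod_x x (f := fun z => 1 - g z)%R).
  exact: measurable_funB.
- apply/measurable_EFinP; apply: (measurable_prod_x x (f := fun z => 1 - f z)%R).
  exact: measurable_funB.
- move=> w _; rewrite lee_fin; apply: ler_prod => i _.
  by rewrite subr_ge0 g1 lerB.
Qed.

(** The level sets of [h] inside a cube are disjoint and of finite measure, so [laplace_simple]
    applies with [q k] equal to one minus the [k]-th value. *)
Lemma laplace_nnsfun (h : {nnsfun (borel R d) >-> R}) M : (forall z, (h z <= 1)%R) ->
  V (fun z => h z * \1_(cube R d M) z)%R n @[n --> \oo] -->
  (expR (- (lambda * fine (\int[leb]_z (h z * \1_(cube R d M) z)%:E))))%:E.
Proof.
move=> h1.
have fh : finite_set (range h) by exact: fimfunP.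
pose s := enum_fset (fset_set (range h)).
have us : uniq s by exact: fset_uniq.
have sE y : (y \in s) = (y \in range h) by rewrite -(in_fset_set fh).
pose c (k : 'I_(size s)) := s`_k.
have c_eq k k' : (c k == c k') = (k == k') by rewrite /c nth_uniq.
have cr k : exists z, c k = h z.
  have : c k \in s by rewrite mem_nth.
  by rewrite sE inE => -[z _ <-]; exists z.
have c0 k : (0 <= c k)%R by have [z ->] := cr k.
have c1 k : (c k <= 1)%R by have [z ->] := cr k.
pose A (k : 'I_(size s)) : set (borel R d) := (h @^-1` [set c k]) `&` cube R d M.
have mA k : measurable (A k) by apply: measurableI; [exact: measurable_sfunP|exact: measurable_cube].
have AM k : A k `<=` cube R d M by move=> z [].
have tA : trivIset setT A.
  apply/trivIsetP => i j _ _ ij; rewrite /A setIACA setIid.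
  rewrite (_ : h @^-1` [set c i] `&` h @^-1` [set c j] = set0) ?set0I//.
  by apply/seteqP; split => z //= [-> /eqP]; rewrite c_eq (negbTE ij).
have hz z : exists k, c k = h z.
  have hs : h z \in s.
    by rewrite sE inE; exists z.
  have hi : (index (h z) s < size s)%N by rewrite index_mem.
  by exists (Ordinal hi); rewrite /c /= nth_index.
have hE z : (h z * \1_(cube R d M) z = \sum_(k < size s) c k * \1_(A k) z)%R.
  have [k0 ck0] := hz z.
  rewrite (bigD1 k0)//= big1 ?addr0.
    rewrite ck0; congr (_ * _)%R; rewrite !indicE /A in_setI.
    by rewrite (@mem_set _ (h @^-1` [set c k0]) z).
  move=> k kk0; rewrite indicE; case: (boolP (z \in A k)) => [|_]; last by rewrite mulr0.
  by rewrite inE => -[/= hzk _]; move: kk0; rewrite -c_eq ck0 hzk eqxx.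
have Alty k : leb (A k) < +oo.
  apply: le_lt_trans (lebesgue_rV_cube R d M); apply: le_measure => //; rewrite inE//.
  exact: measurable_cube.
have IE : fine (\int[leb]_z (h z * \1_(cube R d M) z)%:E) =
    (\sum_(k < size s) (1 - (1 - c k)) * fine (leb (A k)))%R.
  transitivity (fine (\sum_(k < size s) (c k * fine (leb (A k)))%:E)); last first.
    by rewrite sumEFin /=; apply: eq_bigr => k _; congr (_ * _)%R; ring.
  congr fine; under eq_integral do rewrite hE -sumEFin.
  rewrite ge0_integral_sum//; last 2 first.
  - move=> k; apply/measurable_EFinP/measurable_funM => //; exact: measurable_indic.
  - by move=> k z _; rewrite lee_fin mulr_ge0.
  apply: eq_bigr => k _; under eq_integral do rewrite EFinM.
  rewrite ge0_integralZl ?lee_fin//; last by apply/measurable_EFinP; exact: measurable_indic.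
  by rewrite integral_indic// setIT EFinM fineK// ge0_fin_numE.
rewrite IE.
have := @laplace_simple _ _ R P d lambda lambda_gt0 Pi Pi_poisson x x_enum _ A (fun k => 1 - c k)%R M mA AM tA.
have q01 k : (0 <= 1 - c k <= 1)%R by rewrite subr_ge0 c1 lerBlDr lerDl c0.
move=> /(_ q01); apply: cvg_trans; apply: near_eq_cvg; apply: nearW => n.
apply: eq_integral => w _; congr EFin; apply: eq_bigr => i _; rewrite hE.
have [k0 ck0] := hz (x i w).
rewrite (bigD1 k0)//= [in RHS](bigD1 k0)//= !big1 ?addr0 ?mulr1.
- by rewrite indicE; case: ifP => _; rewrite ?mulr1 ?mulr0 ?subr0.
- move=> k kk0; rewrite indicE; case: (boolP (_ \in A k)) => [|_]; last by rewrite mulr0.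
  by rewrite inE => -[/= hzk _]; move: kk0; rewrite -c_eq ck0 hzk eqxx.
- move=> k kk0; case: (boolP (_ \in A k)) => [|//].
  by rewrite inE => -[/= hzk _]; move: kk0; rewrite -c_eq ck0 hzk eqxx.
Qed.

(** Two limits must be exchanged: more and more points, and simple functions [F m] increasing to
    [f]. Since [V] decreases in the number of points, its limit is an infimum, and each of the two
    inequalities then needs only one limit at a time. *)
Lemma laplace_functional (f : borel R d -> R) : measurable_fun setT f ->
  (forall z, (0 <= f z <= 1)%R) -> \int[leb]_z (f z)%:E < +oo ->
  \int[P]_w (\prod_(i < n) (1 - f (x i w)))%:E @[n --> \oo] -->
  (expR (- (lambda * fine (\int[leb]_z (f z)%:E))))%:E.
Proof.
move=> mf f01 If; rewrite -/(V f).
have f0 z : (0 <= f z)%R by case/andP: (f01 z).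
have f1 z : (f z <= 1)%R by case/andP: (f01 z).
have mef : measurable_fun setT (EFin \o f) by exact/measurable_EFinP.
pose h := nnsfun_approx measurableT mef.
have hf m z : (h m z <= f z)%R.
  rewrite /h nnsfun_approxE -lee_fin.
  by apply: (le_approx (f := EFin \o f) (D := setT)) => // y _; rewrite lee_fin.
pose F m z := (h m z * \1_(cube R d m) z)%R.
have mF m : measurable_fun setT (F m).
  by apply: measurable_funM => //; apply: measurable_indic; exact: measurable_cube.
have F0 m z : (0 <= F m z)%R by rewrite mulr_ge0.
have Ff m z : (F m z <= f z)%R.
  by apply: le_trans (hf m z); rewrite /F -[leRHS]mulr1 ler_wpM2l// indicE.
have Fnd z : {homo F ^~ z : n m / (n <= m)%N >-> (n <= m)%R}.
  move=> n m nm; rewrite /F ler_pM//; first exact/lefP/nd_nnsfun_approx.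
  rewrite !indicE ler_nat; case: (boolP (z \in cube R d n)) => // zn.
  rewrite (_ : z \in cube R d m)//; move: zn; rewrite !inE => H j.
  move: (H j); rewrite !in_itv/= => /andP[H1 H2]; apply/andP; split.
    by apply: le_trans H1; rewrite lerN2 ler_nat.
  by apply: le_trans H2 _; rewrite ler_nat.
have Fc z : F m z @[m --> \oo] --> f z.
  have hc : h m z @[m --> \oo] --> f z.
    have := @cvg_nnsfun_approx _ _ _ _ measurableT _ mef (fun y _ => f0 y) z I.
    by move/fine_cvgP => [].
  rewrite -[X in _ --> X]mulr1; apply: cvgM => //; apply: cvg_near_cst.
  have [k _ zk] : (\bigcup_k cube R d k) z by rewrite cube_cover.
  exists k => // m /= km; rewrite indicE mem_set// => j.
  move: (zk j); rewrite !in_itv/= => /andP[H1 H2]; apply/andP; split.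
    by apply: le_trans H1; rewrite lerN2 ler_nat.
  by apply: le_trans H2 _; rewrite ler_nat.
pose Im m := \int[leb]_z (F m z)%:E.
have ImI : Im m @[m --> \oo] --> \int[leb]_z (f z)%:E.
  rewrite (_ : \int[leb]_z (f z)%:E = \int[leb]_z limn (fun m => (F m z)%:E)); last first.
    by apply: eq_integral => z _; apply/esym/cvg_lim => //; exact: (cvg_toEFin (Fc z)).
  apply: cvg_monotone_convergence => //.
  - by move=> n; exact/measurable_EFinP.
  - by move=> n z _; rewrite lee_fin.
  - by move=> z _ n m nm; rewrite lee_fin Fnd.
have Im_le m : Im m <= \int[leb]_z (f z)%:E.
  apply: ge0_le_integral => //.
  - by move=> z _; rewrite lee_fin.
  - exact/measurable_EFinP.
  - by move=> z _; rewrite lee_fin.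
have Imfin m : Im m \is a fin_num.
  by rewrite ge0_fin_numE ?(le_lt_trans (Im_le m))// integral_ge0// => z _; rewrite lee_fin.
have Ifin : \int[leb]_z (f z)%:E \is a fin_num.
  by rewrite ge0_fin_numE// integral_ge0// => z _; rewrite lee_fin.
have VF m : V (F m) n @[n --> \oo] --> (expR (- (lambda * fine (Im m))))%:E.
  by apply: laplace_nnsfun => z; exact: le_trans (hf m z) (f1 z).
have F01 m z : (0 <= F m z <= 1)%R by rewrite F0 (le_trans (Ff m z)).
have cV : V f n @[n --> \oo] --> ereal_inf (range (V f)).
  by apply: ereal_nonincreasing_cvgn; exact: V_nonincr.
suff -> : (expR (- (lambda * fine (\int[leb]_z (f z)%:E))))%:E = ereal_inf (range (V f)) by [].
(* Lower bound: for fixed [n], let [m] tend to infinity in [V (F m) n], which stays above its own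
   infimum. *)
apply/eqP; rewrite eq_le; apply/andP; split.
  apply: le_ereal_inf_tmp => _ [n _ <-].
  have VFn : V (F m) n @[m --> \oo] --> V f n.
    apply: cvg_integral_01.
    - move=> m; apply: (measurable_prod_x x (f := fun z => 1 - F m z)%R).
      exact: measurable_funB.
    - by apply: (measurable_prod_x x (f := fun z => 1 - f z)%R); exact: measurable_funB.
    - move=> m w; apply: (prod_x01 x (f := fun z => 1 - F m z)%R) => z.
      by rewrite subr_ge0 lerBlDr lerDl F0 (le_trans (Ff m z)).
    - apply: aeW => w; elim: n => [|n IH].
        by under eq_fun do rewrite big_ord0; rewrite big_ord0; exact: cvg_cst.
      under eq_fun do rewrite big_ord_recr; rewrite big_ord_recr.
      by apply: cvgM => //; apply: cvgB; [exact: cvg_cst|exact: Fc].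
  rewrite -(cvg_lim _ VFn)//; apply: lime_ge; first by apply/cvg_ex; eexists; exact: VFn.
  apply: nearW => m; apply: (@le_trans _ _ (expR (- (lambda * fine (Im m))))%:E).
    rewrite lee_fin ler_expR lerN2 ler_pM2l//; exact: fine_le.
  have := ereal_nonincreasing_cvgn (V_nonincr (mF m) (F01 m)).
  move=> /(cvg_lim (@ereal_hausdorff _)); rewrite (cvg_lim _ (VF m))// => ->.
  by apply: ereal_inf_lbound; exists n.
(* Upper bound: [F m] lies below [f], so [V f n] is at most [V (F m) n]; the limit in [n] comes
   first here, then the one in [m]. *)
have VE m : ereal_inf (range (V f)) <= (expR (- (lambda * fine (Im m))))%:E.
  rewrite -(cvg_lim _ (VF m))//; apply: lime_ge; first by apply/cvg_ex; eexists; exact: VF.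
  apply: nearW => n; apply: (@le_trans _ _ (V f n)); first by apply: ereal_inf_lbound; exists n.
  by apply: V_anti.
have ImI' : Im m @[m --> \oo] --> (fine (\int[leb]_z (f z)%:E))%:E by rewrite fineK.
have Ec : (expR (- (lambda * fine (Im m))))%:E @[m --> \oo] -->
    (expR (- (lambda * fine (\int[leb]_z (f z)%:E))))%:E.
  apply: cvg_toEFin.
  apply: (@cvg_comp _ _ _ (fun m => - (lambda * fine (Im m)))%R expR).
    by apply: cvgN; apply: cvgM; [exact: cvg_cst|exact: (fine_cvg ImI')].
  exact: continuous_expR.
rewrite -(cvg_lim _ Ec)//; apply: lime_ge; first by apply/cvg_ex; eexists; exact: Ec.
exact: nearW.
Qed.

End laplace_general.

(** * Independent marks of the enumerated points *)

Section weighted_mixture.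
Context d0 d1 d2 (T : measurableType d0) (T1 : measurableType d1) (T2 : measurableType d2).
Context (R : realType) (P : probability T R) (mu : probability T1 R).
Context (V : T -> T2) (mV : measurable_fun setT V) (g : T -> R).
Hypothesis mg : measurable_fun setT g.
Hypothesis g0 : forall w, 0 <= g w.
Local Open Scope ereal_scope.

(** The right-hand side of [independent_marks] as a function of a single event, with the other
    factors frozen in the weight [g]. It is made a measure so that uniqueness of measures can be
    applied. *)
Definition mixture (X : set (T1 * T2)) := \int[P]_w (mu (ysection X (V w)) * (g w)%:E).

Lemma measurable_mixture X : measurable X ->
  measurable_fun setT (fun w => mu (ysection X (V w)) * (g w)%:E).
Proof.
move=> mX; apply: emeasurable_funM; last exact/measurable_EFinP.
exact: (measurableT_comp (measurable_fun_ysection mu mX) mV).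
Qed.

Let mixture0 : mixture set0 = 0.
Proof.
rewrite /mixture (eq_integral (cst 0)) ?integral0// => w _.
by rewrite ysection0 measure0 mul0e.
Qed.

Let mixture_ge0 X : 0 <= mixture X.
Proof. by apply: integral_ge0 => w _; rewrite mule_ge0// lee_fin. Qed.

Let mixture_sigma_additive : semi_sigma_additive mixture.
Proof.
move=> F mF tF mUF.
rewrite [X in _ --> X](_ : _ = \sum_(n <oo) mixture (F n)).
  by apply/cvg_closeP; split; [exact: is_cvg_nneseries|rewrite closeE].
rewrite -integral_nneseries//; last 2 first.
- by move=> n; exact: measurable_mixture.
- by move=> n w _; rewrite mule_ge0// lee_fin.
apply: eq_integral => w _.
transitivity ((g w)%:E * \sum_(n <oo) mu (ysection (F n) (V w))); last first.
  by rewrite -nneseriesZl//; apply: eq_eseriesr => n _; rewrite muleC.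
rewrite muleC; congr (_ * _); apply/esym/cvg_lim => //=; rewrite ysection_bigcup.
apply: (measure_sigma_additive _ (trivIset_ysection tF)) => ?.
exact: measurable_ysection.
Qed.

HB.instance Definition _ := isMeasure.Build _ _ _ mixture
  mixture0 mixture_ge0 mixture_sigma_additive.

Definition mixture_measure : {measure set (T1 * T2) -> \bar R} := mixture.

End weighted_mixture.

Section independent_marks.
Context d0 d1 d2 (T : measurableType d0) (T1 : measurableType d1) (T2 : measurableType d2).
Context (R : realType) (P : probability T R).
Context (L : nat -> {RV P >-> T1}) (x : nat -> {RV P >-> T2}).
Hypothesis L_indep : mutually_independent P L.
Hypothesis Lx_indep : independent_sequences P L x.
Local Open Scope ereal_scope.

Let law i : probability T1 R := distribution P (L i).
Let psi i (D : set (T1 * T2)) w : R := fine (law i (ysection D (x i w))).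

Let psi01 i D w : measurable D -> (0 <= psi i D w <= 1)%R.
Proof.
move=> mD; have m := measurable_ysection (x i w) mD.
rewrite /psi fine_ge0//= -lee_fin fineK ?probability_le1//.
by rewrite ge0_fin_numE// (le_lt_trans (probability_le1 _ m))// ltry.
Qed.

Let measurable_psi i D : measurable D -> measurable_fun setT (psi i D).
Proof.
move=> mD; apply: (measurableT_comp (fine_measurable measurableT)).
exact: (measurableT_comp (measurable_fun_ysection (law i) mD)).
Qed.

Let pair i w := (L i w, x i w).
Let mpair i : measurable_fun setT (pair i).
Proof. by apply: measurable_fun_pair. Qed.

(* For rectangles this is the hypothesis; the [D i] are then replaced one by
   one, as both sides are finite measures in each [D i]. *)
Lemma independent_marks n (D : nat -> set (T1 * T2)) : (forall i, measurable (D i)) ->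
  P (\bigcap_(i < n) pair i @^-1` D i) = \int[P]_w (\prod_(i < n) psi i (D i) w)%:E.
Proof.
move=> mD.
pose rect (X : set (T1 * T2)) := exists E F, [/\ measurable E, measurable F & X = E `*` F].
have rT : rect setT by exists setT, setT; split => //; rewrite setXTT.
have mrect X : rect X -> measurable X by move=> [E [F [mE mF ->]]]; exact: measurableX.
(* Induction on [m]: events with index below [m] are arbitrary, the others are still rectangles. *)
suff H m (D' : nat -> set (T1 * T2)) : (forall i, measurable (D' i)) ->
    (forall i, (m <= i)%N -> rect (D' i)) ->
    P (\bigcap_(i < n) pair i @^-1` D' i) = \int[P]_w (\prod_(i < n) psi i (D' i) w)%:E.
  pose D' i := if (i < n)%N then D i else setT.
  have -> : \bigcap_(i < n) pair i @^-1` D i = \bigcap_(i < n) pair i @^-1` D' i.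
    by apply: eq_bigcapr => i /= ni; rewrite /D' ni.
  rewrite (H n) => [|i|i]; rewrite /D'; last 2 first.
  - by case: ifP.
  - by rewrite leqNgt => /negbTE ->.
  by apply: eq_integral => w _; congr EFin; apply: eq_bigr => i _; rewrite ltn_ord.
elim: m D' => [D' _ rD|m IH D' mD' rD].
  have rD0 i : exists E, exists F, [/\ measurable E, measurable F & D' i = E `*` F].
    exact: rD.
  have [E HE] := choice rD0.
  have [F HF] := choice HE.
  have mE i : measurable (E i) by have [] := HF i.
  have mF i : measurable (F i) by have [] := HF i.
  have DE i : D' i = E i `*` F i by have [] := HF i.
  rewrite (_ : \bigcap_(i < n) _ = (\bigcap_(i < n) L i @^-1` E i) `&` (\bigcap_(i < n) x i @^-1` F i)).
    rewrite Lx_indep// L_indep//.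
    have mxF : measurable (\bigcap_(i < n) x i @^-1` F i).
      apply: fin_bigcap_measurable => [|i _]; first exact: finite_II.
      by rewrite -[X in measurable X]setTI; exact: measurable_funPT.
    rewrite (eq_integral (fun w => (\prod_(i < n) P (L i @^-1` E i)) * (\1_(\bigcap_(i < n) x i @^-1` F i) w)%:E)).
      rewrite ge0_integralZl//; last 2 first.
      - by apply/measurable_EFinP; exact: measurable_indic.
      - by apply: prode_ge0 => i _; exact: measure_ge0.
      by rewrite integral_indic// setIT.
    move=> w _.
    have psiE i : (psi i (D' i) w)%:E = P (L i @^-1` E i) * (\1_(x i @^-1` F i) w)%:E.
      rewrite /psi DE fineK; last first.
        rewrite ge0_fin_numE// (le_lt_trans (probability_le1 _ _)) ?ltry//.
        exact: measurable_ysection (measurableX (mE i) (mF i)).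
      rewrite indicE; case: (boolP (w \in _)) => [|/negP] xF.
        by rewrite mule1 in_ysectionX//; move: xF; rewrite !inE.
      by rewrite mule0 notin_ysectionX ?measure0//; apply/negP => H; apply: xF; move: H; rewrite !inE.
    rewrite -prodEFin; under eq_bigr do rewrite psiE.
    rewrite big_split /=; congr (_ * _).
    rewrite prodEFin; congr EFin; rewrite indicE.
    case: (boolP (w \in _)) => [|/negP wn].
      rewrite inE => H; rewrite big1// => i _; rewrite indicE mem_set//.
      exact: (H i (ltn_ord i)).
    have [i [ni nF]] : exists i, (i < n)%N /\ ~ F i (x i w).
      apply: contrapT => /forallNP H; apply: wn; rewrite inE => i /= ni.
      by apply: contrapT => nF; apply: (H i).
    by rewrite (bigD1 (Ordinal ni))//= indicE memNset ?mul0r.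
  apply/seteqP; split => w /=.
    by move=> H; split => i /= ni; have := H i ni; rewrite /= DE => -[].
  by move=> [H1 H2] i /= ni; rewrite DE; split; [exact: H1|exact: H2].
have [nm|mn] := leqP n m.
  pose D'' i := if (i < n)%N then D' i else setT.
  rewrite (_ : \bigcap_(i < n) _ = \bigcap_(i < n) pair i @^-1` D'' i).
    rewrite (IH D'') => [|i|i]; rewrite /D''; last 2 first.
    - by case: ifP.
    - by move=> mi; rewrite ltnNge (leq_trans nm).
    by apply: eq_integral => w _; congr EFin; apply: eq_bigr => i _; rewrite ltn_ord.
  by apply: eq_bigcapr => i /= ni; rewrite /D'' ni.
pose m' := Ordinal mn.
pose upd X i := if i == m then X else D' i.
pose G := \bigcap_(i in [set i | (i < n)%N /\ i != m]) pair i @^-1` D' i.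
have mG : measurable G.
  apply: fin_bigcap_measurable => [|i _].
    by apply: sub_finite_set (finite_II n) => i [].
  by rewrite -[X in measurable X]setTI; exact: mpair.
pose g w := (\prod_(i < n | i != m') psi i (D' i) w)%R.
have mg : measurable_fun setT g.
  rewrite /g; under eq_fun do rewrite big_mkcond.
  by apply: measurable_prod => i _; case: (i != m') => //; exact: (measurable_psi i (mD' i)).
have g0 w : (0 <= g w)%R by apply: prodr_ge0 => i _; case/andP: (psi01 i w (mD' i)).
have g1 w : (g w <= 1)%R by apply: prodr_ile1 => i _; exact: psi01.
have mx : measurable_fun setT (x m : T -> T2) by exact: measurable_funPT.
(* Both sides as measures in the [m]-th event alone, the other events being frozen in [G] and [g];
   on rectangles they agree by induction. *)
pose m1 : {measure set (T1 * T2) -> \bar R} := image_measure (mrestr P mG) (mpair m).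
pose m2 : {measure set (T1 * T2) -> \bar R} := mixture_measure P (law m) mx mg g0.
have m1E X : P (\bigcap_(i < n) pair i @^-1` upd X i) = m1 X.
  rewrite /m1 /= /pushforward /mrestr; congr (P _); apply/seteqP; split => w /=.
    move=> H; split; first by have := H m mn; rewrite /upd eqxx.
    by move=> i /= [ni im]; have := H i ni; rewrite /upd (negbTE im).
  move=> [H1 H2] i /= ni; rewrite /upd; case: eqVneq => [->//|im].
  exact: (H2 i).
have m2E X : measurable X -> \int[P]_w (\prod_(i < n) psi i (upd X i) w)%:E = m2 X.
  move=> mX; rewrite /m2 /= /mixture; apply: eq_integral => w _.
  rewrite (bigD1 m')//= EFinM; congr (_ * _).
    rewrite /upd eqxx /psi fineK// ge0_fin_numE// (le_lt_trans (probability_le1 _ _)) ?ltry//.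
    exact: measurable_ysection.
  congr EFin; apply: eq_bigr => i im; rewrite /upd (_ : (i == m :> nat) = false)//.
  by apply/negbTE; rewrite -val_eqE in im.
have updE : D' = upd (D' m) by apply/funext => i; rewrite /upd; case: eqVneq => [->|].
rewrite updE m1E m2E//.
pose C : set (set (T1 * T2)) := [set E `*` F | E in measurable & F in measurable].
apply: (measure_unique C (fun _ => setT)) => //.
- exact: measurable_prod_measurableType.
- move=> _ _ [X1 mX1 [X2 mX2 <-]] [Y1 mY1 [Y2 mY2 <-]].
  exists (X1 `&` Y1); first exact: measurableI.
  by exists (X2 `&` Y2); [exact: measurableI|rewrite setXI].
- by move=> _; exists setT => //; exists setT => //; rewrite setXTT.
- by rewrite bigcup_const.
- move=> _ [E mE [F mF <-]].
  have mEF : measurable (E `*` F) by exact: measurableX.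
  rewrite -m1E -m2E//; apply: IH => i; rewrite /upd; case: eqVneq => // im.
  + by move=> _; exists E, F.
  + by move=> mi; apply: rD; rewrite ltn_neqAle eq_sym im.
- move=> _; rewrite -m1E (le_lt_trans (probability_le1 _ _)) ?ltry//.
  apply: fin_bigcap_measurable => [|i _]; first exact: finite_II.
  rewrite -[X in measurable X]setTI; apply: mpair => //; rewrite /upd; case: ifP => // _.
Qed.

End independent_marks.

Section ae_eq_measure.
Context d (T : measurableType d) (R : realType) (P : probability T R).

Lemma ae_eq_probability (E F : set T) : measurable E -> measurable F ->
  {ae P, forall w, E w <-> F w} -> P E = P F.
Proof.
move=> mE mF EF; rewrite -[E in LHS]setIT -[F in RHS]setIT -!integral_indic//.
apply: ge0_ae_eq_integral => //.
- by apply/measurable_EFinP; exact: measurable_indic.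
- by apply/measurable_EFinP; exact: measurable_indic.
- apply: filterS EF => w EFw _; rewrite !indicE; congr ((_ : bool)%:R%:E).
  by apply/idP/idP => /set_mem/EFw/mem_set.
Qed.
End ae_eq_measure.

Section finite_part.
Context (R : realType) (d : nat).
Local Open Scope ereal_scope.

(** The space [config] also contains infinite sets, whereas the section lemmas need finite sets
    everywhere. This truncation is measurable and leaves finite clusters unchanged. *)
Definition finite_part (K : config R d) : config R d := if `[< finite_set (K : set 'rV[R]_d) >] then K else set0.

Lemma finite_finite_part K : finite_set (finite_part K : set 'rV[R]_d).
Proof. by rewrite /finite_part; case: ifPn => // /asboolP. Qed.

Lemma measurable_finite_config : measurable [set K : config R d | finite_set (K : set 'rV[R]_d)].
Proof.
rewrite (_ : [set K | _] = setT `&` [set K : config R d | counting ((K : set 'rV[R]_d) `&` setT) < +oo :> \bar R]).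
  exact: (emeasurable_fun_infty_o measurableT (measurable_counting_config measurableT)).
rewrite setTI; apply/seteqP; split => K /=; rewrite setIT /counting.
  by move=> fK; rewrite asboolT// ltry.
by case: ifPn => [/asboolP//|_]; rewrite ltxx.
Qed.

Lemma measurable_finite_part : measurable_fun setT finite_part.
Proof.
apply: (@measurability _ _ _ (config R d) _ _ (@counting_event R d)) => //.
move=> _ [_ [A [k [mA ->]]] <-]; rewrite setTI.
have mfin := measurable_finite_config.
have mc : measurable ([set K : config R d | counting ((K : set 'rV[R]_d) `&` A) = k%:R%:E :> \bar R]).
  by apply: sub_sigma_algebra; exists A, k.
rewrite (_ : _ @^-1` _ = ([set K : config R d | finite_set (K : set 'rV[R]_d)] `&`
    [set K : config R d | counting ((K : set 'rV[R]_d) `&` A) = k%:R%:E :> \bar R]) `|`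
    (~` [set K : config R d | finite_set (K : set 'rV[R]_d)] `&` [set _ | k = 0%N])).
  apply: measurableU; first exact: measurableI.
  apply: measurableI; first exact: measurableC.
  have [->|k0] := eqVneq k 0%N.
    by rewrite (_ : [set _ | _] = setT)//; apply/seteqP; split.
  by rewrite (_ : [set _ | _] = set0)//; apply/seteqP; split => // K /= /eqP; rewrite (negbTE k0).
apply/seteqP; split => K /=; rewrite /finite_part.
  case: ifPn => [/asboolP fK Kk|/asboolP nK]; first by left.
  by rewrite set0I counting_finite// fset_set0 cardfs0 => -[] /eqP; rewrite eq_sym pnatr_eq0 => /eqP ->; right.
case=> [[fK Kk]|[nK k0]]; first by rewrite asboolT.
by rewrite asboolF// set0I counting_finite// fset_set0 cardfs0 k0.
Qed.

Lemma finite_partE (K : config R d) : finite_set (K : set 'rV[R]_d) -> finite_part K = K.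
Proof. by move=> fK; rewrite /finite_part asboolT. Qed.

End finite_part.

(** * Void probabilities of the cluster process *)

Section void_probability.
Context disp (Omega : measurableType disp) (R : realType) (P : probability Omega R).
Context (d : nat).
Local Open Scope ereal_scope.

Definition hit_prob (L0 : {RV P >-> config R d}) (A : set 'rV[R]_d) (z : 'rV[R]_d) : \bar R :=
  P [set w | exists2 y, L0 w y & A (y + z)%R].

Section hit_prob.
Context (L0 : {RV P >-> config R d}) (L0_finite : finite_point_process L0).

Lemma measurable_hit (A : set (borel R d)) : measurable A ->
  measurable ([set p | exists2 y, L0 p.2 y & A (y + p.1)%R] : set (borel R d * Omega)).
Proof.
move=> mA.
have m2 : measurable_fun setT (fun p : borel R d * Omega => L0 p.2 : config R d).
  by apply: (measurableT_comp (measurable_funPT L0)); exact: measurable_snd.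
apply: (@measurable_exists_section R d _ _ _ m2 (fun p => L0_finite p.2)
  [set q | A ((q.2 : 'rV[R]_d) + (q.1.1 : 'rV[R]_d))%R]).
have ms : measurable_fun setT (fun q : (borel R d * Omega) * borel R d =>
    ((q.2 : 'rV[R]_d) + (q.1.1 : 'rV[R]_d))%R : borel R d).
  apply: measurable_rVD; first exact: measurable_snd.
  by apply: measurableT_comp; [exact: measurable_fst|exact: measurable_fst].
by rewrite -[X in measurable X]setTI; exact: (ms measurableT _ mA).
Qed.

Lemma measurable_hit_prob (A : set (borel R d)) : measurable A ->
  measurable_fun setT (hit_prob L0 A : borel R d -> \bar R).
Proof.
move=> mA; have := measurable_fun_xsection P (measurable_hit mA).
by apply: eq_measurable_fun => z _; rewrite /hit_prob /= xsectionE.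
Qed.

Lemma measurable_hit_at (A : set (borel R d)) z : measurable A ->
  measurable [set w | exists2 y, L0 w y & A (y + z)%R].
Proof. by move=> mA; have := measurable_xsection (z : borel R d) (measurable_hit mA); rewrite xsectionE. Qed.

Lemma hit_prob01 (A : set (borel R d)) z : measurable A -> 0 <= hit_prob L0 A z <= 1.
Proof. by move=> mA; rewrite measure_ge0//= probability_le1//; exact: measurable_hit_at. Qed.

End hit_prob.

Context (lambda : R) (lambda_gt0 : (0 < lambda)%R).
Context (Pi : {RV P >-> config R d}) (Pi_poisson : stationary_poisson lambda Pi).
Context (L0 N : {RV P >-> config R d}) (L0_finite : finite_point_process L0).
Context (N_pcp : poisson_cluster_process Pi L0 N).

Lemma measurable_void (A : set (borel R d)) : measurable A ->
  measurable [set w | (N w : set 'rV[R]_d) `&` A = set0].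
Proof.
move=> mA; rewrite (_ : mkset _ = setT `&` (fun w => counting ((N w : set 'rV[R]_d) `&` A) : \bar R) @^-1` [set 0]).
  apply: (measurableT_comp (measurable_counting_config mA) (measurable_funPT N)) => //.
by rewrite setTI; apply/seteqP; split => w /= /counting_eq0; [exact|exact].
Qed.

(** The process misses [A] when each cluster, placed at its point, misses [A]. By
    [independent_marks] the first [n] clusters do so with probability the mean of a product of
    factors [1 - hit_prob]; [laplace_functional] gives the limit. *)
Lemma void_probability (A : set (borel R d)) : measurable A ->
  \int[@lebesgue_rV R d]_z hit_prob L0 A z < +oo ->
  P [set w | (N w : set 'rV[R]_d) `&` A = set0] =
  (expR (- (lambda * fine (\int[@lebesgue_rV R d]_z hit_prob L0 A z))))%:E.
Proof.
move=> mA IA; have [_ [x [L [x_enum [L_finite L_law] L_indep Lx_indep N_union]]]] := N_pcp.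
pose f z := fine (hit_prob L0 A z).
have fE z : (f z)%:E = hit_prob L0 A z.
  have /andP[h0 h1] := hit_prob01 L0_finite z mA.
  by rewrite fineK// ge0_fin_numE// (le_lt_trans h1)// ltry.
have f01 z : (0 <= f z <= 1)%R by rewrite -!lee_fin !fE; exact: hit_prob01.
have mf : measurable_fun setT (f : borel R d -> R).
  exact: (measurableT_comp (fine_measurable measurableT) (measurable_hit_prob L0_finite mA)).
have IE : \int[@lebesgue_rV R d]_z hit_prob L0 A z = \int[@lebesgue_rV R d]_z (f z)%:E.
  by apply: eq_integral => z _; rewrite fE.
pose D : set (config R d * borel R d) := [set p | forall y, finite_part p.1 y -> ~ A (y + p.2)%R].
have mD : measurable D.
  have m1 : measurable_fun setT (fun p : config R d * borel R d => finite_part p.1).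
    by apply: (measurableT_comp (@measurable_finite_part R d)); exact: measurable_fst.
  apply: (@measurable_forall_section R d _ _ _ m1 (fun p => finite_finite_part p.1)
    [set q | ~ A ((q.2 : 'rV[R]_d) + (q.1.2 : 'rV[R]_d))%R]).
  have ms : measurable_fun setT (fun q : (config R d * borel R d) * borel R d =>
      ((q.2 : 'rV[R]_d) + (q.1.2 : 'rV[R]_d))%R : borel R d).
    apply: measurable_rVD; first exact: measurable_snd.
    by apply: measurableT_comp; [exact: measurable_snd|exact: measurable_fst].
  apply: measurableC.
  by rewrite -[X in measurable X]setTI; exact: (ms measurableT _ mA).
pose M n := \bigcap_(i < n) (fun w => (L i w, x i w)) @^-1` D.
have mM1 i : measurable ((fun w => (L i w, x i w)) @^-1` D).
  rewrite -[X in measurable X]setTI.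
  by apply: (measurable_fun_pair (measurable_funPT (L i)) (measurable_funPT (x i))).
have mM n : measurable (M n).
  by apply: fin_bigcap_measurable => [|i _]; [exact: finite_II|exact: mM1].
have PM n : P (M n) = \int[P]_w (\prod_(i < n) (1 - f (x i w)))%:E.
  rewrite (independent_marks L_indep Lx_indep n (fun=> mD)); apply: eq_integral => w _.
  congr EFin; apply: eq_bigr => i _.
  have mY : measurable (ysection D (x i w)) by exact: measurable_ysection.
  transitivity (fine (P (L0 @^-1` ysection D (x i w)))).
    by rewrite -[P (L0 @^-1` _)](L_law i _ mY).
  rewrite (_ : _ @^-1` _ = ~` [set v | exists2 y, L0 v y & A (y + x i w)%R]).
    rewrite probability_setC; last exact: measurable_hit_at.
    by rewrite -/(hit_prob L0 A (x i w)) -fE -EFinB.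
  apply/seteqP; split => v /=; rewrite ysectionE /=.
    by move=> H [y Ly Ay]; apply: (H y) => //; rewrite /= (finite_partE (L0_finite v)).
  by move=> H y; rewrite /= (finite_partE (L0_finite v)) => Ly Ay; apply: H; exists y.
have cM : P (M n) @[n --> \oo] --> P (\bigcap_n M n).
  apply: nonincreasing_cvg_mu => //.
  - by rewrite (le_lt_trans (probability_le1 _ _)) ?ltry.
  - by apply: bigcapT_measurable.
  - by move=> n m nm; apply/subsetPset => w H i /= ni; apply: H; rewrite /= (leq_trans ni nm).
rewrite IE in IA *.
have := laplace_functional lambda_gt0 Pi_poisson x_enum mf f01 IA.
move=> /(cvg_lim (@ereal_hausdorff _)) <-.
rewrite (_ : (fun n => _) = (fun n => P (M n))); last by apply/funext => n; rewrite PM.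
rewrite (cvg_lim _ cM)//; apply: ae_eq_probability.
- exact: measurable_void.
- exact: bigcapT_measurable.
apply: filterS N_union => w Nw; rewrite /= Nw; split.
  move=> H n _ i /= ni y; rewrite /= (finite_partE (L_finite i w)) => Ly Ay.
  suff : (set0 : set 'rV[R]_d) (y + x i w)%R by [].
  by rewrite -H; split => //; exists i => //; exists y.
move=> H; apply/seteqP; split => // _ [[i _ [y Ly <-]] Ay].
(* [M n] only concerns indices below [n], so index [i] is read off from [M i.+1]. *)
have /= Hi := H i.+1 I i (ltnSn i).
by apply: (Hi y) => //; rewrite (finite_partE (L_finite i w)).
Qed.

End void_probability.

(** * Exposed points *)

Section exposed.
Context (R : realType) (d : nat) (B : set 'rV[R]_d).
Local Notation g := (gauge B).

Definition direction (x : 'rV[R]_d) : 'rV[R]_d := (g x)^-1 *: x.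

(** If [y] is moved to the position [s *: u], then [y'] moves to [s *: u + (y' - y)], so the
    condition depends on differences only. The threshold [c] is kept apart from the level [s] for
    the upper bound on shells, where it is smaller. *)
Definition exposed (K : set 'rV[R]_d) (s c : R) (u : 'rV[R]_d) : set 'rV[R]_d :=
  K `&` [set y | forall y', K y' -> y' <> y -> c < g (s *: u + (y' - y))].

Hypothesis B_compact : compact B.
Hypothesis B_convex : convex_set (B : set (convex_lmodType 'rV[R]_d)).
Hypothesis B_nbhs0 : nbhs (0 : 'rV[R]_d) B.

Lemma gauge_direction x : x != 0 -> g (direction x) = 1.
Proof.
move=> x0; rewrite /direction gaugeZ ?invr_ge0 ?gauge_ge0// mulVf//.
by rewrite gauge_eq0.
Qed.

Lemma gauge_directionE x : x = g x *: direction x.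
Proof.
have [->|x0] := eqVneq x 0; first by rewrite /direction !scaler0.
by rewrite /direction scalerA mulfV ?scale1r// gauge_eq0.
Qed.

(** Subadditivity along [u]: the function [g (s *: u + v) - s] does not increase with [s]. This is
    where convexity of [B] makes exposed points fewer at higher levels. *)
Lemma gauge_ray s t u v : s <= t -> g u <= 1 ->
  g (t *: u + v) <= g (s *: u + v) + (t - s).
Proof.
move=> st gu; rewrite (_ : t *: u + v = (s *: u + v) + (t - s) *: u).
  apply: le_trans (gaugeD B_compact B_convex B_nbhs0 _ _) _.
  by rewrite lerD2l gaugeZ ?subr_ge0// ler_piMr// subr_ge0.
by rewrite scalerBl [RHS]addrC addrA subrK.
Qed.

Lemma measurable_direction : measurable_fun setT (direction : borel R d -> borel R d).
Proof.
apply: (@measurable_rVZ _ _ _ d (fun x : borel R d => (g x)^-1) id); last exact: measurable_id.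
(* The inverse is written with exponential and logarithm, whose measurability is at hand; at gauge
   [0] both sides are [0]. *)
rewrite (_ : (fun _ => _) = (fun x : borel R d => if 0 < g x then expR (- ln (g x)) else 0)).
  have mg := measurable_gauge B_compact B_convex B_nbhs0.
  apply: measurable_fun_ifT => //; first exact: measurable_fun_ltr.
  apply: (measurableT_comp (@measurable_expR R)); apply: measurable_funN.
  exact: (measurableT_comp (@measurable_ln R) mg).
apply/funext => x; case: ifPn => [g0|]; first by rewrite expRN lnK.
by rewrite -leNgt le_eqVlt ltNge gauge_ge0// orbF => /eqP ->; rewrite invr0.
Qed.

Section joint.
Context dX (X : measurableType dX) (phi : X -> config R d) (mphi : measurable_fun setT phi).
Hypothesis fphi : forall x, finite_set (phi x : set 'rV[R]_d).
Context (s : R) (c : X -> R) (mc : measurable_fun setT (c : X -> measurableTypeR R)) (h : X -> 'rV[R]_d) (mh : measurable_fun setT (h : X -> borel R d)).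

(** The threshold and the direction may depend on the parameter. For a random level, that level is
    absorbed into [h] and [s = 1] is taken. *)
Lemma measurable_exposed_rel :
  measurable ([set p : X * borel R d | forall y', phi p.1 y' -> y' <> p.2 ->
    c p.1 < g (s *: h p.1 + (y' - p.2))]).
Proof.
have m1 : measurable_fun setT (fun p : X * borel R d => phi p.1).
  by apply: measurableT_comp => //; exact: measurable_fst.
apply: (@measurable_forall_section R d _ _ _ m1 (fun p => fphi p.1)
  [set q | (q.2 : 'rV[R]_d) <> (q.1.2 : 'rV[R]_d) ->
    c q.1.1 < g (s *: h q.1.1 + ((q.2 : 'rV[R]_d) - (q.1.2 : 'rV[R]_d)))]).
have m12 : measurable_fun setT (fun q : (X * borel R d) * borel R d => q.1.2).
  by apply: measurableT_comp; [exact: measurable_snd|exact: measurable_fst].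
rewrite (_ : mkset _ = [set q : (X * borel R d) * borel R d | (q.2 : 'rV[R]_d) = q.1.2] `|`
    [set q : (X * borel R d) * borel R d |
      c q.1.1 < g (s *: h q.1.1 + ((q.2 : 'rV[R]_d) - (q.1.2 : 'rV[R]_d)))]).
  apply: measurableU; first by apply: measurable_eq_rV => //; exact: measurable_snd.
  have ms : measurable_fun setT (fun q : (X * borel R d) * borel R d =>
      g (s *: h q.1.1 + ((q.2 : 'rV[R]_d) - (q.1.2 : 'rV[R]_d))) : measurableTypeR R).
    apply: (measurableT_comp (measurable_gauge B_compact B_convex B_nbhs0)).
    apply: measurable_rVD.
      apply: measurable_rVZ => //; apply: measurableT_comp => //.
      by apply: measurableT_comp; [exact: measurable_fst|exact: measurable_fst].
    by apply: measurable_rVB => //; exact: measurable_snd.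
  have mcq : measurable_fun setT (fun q : (X * borel R d) * borel R d => c q.1.1 : measurableTypeR R).
    apply: measurableT_comp => //.
    by apply: measurableT_comp; [exact: measurable_fst|exact: measurable_fst].
  have := measurable_fun_ltr mcq ms measurableT (Y := [set true]) I; rewrite setTI.
  by [].
apply/seteqP; split => q /=; last by case=> [-> //|].
by move=> H; have [e|ne] := pselect ((q.2 : 'rV[R]_d) = q.1.2); [left|right; exact: H].
Qed.

Lemma measurable_count_exposed :
  measurable_fun setT (fun x => counting (exposed (phi x) s (c x) (h x)) : \bar R).
Proof. exact: (measurable_count_section mphi fphi measurable_exposed_rel). Qed.

End joint.
End exposed.

Section monotone_integral.
Context d (T : measurableType d) (R : realType) (mu : {measure set T -> \bar R}).
Import HBNNSimple.
Local Open Scope ereal_scope.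

(** The integral of a nonnegative function is a supremum over the simple functions below it, so
    monotonicity holds without measurability. Inner integrals can thus be compared directly. *)
Lemma ge0_le_integral_nm (f1 f2 : T -> \bar R) : (forall x, 0 <= f1 x) ->
  (forall x, f1 x <= f2 x) -> \int[mu]_x f1 x <= \int[mu]_x f2 x.
Proof.
move=> f10 f12; rewrite !ge0_integralTE//; last first.
  by move=> x; exact: le_trans (f10 x) (f12 x).
apply: ereal_sup_le => _ [h /= hf1 <-]; exists h => //= x.
exact: le_trans (hf1 x) (f12 x).
Qed.
End monotone_integral.

(** * Hitting a shell and exposed points *)

Section shell.
Context (R : realType) (d : nat) (B : set 'rV[R]_d).
Local Notation g := (gauge B).
Hypothesis B_compact : compact B.
Hypothesis B_convex : convex_set (B : set (convex_lmodType 'rV[R]_d)).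
Hypothesis B_nbhs0 : nbhs (0 : 'rV[R]_d) B.
Implicit Types (K S : set 'rV[R]_d) (a b : R).

(** Every other point has gauge above [a]. Pulling the configuration back along [u] from gauge
    [g (y + z)], at most [b], to level [a] costs at most [b - a]; hence the threshold
    [a - (b - a) = 2 * a - b]. *)
Lemma exposed_of_hit K S a b z : 0 <= a -> S `<=` [set x | a < g x <= b] ->
  (exists2 y, K y & S (y + z)) -> ~ (exists2 y, K y & g (y + z) <= a) ->
  exists2 y, K y & S (z + y) /\ exposed B K a (2 * a - b) (direction B (z + y)) y.
Proof.
move=> a0 SS [y Ky Sy] miss; exists y => //; rewrite addrC; split => //.
have /andP[ag gb] := SS _ Sy.
split => // y' Ky' _.
have ag' : a < g (y' + z) by rewrite ltNge; apply/negP => ga; apply: miss; exists y'.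
have yz0 : y + z != 0.
  by rewrite -(gauge_gt0 B_compact B_convex B_nbhs0) (le_lt_trans a0).
have gu : g (direction B (y + z)) <= 1 by rewrite gauge_direction.
have := gauge_ray B_compact B_convex B_nbhs0 (y' - y) (ltW ag) gu.
rewrite -gauge_directionE// (_ : y + z + (y' - y) = y' + z); last first.
  by rewrite addrC addrA subrK.
by move=> H; lra.
Qed.

(** Pushing out from [g (y + z)] to level [b] raises the gauge of another point by at most
    [b - g (y + z)]. Exposure with threshold [b] therefore makes [y + z] strictly nearest, so the
    ball is missed and two such points cannot coexist. *)
Lemma hit_of_exposed K S a b z : 0 <= a -> S `<=` [set x | a < g x <= b] ->
  let E := [set y | S (z + y) /\ exposed B K b b (direction B (z + y)) y] in
  (E !=set0 -> (exists2 y, K y & S (y + z)) /\ ~ (exists2 y, K y & g (y + z) <= a)) /\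
  (forall y y', E y -> E y' -> y = y').
Proof.
move=> a0 SS E.
have key y y' : E y -> K y' -> y' <> y -> g (y + z) < g (y' + z).
  move=> [Sy [Ky Hy]] Ky' y'y; rewrite addrC in Sy Hy.
  have /andP[ag gb] := SS _ Sy.
  have yz0 : y + z != 0.
    by rewrite -(gauge_gt0 B_compact B_convex B_nbhs0) (le_lt_trans a0).
  have gu : g (direction B (y + z)) <= 1 by rewrite gauge_direction.
  have := gauge_ray B_compact B_convex B_nbhs0 (y' - y) gb gu.
  rewrite -gauge_directionE// (_ : y + z + (y' - y) = y' + z); last first.
    by rewrite addrC addrA subrK.
  by have := Hy y' Ky' y'y; lra.
split=> [[y Ey]|y y' Ey Ey'].
  have [Sy [Ky _]] := Ey; rewrite addrC in Sy; have /andP[ag gb] := SS _ Sy.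
  split; first by exists y.
  move=> [y' Ky' gy'a]; have [yy'|yy'] := pselect (y' = y).
    by move: ag; rewrite -yy' ltNge gy'a.
  by have := key _ _ Ey Ky' yy'; rewrite ltNge (le_trans gy'a (ltW ag)).
apply: contrapT => yy'.
have [_ [Ky _]] := Ey; have [_ [Ky' _]] := Ey'.
have := lt_trans (key _ _ Ey Ky' (fun e => yy' (esym e))) (key _ _ Ey' Ky yy').
by rewrite ltxx.
Qed.

Context disp (Omega : measurableType disp) (P : probability Omega R).
Context (L0 : {RV P >-> config R d}) (L0_finite : finite_point_process L0).
Local Open Scope ereal_scope.

Definition mean_exposed (s c : R) (u : 'rV[R]_d) : \bar R :=
  \int[P]_w counting (exposed B (L0 w) s c u).

Let phi (p : borel R d * Omega) : config R d := L0 p.2.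
Let mphi : measurable_fun setT phi.
Proof. by apply: (measurableT_comp (measurable_funPT L0)); exact: measurable_snd. Qed.
Let fphi p : finite_set (phi p : set 'rV[R]_d) := L0_finite p.2.

Let marked (S : set 'rV[R]_d) (s c : R) (x : 'rV[R]_d) (w : Omega) : set 'rV[R]_d :=
  (L0 w : set 'rV[R]_d) `&` [set y | S x /\ exposed B (L0 w) s c (direction B x) y].

Let markedE (S : set (borel R d)) s c x w :
  counting (marked S s c x w) =
  counting (exposed B (L0 w) s c (direction B x)) * (\1_S x)%:E :> \bar R.
Proof.
rewrite /marked indicE; have [xS|xS] := boolP (x \in S).
  rewrite mule1; congr counting; apply/seteqP; split => y /=; first by case=> _ [].
  by move=> [Ky Hy]; split => //; split => //; rewrite inE in xS.
rewrite mule0 (_ : _ `&` _ = set0) ?counting_finite ?fset_set0//.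
by apply/seteqP; split => y //= [_ [/mem_set]]; rewrite (negbTE xS).
Qed.

Let measurable_marked (S : set (borel R d)) s c : measurable S ->
  measurable_fun setT (fun p : borel R d * Omega => counting (marked S s c p.1 p.2) : \bar R).
Proof.
move=> mS; under eq_fun do rewrite markedE.
apply: emeasurable_funM.
  apply: (measurable_count_exposed B_compact B_convex B_nbhs0 mphi fphi s (@measurable_cst _ _ _ _ setT c)
    (h := fun p => direction B p.1)).
  by apply: (measurableT_comp (measurable_direction B_compact B_convex B_nbhs0)); exact: measurable_fst.
have mI : measurable_fun setT (\1_S : borel R d -> R) by exact: measurable_indic.
by apply/measurable_EFinP; exact: (measurableT_comp mI measurable_fst).
Qed.

(** Integrating over the position of the exposed point instead of the cluster centre leaves an
    integrand that depends on the direction only. *)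
Let tonelli_marked (S : set (borel R d)) s c : measurable S ->
  \int[P]_w \int[@lebesgue_rV R d]_z
    counting ((L0 w : set 'rV[R]_d) `&`
      [set y | S (z + y)%R /\ exposed B (L0 w) s c (direction B (z + y)%R) y]) =
  \int[@lebesgue_rV R d]_(x in S) mean_exposed s c (direction B x).
Proof.
move=> mS.
transitivity (\int[P]_w \int[@lebesgue_rV R d]_x counting (marked S s c x w)).
  apply: eq_integral => w _.
  pose E : set (borel R d * borel R d) := [set p | S p.1 /\
    forall y', (L0 w : set 'rV[R]_d) y' -> y' <> p.2 -> (c < g (s *: direction B p.1 + (y' - p.2)))%R].
  have mE : measurable E.
    apply: measurableI.
      by rewrite -[X in measurable X]setTI; apply: measurable_fst.
    apply: (@measurable_exposed_rel R d B B_compact B_convex B_nbhs0 _ (borel R d)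
      (fun=> L0 w : config R d) _ (fun=> L0_finite w) s (fun=> c) _ (direction B)) => //.
    exact: measurable_direction.
  have EE (x y : 'rV[R]_d) : (L0 w : set 'rV[R]_d) y ->
      E (x, y) <-> (S x /\ exposed B (L0 w) s c (direction B x) y).
    by move=> Ly; split => [[Sx Hx]|[Sx [_ Hx]]].
  have EI (x : 'rV[R]_d) : (L0 w : set 'rV[R]_d) `&` [set y | E (x + y, y)%R] =
      (L0 w : set 'rV[R]_d) `&` [set y | S (x + y)%R /\ exposed B (L0 w) s c (direction B (x + y)%R) y].
    by apply/seteqP; split => y [Ly /(EE _ _ Ly) Ey].
  have EI' (x : 'rV[R]_d) : (L0 w : set 'rV[R]_d) `&` [set y | E (x, y)] = marked S s c x w.
    by apply/seteqP; split => y [Ly /(EE _ _ Ly) Ey].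
  have key := tonelli_counting (L0_finite w) mE.
  transitivity (\int[@lebesgue_rV R d]_x
      counting ((L0 w : set 'rV[R]_d) `&` [set y | E ((x : 'rV[R]_d) + y, y)%R])).
    by apply: eq_integral => x _; rewrite EI.
  by rewrite key; apply: eq_integral => x _; rewrite EI'.
have FT := @fubini_tonelli _ _ _ _ R (@lebesgue_rV R d) P
  (fun p => counting (marked S s c p.1 p.2)) (measurable_marked s c mS) (fun p => counting_ge0 R _).
transitivity (\int[@lebesgue_rV R d]_x \int[P]_w counting (marked S s c x w)).
  exact: (esym FT).
rewrite [RHS]integral_mkcond; apply: eq_integral => x _.
rewrite /= patchE; have [xS|xS] := boolP (x \in S).
  apply: eq_integral => w _; congr counting; rewrite /marked.
  by apply/seteqP; split => y /=; [case=> _ []|move=> [Ly Hy]; split => //; split => //; rewrite inE in xS].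
rewrite integral0_eq// => w _; rewrite markedE indicE (negbTE xS) mule0//.
Qed.

Let ball a : set 'rV[R]_d := [set x | (g x <= a)%R].
Let missed (S : set 'rV[R]_d) a : set (borel R d * Omega) :=
  [set p | (exists2 y, L0 p.2 y & S (y + p.1)%R) /\ ~ (exists2 y, L0 p.2 y & ball a (y + p.1)%R)].

Lemma measurable_gauge_ball a : measurable ([set x | (g x <= a)%R] : set (borel R d)).
Proof. by apply: closed_borel; exact: closed_gauge_ball. Qed.

Let measurable_missed (S : set (borel R d)) a : measurable S -> measurable (missed S a).
Proof.
move=> mS; apply: measurableI; first exact: measurable_hit.
by apply: measurableC; apply: measurable_hit => //; exact: measurable_gauge_ball.
Qed.

(** The increment in the exponent of the void probability, up to the factor [lambda], when [S] is
    added to the gauge ball of radius [a]; see [hit_gainE]. *)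
Definition hit_gain (S : set 'rV[R]_d) (a : R) : \bar R :=
  \int[@lebesgue_rV R d]_z P [set w | missed S a (z, w)].

Lemma hit_gainE (S : set (borel R d)) a : measurable S ->
  \int[@lebesgue_rV R d]_z hit_prob L0 (ball a `|` S) z =
  \int[@lebesgue_rV R d]_z hit_prob L0 (ball a) z + hit_gain S a.
Proof.
move=> mS; have mB := measurable_gauge_ball a.
rewrite /hit_gain -ge0_integralD//; last 2 first.
- exact: (measurable_hit_prob L0_finite mB).
- have := measurable_fun_xsection P (measurable_missed a mS).
  by apply: eq_measurable_fun => z _; rewrite /= xsectionE.
apply: eq_integral => z _; rewrite /hit_prob -measureU//.
- congr (P _); apply/seteqP; split => w /=.
    move=> [y Ly [By|Sy]]; first by left; exists y.
    have [h|h] := pselect (exists2 y, L0 w y & ball a (y + z)%R); first by left.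
    by right; split => //; exists y.
  by case=> [[y Ly By]|[[y Ly Sy] _]]; exists y => //; [left|right].
- exact: (measurable_hit_at L0_finite z mB).
- have := measurable_xsection (z : borel R d) (measurable_missed a mS).
  by rewrite xsectionE.
- by apply/seteqP; split => w //= [h [_ nh]].
Qed.

Let hit_gain_tonelli (S : set (borel R d)) a : measurable S ->
  hit_gain S a = \int[P]_w \int[@lebesgue_rV R d]_z (\1_(missed S a) (z, w))%:E.
Proof.
move=> mS; have mM := measurable_missed a mS.
have mI : measurable_fun setT (fun p : borel R d * Omega => (\1_(missed S a) p)%:E : \bar R).
  by apply/measurable_EFinP; exact: measurable_indic.
have FT := @fubini_tonelli _ _ _ _ R (@lebesgue_rV R d) P _ mI (fun p => _).
transitivity (\int[@lebesgue_rV R d]_z \int[P]_w (\1_(missed S a) (z, w))%:E).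
  apply: eq_integral => z _; rewrite -[X in P X]setIT -integral_indic//.
  by have := measurable_xsection (z : borel R d) mM; rewrite xsectionE.
by apply: FT => p; rewrite lee_fin.
Qed.

Lemma hit_gain_le (S : set (borel R d)) a b : measurable S -> (0 <= a)%R ->
  S `<=` [set x | (a < g x <= b)%R] ->
  hit_gain S a <= \int[@lebesgue_rV R d]_(x in S) mean_exposed a (2 * a - b) (direction B x).
Proof.
move=> mS a0 SS; rewrite hit_gain_tonelli// -tonelli_marked//.
apply: ge0_le_integral_nm => w; first by apply: integral_ge0 => z _; rewrite lee_fin.
apply: ge0_le_integral_nm => z; first by rewrite lee_fin.
rewrite indicE; case: (boolP (_ \in _)) => [|_]; last exact: counting_ge0.
rewrite inE => -[/= hS hB]; apply: counting_ge1.
by have [y Ly Ey] := exposed_of_hit a0 SS hS hB; exists y.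
Qed.

(** The count is at most [1] and vanishes unless [S] is hit before the ball, so it lies below an
    indicator, by [hit_of_exposed]. *)
Lemma hit_gain_ge (S : set (borel R d)) a b : measurable S -> (0 <= a)%R ->
  S `<=` [set x | (a < g x <= b)%R] ->
  \int[@lebesgue_rV R d]_(x in S) mean_exposed b b (direction B x) <= hit_gain S a.
Proof.
move=> mS a0 SS; rewrite hit_gain_tonelli// -tonelli_marked//.
apply: ge0_le_integral_nm => w; first by apply: integral_ge0 => z _; exact: counting_ge0.
apply: ge0_le_integral_nm => z; first exact: counting_ge0.
have [hit uniq] := @hit_of_exposed (L0 w) S a b z a0 SS.
set E := [set y | _] in hit uniq; set E' := _ `&` _.
have [E0|/set0P[y Ey]] := eqVneq E' set0.
  by rewrite E0 counting_finite// fset_set0 lee_fin.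
have [hS hB] := hit (ex_intro _ y Ey.2).
rewrite indicE mem_set//; apply: (@le_trans _ _ (counting [set y])).
  by apply: le_counting => y' [_ Ey']; rewrite /= (uniq _ _ Ey.2 Ey').
by rewrite counting_finite// fset_set1 cardfs1.
Qed.

End shell.

(** * Limits of exposed sets and of their mean sizes *)

Lemma filter_finite_set (T : choiceType) X (F : set_system X) {FF : Filter F} (K : set T)
    (Q : T -> X -> Prop) : finite_set K ->
  (forall y, K y -> \forall b \near F, Q y b) -> \forall b \near F, forall y, K y -> Q y b.
Proof.
move=> fK H; have := @filter_bigI X T (fset_set K) Q F FF.
have H' i : i \in fset_set K -> F (Q i) by rewrite in_fset_set// inE; exact: H.
move=> /(_ H'); apply: filterS => b Hb y Ky; apply: Hb.
by rewrite /= in_fset_set//; exact: mem_set.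
Qed.

Section exposed_limits.
Context (R : realType) (d : nat) (B : set 'rV[R]_d).
Local Notation g := (gauge B).
Hypothesis B_compact : compact B.
Hypothesis B_convex : convex_set (B : set (convex_lmodType 'rV[R]_d)).
Hypothesis B_nbhs0 : nbhs (0 : 'rV[R]_d) B.
Implicit Types (K : set 'rV[R]_d) (a b : R) (u v : 'rV[R]_d).

Lemma near_right_lt a c : a < c -> \forall b \near a^'+, b < c.
Proof. by move=> ac; near=> b; near: b; exact: nbhs_right_lt. Unshelve. all: by end_near. Qed.

(** The gauge is not symmetric, but it is equivalent to a norm, so changing the sign costs at most a
    constant factor. *)
Lemma gauge_opp_bound : exists2 M : R, 0 < M & forall z, g (- z) <= M * g z.
Proof.
have [M1 M10 H1] := gauge_le_norm B_nbhs0.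
have [M2 M20 H2] := norm_le_gauge B_compact B_convex B_nbhs0.
exists (M1 * M2); first exact: mulr_gt0.
move=> z; apply: le_trans (H1 _) _; rewrite normrN -mulrA ler_pM2l//.
Qed.

Lemma near_gauge_gt a u v : g u <= 1 -> a < g (a *: u + v) ->
  \forall b \near a^'+, b < g (b *: u + v).
Proof.
move=> gu av; have [M M0 HM] := gauge_opp_bound.
(* Moving from [a] to [b] raises the threshold by [b - a] and lowers the gauge by at most
   [M * (b - a)]; hence the slack is divided by [M + 1]. *)
have e0 : 0 < (g (a *: u + v) - a) / (M + 1).
  by rewrite divr_gt0 ?subr_gt0// addr_gt0.
near=> b.
have ab : a < b by near: b; exact: nbhs_right_gt.
have be : b < a + (g (a *: u + v) - a) / (M + 1).
  by near: b; apply: near_right_lt; rewrite ltrDl.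
have H : g (a *: u + v) <= g (b *: u + v) + M * (b - a).
  rewrite (_ : a *: u + v = (b *: u + v) + - ((b - a) *: u)).
    apply: le_trans (gaugeD B_compact B_convex B_nbhs0 _ _) _; rewrite lerD2l.
    apply: le_trans (HM _) _; rewrite ler_pM2l//.
    rewrite gaugeZ ?subr_ge0// ?(ltW ab)//.
    by rewrite ler_piMr// subr_ge0 ltW.
  by rewrite scalerBl opprB [RHS]addrC addrA subrK.
have : (b - a) * (M + 1) < g (a *: u + v) - a.
  by rewrite -ltr_pdivlMr ?addr_gt0// ltrBlDl.
move: H; move: (g (a *: u + v)) (g (b *: u + v)) => s t; nra.
Unshelve. all: by end_near.
Qed.

(** Each of the finitely many comparisons is stable to the right of [a]: a strict one by
    [near_gauge_gt], the opposite one by [gauge_ray]. *)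
Lemma near_exposed_inner K a u : finite_set K -> g u <= 1 ->
  \forall b \near a^'+, exposed B K b b u = exposed B K a a u.
Proof.
move=> fK gu.
have : \forall b \near a^'+, forall y, K y -> forall y', K y' ->
    (b < g (b *: u + (y' - y))) = (a < g (a *: u + (y' - y))).
  apply: filter_finite_set => // y Ky; apply: filter_finite_set => // y' Ky'.
  have [av|av] := ltP a (g (a *: u + (y' - y))); first exact: near_gauge_gt.
  near=> b; have ab : a < b by near: b; exact: nbhs_right_gt.
  apply/negbTE; rewrite -leNgt.
  apply: le_trans (gauge_ray B_compact B_convex B_nbhs0 _ (ltW ab) gu) _.
  by move: av; lra.
apply: filterS => b H; apply/seteqP; split => y [Ky Hy]; split => // y' Ky' yy'.
  by rewrite -H//; exact: Hy.
by rewrite H//; exact: Hy.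
Unshelve. all: by end_near.
Qed.

(** The threshold [2 * a - b] approaches [a] from below. A tie would pass it for every [b > a] and
    fail in the limit, so ties have to be excluded. *)
Lemma near_exposed_outer K a u : finite_set K ->
  (forall y y', K y -> K y' -> y' <> y -> g (a *: u + (y' - y)) <> a) ->
  \forall b \near a^'+, exposed B K a (2 * a - b) u = exposed B K a a u.
Proof.
move=> fK tie.
have : \forall b \near a^'+, forall y, K y -> forall y', K y' -> y' <> y ->
    (2 * a - b < g (a *: u + (y' - y))) = (a < g (a *: u + (y' - y))).
  apply: filter_finite_set => // y Ky; apply: filter_finite_set => // y' Ky'.
  have [yy'|yy'] := pselect (y' = y); first by apply: nearW => b /(_ yy').
  have [av|av] := ltP a (g (a *: u + (y' - y))).
    near=> b; have ab : a < b by near: b; exact: nbhs_right_gt.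
    by move=> _; apply: lt_trans av; lra.
  have av' : g (a *: u + (y' - y)) < a by rewrite lt_neqAle av andbT; apply/eqP; exact: tie.
  near=> b; move=> _; apply/negbTE; rewrite -leNgt.
  have : b < 2 * a - g (a *: u + (y' - y)) by near: b; apply: near_right_lt; lra.
  by lra.
apply: filterS => b H; apply/seteqP; split => y [Ky Hy]; split => // y' Ky' yy'.
  by rewrite -H//; exact: Hy.
by rewrite H//; exact: Hy.
Unshelve. all: by end_near.
Qed.

(** At level [0] the outer threshold is [- b < 0]. This lemma and [exposed00] show that all points
    are exposed both along the sequence and in the limit. *)
Lemma exposed_neg K c u : c < 0 -> exposed B K 0 c u = K.
Proof.
move=> c0; apply/seteqP; split => [y []//|y Ky]; split => // y' _ _.
by apply: (lt_le_trans c0); exact: gauge_ge0.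
Qed.

Lemma exposed00 K u : exposed B K 0 0 u = K.
Proof.
apply/seteqP; split => [y []//|y Ky]; split => // y' _ yy'.
rewrite scale0r add0r gauge_gt0// subr_eq0; exact/eqP.
Qed.
End exposed_limits.

Section shells.
Context (R : realType) (d : nat) (B : set 'rV[R]_d).
Local Notation g := (gauge B).
Hypothesis d_gt0 : (0 < d)%N.
Hypothesis B_compact : compact B.
Hypothesis B_convex : convex_set (B : set (convex_lmodType 'rV[R]_d)).
Hypothesis B_nbhs0 : nbhs (0 : 'rV[R]_d) B.
Implicit Types (C : set 'rV[R]_d) (a b r : R).

Definition shell C a b : set 'rV[R]_d := [set x | a < g x <= b /\ C (direction B x)].

Lemma measurable_shell (C : set (borel R d)) a b : measurable C ->
  measurable (shell C a b : set (borel R d)).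
Proof.
move=> mC; apply: measurableI.
  have := measurable_gauge B_compact B_convex B_nbhs0 measurableT (measurable_itv `]a, b]).
  by rewrite setTI; congr measurable; apply/seteqP; split => x; rewrite /= in_itv.
have mD := measurable_direction B_compact B_convex B_nbhs0.
by rewrite -[X in measurable X]setTI; exact: (mD measurableT _ mC).
Qed.

Local Open Scope ereal_scope.

Lemma lebesgue_shell (C : set (borel R d)) a b : measurable C ->
  lebesgue_rV (shell C a b : set (borel R d)) < +oo.
Proof.
move=> mC; apply: le_lt_trans (lebesgue_gauge_ball B_compact B_convex B_nbhs0 b).
apply: le_measure; rewrite ?inE.
- exact: measurable_shell.
- exact: measurable_gauge_ball.
- by move=> x [/andP[_]].
Qed.

Lemma direction_scale r x : (0 < r)%R -> direction B (r *: x) = direction B x.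
Proof.
move=> r0; rewrite /direction gaugeZ ?(ltW r0)// scalerA invfM mulrAC mulVf ?mul1r//.
by rewrite gt_eqF.
Qed.

Context (psi : borel R d -> \bar R) (mpsi : measurable_fun setT psi).
Hypothesis psi0 : forall u, 0 <= psi u.
Let leb := @lebesgue_rV R d.

Let mdpsi : measurable_fun setT (fun x : borel R d => psi (direction B x)).
Proof. exact: (measurableT_comp mpsi (measurable_direction B_compact B_convex B_nbhs0)). Qed.

(** The integrand is homogeneous of degree [0], so dilating the cone contributes only the Jacobian.
    This stands in for polar coordinates. *)
Lemma integral_cone (C : set (borel R d)) r : measurable C -> (0 < r)%R ->
  \int[leb]_(x in shell C 0 r) psi (direction B x) =
  (r ^+ d)%:E * \int[leb]_(x in shell C 0 1) psi (direction B x).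
Proof.
move=> mC r0; rewrite integral_mkcond [in RHS]integral_mkcond.
pose f : borel R d -> \bar R := (fun x : borel R d => psi (direction B x)) \_ (shell C 0 1).
have mf : measurable_fun setT f.
  apply/(measurable_restrictT _ (measurable_shell 0 1 mC)); exact: measurable_funTS.
have f0 x : 0 <= f x by rewrite /f patchE; case: ifP.
have rV0 : (0 < r^-1)%R by rewrite invr_gt0.
have := ge0_integral_rV_affine 0%R rV0 mf f0; rewrite invrK => <-.
apply: eq_integral => x _; rewrite /f !patchE addr0 direction_scale//.
congr (if _ then _ else _); apply/idP/idP; rewrite !inE /shell /= gaugeZ ?(ltW rV0)// direction_scale//.
  move=> [/andP[g0 gr] Cx]; split => //.
  by rewrite mulr_gt0//= mulrC ler_pdivrMr// mul1r.
move=> [/andP[g0 gr] Cx]; split => //.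
by move: g0 gr; rewrite pmulr_rgt0// => ->/=; rewrite mulrC ler_pdivrMr// mul1r.
Qed.

Lemma integral_shell (C : set (borel R d)) a b : measurable C -> (0 <= a)%R -> (a < b)%R ->
  \int[leb]_(x in shell C 0 1) psi (direction B x) < +oo ->
  \int[leb]_(x in shell C a b) psi (direction B x) =
  (b ^+ d - a ^+ d)%:E * \int[leb]_(x in shell C 0 1) psi (direction B x).
Proof.
move=> mC a0 ab Ilty; have b0 : (0 < b)%R by exact: le_lt_trans ab.
move: a0; rewrite le_eqVlt => /orP[/eqP a0|a0].
  (* A positive dimension is used here: [0 ^+ d] has to be [0]. *)
  by rewrite -a0 expr0n gtn_eqF// subr0; exact: integral_cone.
have Ifin : \int[leb]_(x in shell C 0 1) psi (direction B x) \is a fin_num.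
  by rewrite ge0_fin_numE//; apply: integral_ge0.
have := integral_cone mC b0.
rewrite (_ : shell C 0 b = shell C 0 a `|` shell C a b); last first.
  apply/seteqP; split => x; rewrite /shell /=.
    move=> [/andP[g0 gb] Cx]; have [ga|ga] := leP (g x) a; [left|right]; split => //.
    by rewrite g0.
  case=> [[/andP[g0 ga] Cx]|[/andP[g0 gb] Cx]]; split => //.
    by rewrite g0 (le_trans ga (ltW ab)).
  by rewrite gb (lt_trans a0 g0).
rewrite ge0_integral_setU//=; last 4 first.
- exact: measurable_shell.
- exact: measurable_shell.
- exact: measurable_funTS.
- apply/disj_setPS => x [[/andP[_ ga] _] [/andP[ga' _] _]].
  by move: ga'; rewrite ltNge ga.
rewrite integral_cone//; move: Ifin.
set I := \int[leb]_(x in shell C 0 1) _; set X := \int[leb]_(x in shell C a b) _.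
move=> Ifin H; rewrite -(fineK Ifin) in H *.
have Xfin : X \is a fin_num.
  have : (a ^+ d)%:E * (fine I)%:E + X \is a fin_num by rewrite H.
  by rewrite fin_numD => /andP[].
rewrite -(fineK Xfin) in H *; move: H; rewrite -!EFinM -EFinD => -[H].
by congr EFin; rewrite mulrBl -H; ring.
Qed.

End shells.

Section sphere.
Context (R : realType) (d : nat) (B : set 'rV[R]_d).
Local Notation g := (gauge B).
Hypothesis d_gt0 : (0 < d)%N.
Hypothesis B_compact : compact B.
Hypothesis B_convex : convex_set (B : set (convex_lmodType 'rV[R]_d)).
Hypothesis B_nbhs0 : nbhs (0 : 'rV[R]_d) B.
Local Open Scope ereal_scope.

Lemma measurable_sphere a : measurable ([set x | g x = a] : set (borel R d)).
Proof.
have := measurable_gauge B_compact B_convex B_nbhs0 measurableT (measurable_set1 a).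
by rewrite setTI.
Qed.

(** The sphere lies in every shell from [r < a] to [a], and the volume of these shells tends to
    [0]. *)
Lemma lebesgue_sphere a : (0 < a)%R -> lebesgue_rV ([set x | g x = a] : set (borel R d)) = 0.
Proof.
move=> a0; pose V := lebesgue_rV (shell B setT 0 1 : set (borel R d)).
have Vlty : V < +oo by exact: lebesgue_shell.
have Vfin : V \is a fin_num by rewrite ge0_fin_numE ?lebesgue_rV_ge0.
pose S := lebesgue_rV ([set x | g x = a] : set (borel R d)).
have SV r : (0 < r)%R -> (r < a)%R -> S <= ((a ^+ d - r ^+ d) * fine V)%:E.
  move=> r0 ra; rewrite EFinM fineK//.
  have := @integral_shell R d B d_gt0 B_compact B_convex B_nbhs0 (cst 1) (measurable_cst _)
    (fun _ => lee01) setT r a measurableT (ltW r0) ra.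
  have mS b c := measurable_shell B_compact B_convex B_nbhs0 b c (@measurableT _ (borel R d)).
  rewrite !integral_cst ?mul1e// => /(_ Vlty) <-.
  apply: le_measure; rewrite ?inE//; first exact: measurable_sphere.
  by move=> x /= gx; split => //; rewrite gx ra lexx.
have Sfin : S \is a fin_num.
  rewrite ge0_fin_numE ?lebesgue_rV_ge0//; apply: le_lt_trans (ltry _); apply: (SV (a / 2)%R); first by rewrite divr_gt0.
  by rewrite ltr_pdivrMr// ltr_pMr// ltr1n.
apply/eqP; rewrite eq_le lebesgue_rV_ge0 andbT -[leLHS](fineK Sfin) lee_fin.
have c : (((a ^+ d - r ^+ d) * fine V) @[r --> a^'-] --> (0 : R))%R.
  rewrite -(mul0r (fine V)) -(subrr (a ^+ d)%R).
  apply: cvgM; last exact: cvg_cst.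
  apply: cvgB; first exact: cvg_cst.
  apply: cvg_at_left_filter; exact: exprn_continuous.
rewrite -(cvg_lim (@Rhausdorff R) c); apply: limr_ge; first by apply/cvg_ex; eexists; exact: c.
near=> r; rewrite -lee_fin fineK//; apply: SV.
  by near: r; exact: nbhs_left_gt.
by near: r; exact: nbhs_left_lt.
Unshelve. all: by end_near.
Qed.

End sphere.

Section mean_exposed_limits.
Context (R : realType) (d : nat) (B : set 'rV[R]_d).
Local Notation g := (gauge B).
Hypothesis d_gt0 : (0 < d)%N.
Hypothesis B_compact : compact B.
Hypothesis B_convex : convex_set (B : set (convex_lmodType 'rV[R]_d)).
Hypothesis B_nbhs0 : nbhs (0 : 'rV[R]_d) B.
Context disp (Omega : measurableType disp) (P : probability Omega R).
Context (L0 : {RV P >-> config R d}) (L0_cluster : typical_cluster L0).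
Local Open Scope ereal_scope.
Let leb := @lebesgue_rV R d.
Let L0_finite : finite_point_process L0. Proof. by case: L0_cluster. Qed.
Let mL0 : measurable_fun setT (L0 : Omega -> config R d). Proof. exact: measurable_funPT. Qed.

(** A tie places a difference of two cluster points in a translate of the sphere of radius [a], a
    null set. By absolute continuity the mean number of such pairs is [0]. *)
Lemma tie_null a u : (0 < a)%R ->
  {ae P, forall w, forall y y', (L0 w : set 'rV[R]_d) y -> (L0 w : set 'rV[R]_d) y' ->
     y' <> y -> (g (a *: u + (y' - y)) <> a)%R}.
Proof.
move=> a0; have [_ _ dom] := L0_cluster.
pose A : set (borel R d) := [set v | g (a *: u + (v : 'rV[R]_d))%R = a].
have mA : measurable A.
  have m : measurable_fun setT ((fun v : borel R d => a *: u + (v : 'rV[R]_d))%R : _ -> borel R d).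
    exact: measurable_rVD.
  have := m measurableT _ (measurable_sphere B_compact B_convex B_nbhs0 a).
  by rewrite setTI.
have A0 : leb A = 0.
  have := lebesgue_rV_affine (a *: u) ltr01 (measurable_sphere B_compact B_convex B_nbhs0 a).
  rewrite lebesgue_sphere// mule0 => <-; congr lebesgue_rV.
  by apply/seteqP; split => v /=; rewrite scale1r [(v + _)%R]addrC.
have : difference_measure L0 A = 0.
  apply: (dom A) => //; apply/(measure0_null_setP (@lebesgue_rV R d) mA).
  exact: A0.
move=> D0.
pose E : set Omega := [set w | exists2 y, L0 w y & exists2 y', L0 w y' &
  y' <> y /\ A (y' - y)%R].
have mE : measurable E.
  apply: (@measurable_exists_section R d _ _ _ mL0 L0_finite
    [set p | exists2 y', L0 p.1 y' & y' <> p.2 /\ A (y' - (p.2 : 'rV[R]_d))%R]).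
  have m1 : measurable_fun setT (fun p : Omega * borel R d => L0 p.1 : config R d).
    by apply: measurableT_comp => //; exact: measurable_fst.
  apply: (@measurable_exists_section R d _ _ _ m1 (fun p => L0_finite p.1)
    [set q | (q.2 : 'rV[R]_d) <> (q.1.2 : 'rV[R]_d) /\ A ((q.2 : 'rV[R]_d) - (q.1.2 : 'rV[R]_d))%R]).
  have m12 : measurable_fun setT (fun q : (Omega * borel R d) * borel R d => q.1.2).
    by apply: measurableT_comp; [exact: measurable_snd|exact: measurable_fst].
  apply: measurableI.
    by apply: measurableC; apply: measurable_eq_rV => //; exact: measurable_snd.
  have m : measurable_fun setT (fun q : (Omega * borel R d) * borel R d =>
      ((q.2 : 'rV[R]_d) - (q.1.2 : 'rV[R]_d))%R : borel R d).
    by apply: measurable_rVB => //; exact: measurable_snd.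
  by rewrite -[X in measurable X]setTI; exact: (m measurableT _ mA).
exists E; split => //.
  apply/eqP; rewrite eq_le measure_ge0 andbT -D0 /difference_measure.
  rewrite -[X in P X]setIT -integral_indic//.
  apply: ge0_le_integral_nm => w; first by rewrite lee_fin.
  rewrite indicE; case: (boolP (w \in E)) => [|_]; last exact: counting_ge0.
  rewrite inE => -[y Ly [y' Ly' [yy' Ay]]].
  by apply: counting_ge1; exists (y', y); split.
move=> w /= nH; apply: contrapT => nE; apply: nH => y y' Ly Ly' yy' Hg.
by apply: nE; exists y => //; exists y'.
Qed.

Let card w : \bar R := counting (L0 w : set 'rV[R]_d).
Let mcard : measurable_fun setT card.
Proof.
have := measurableT_comp (measurable_counting_config (@measurableT _ (borel R d))) mL0.
by apply: eq_measurable_fun => w _; rewrite /= setIT.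
Qed.
Let card_int : P.-integrable setT card.
Proof.
have [_ /andP[_ c] _] := L0_cluster.
apply/integrableP; split => //; rewrite (eq_integral card)// => w _.
by rewrite gee0_abs// counting_ge0.
Qed.

Let mexposed s c u : measurable_fun setT (fun w => counting (exposed B (L0 w) s c u) : \bar R).
Proof.
exact: (@measurable_count_exposed R d B B_compact B_convex B_nbhs0 _ Omega L0 mL0 L0_finite s (fun=> c) (@measurable_cst _ _ _ _ setT c) (fun=> u)).
Qed.

Lemma mean_exposed_ge0 s c u : 0 <= mean_exposed B L0 s c u.
Proof. by apply: integral_ge0 => w _; exact: counting_ge0. Qed.

Lemma mean_exposed_le s c u : mean_exposed B L0 s c u <= mean_card L0.
Proof.
apply: ge0_le_integral_nm => w; first exact: counting_ge0.
by apply: le_counting => y [].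
Qed.

Lemma measurable_mean_exposed s c : measurable_fun setT (mean_exposed B L0 s c : borel R d -> \bar R).
Proof.
have mphi : measurable_fun setT (fun p : borel R d * Omega => L0 p.2 : config R d).
  by apply: measurableT_comp => //; exact: measurable_snd.
have m := @measurable_count_exposed R d B B_compact B_convex B_nbhs0 _ _ _ mphi
  (fun p => L0_finite p.2) s (fun=> c) (@measurable_cst _ _ _ _ setT c) (fun p => p.1) measurable_fst.
exact: (measurable_fun_fubini_tonelli_F (m2 := P) _ m (fun p => counting_ge0 R _)).
Qed.

(** Dominated convergence: exposed points are at most the points of the cluster, whose number is
    integrable. *)
Let cvg_mean_exposed (s c : nat -> R) s0 c0 u :
  {ae P, forall w, \forall n \near \oo, exposed B (L0 w) (s n) (c n) u = exposed B (L0 w) s0 c0 u} ->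
  mean_exposed B L0 (s n) (c n) u @[n --> \oo] --> mean_exposed B L0 s0 c0 u.
Proof.
move=> H; have [] := @dominated_convergence _ _ _ P setT measurableT
  (fun n w => counting (exposed B (L0 w) (s n) (c n) u))
  (fun w => counting (exposed B (L0 w) s0 c0 u)) card => //.
- apply: filterS H => w Hw _; apply: cvg_near_cst.
  by apply: filterS Hw => n ->.
- apply: aeW => w n _; rewrite gee0_abs ?counting_ge0//.
  by apply: le_counting => y [].
Qed.

Lemma cvg_mean_exposed_inner a (b : nat -> R) u : (g u <= 1)%R -> (forall n, (a < b n)%R) ->
  (b n @[n --> \oo] --> a)%R ->
  mean_exposed B L0 (b n) (b n) u @[n --> \oo] --> mean_exposed B L0 a a u.
Proof.
move=> gu ab ba; apply: cvg_mean_exposed; apply: aeW => w.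
have Q := near_exposed_inner B_compact B_convex B_nbhs0 a (L0_finite w) gu.
have : \forall n \near \oo, (a < b n)%R ->
  exposed B (L0 w) (b n) (b n) u = exposed B (L0 w) a a u by exact: (ba _ Q).
by apply: filterS => n; exact.
Qed.

Lemma cvg_mean_exposed_outer a (b : nat -> R) u : (0 <= a)%R -> (forall n, (a < b n)%R) ->
  (b n @[n --> \oo] --> a)%R ->
  mean_exposed B L0 a (2 * a - b n) u @[n --> \oo] --> mean_exposed B L0 a a u.
Proof.
move=> a0 ab ba; apply: cvg_mean_exposed.
move: a0; rewrite le_eqVlt => /orP[/eqP a0|a0].
  apply: aeW => w; apply: nearW => n; rewrite -a0 mulr0 sub0r exposed00// exposed_neg//.
  by rewrite oppr_lt0 a0.
apply: filterS (tie_null u a0) => w tie.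
have Q := near_exposed_outer (L0_finite w) tie.
have : \forall n \near \oo, (a < b n)%R ->
  exposed B (L0 w) a (2 * a - b n) u = exposed B (L0 w) a a u by exact: (ba _ Q).
by apply: filterS => n; exact.
Qed.

(** An integral over directions, realised as a volume integral over the unit cone with an integrand
    constant along rays. *)
Definition exposed_flux (C : set 'rV[R]_d) s c : \bar R :=
  \int[leb]_(x in shell B C 0 1) mean_exposed B L0 s c (direction B x).

Let measurable_mean_direction s c (C : set (borel R d)) : measurable C ->
  measurable_fun (shell B C 0 1 : set (borel R d))
    (fun x : borel R d => mean_exposed B L0 s c (direction B x)).
Proof.
move=> mC; apply: measurable_funTS.
exact: (measurableT_comp (measurable_mean_exposed s c) (measurable_direction B_compact B_convex B_nbhs0)).
Qed.

Let bound_integrable (C : set (borel R d)) : measurable C ->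
  leb.-integrable (shell B C 0 1) (cst (mean_card L0)).
Proof.
move=> mC; have [_ /andP[c0 c] _] := L0_cluster.
have mS := measurable_shell B_compact B_convex B_nbhs0 0 1 mC.
apply/integrableP; split => //.
rewrite (eq_integral (cst (mean_card L0))); last first.
  by move=> x _ /=; rewrite gee0_abs// ltW.
rewrite integral_cst//; apply: lte_mul_pinfty.
- exact: ltW.
- by rewrite ge0_fin_numE// ltW.
- exact: lebesgue_shell.
Qed.

Lemma exposed_flux_ge0 C s c : 0 <= exposed_flux C s c.
Proof. by apply: integral_ge0 => x _; exact: mean_exposed_ge0. Qed.

Lemma exposed_flux_lty (C : set (borel R d)) s c : measurable C -> exposed_flux C s c < +oo.
Proof.
move=> mC; have mS := measurable_shell B_compact B_convex B_nbhs0 0 1 mC.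
have [_ /andP[c0 c1] _] := L0_cluster.
have /integrableP[_] := bound_integrable mC; apply: le_lt_trans.
apply: ge0_le_integral => //.
- by move=> x _; exact: mean_exposed_ge0.
- exact: measurable_mean_direction.
- by move=> x _ /=; rewrite gee0_abs ?mean_exposed_le// ltW.
Qed.

Let cvg_exposed_flux (C : set (borel R d)) (s c : nat -> R) s0 c0 : measurable C ->
  (forall u, (g u <= 1)%R ->
    mean_exposed B L0 (s n) (c n) u @[n --> \oo] --> mean_exposed B L0 s0 c0 u) ->
  exposed_flux C (s n) (c n) @[n --> \oo] --> exposed_flux C s0 c0.
Proof.
move=> mC H; have mS := measurable_shell B_compact B_convex B_nbhs0 0 1 mC.
have [_ /andP[mc0 mc1] _] := L0_cluster.
apply: (@dominated_cvg _ _ _ leb _ mS _ _ (cst (mean_card L0))).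
- by move=> n; exact: measurable_mean_direction.
- move=> x [/andP[x0 x1] _]; apply: H; rewrite gauge_direction//.
  by rewrite -(gauge_gt0 B_compact B_convex B_nbhs0).
- by move=> x _; rewrite ge0_fin_numE// ltW.
- exact: bound_integrable.
- by move=> n x _; rewrite gee0_abs ?mean_exposed_le ?mean_exposed_ge0.
Qed.

Lemma cvg_exposed_flux_inner (C : set (borel R d)) a (b : nat -> R) : measurable C ->
  (forall n, (a < b n)%R) -> (b n @[n --> \oo] --> a)%R ->
  exposed_flux C (b n) (b n) @[n --> \oo] --> exposed_flux C a a.
Proof.
by move=> mC ab ba; apply: cvg_exposed_flux => // u gu; exact: cvg_mean_exposed_inner.
Qed.

Lemma cvg_exposed_flux_outer (C : set (borel R d)) a (b : nat -> R) : measurable C -> (0 <= a)%R ->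
  (forall n, (a < b n)%R) -> (b n @[n --> \oo] --> a)%R ->
  exposed_flux C a (2 * a - b n) @[n --> \oo] --> exposed_flux C a a.
Proof.
by move=> mC a0 ab ba; apply: cvg_exposed_flux => // u gu; exact: cvg_mean_exposed_outer.
Qed.

Lemma integral_shell_exposed (C : set (borel R d)) a b s c : measurable C -> (0 <= a)%R -> (a < b)%R ->
  \int[leb]_(x in shell B C a b) mean_exposed B L0 s c (direction B x) =
  (b ^+ d - a ^+ d)%:E * exposed_flux C s c.
Proof.
move=> mC a0 ab; apply: integral_shell => //.
- exact: measurable_mean_exposed.
- by move=> u; exact: mean_exposed_ge0.
- exact: exposed_flux_lty.
Qed.

End mean_exposed_limits.

(** * Contact directions *)

Section contact.
Context (R : realType) (d : nat) (B : set 'rV[R]_d) (u0 : 'rV[R]_d).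
Local Notation g := (gauge B).
Hypothesis B_compact : compact B.
Hypothesis B_convex : convex_set (B : set (convex_lmodType 'rV[R]_d)).
Hypothesis B_nbhs0 : nbhs (0 : 'rV[R]_d) B.
Implicit Types (K : set 'rV[R]_d) (t : R).

Lemma finite_gauge_ball K t : locally_finite K -> finite_set (K `&` [set x | g x <= t]).
Proof.
move=> lK; have [t0|t0] := leP 0 t; first by apply: lK; exact: gauge_ball_compact.
rewrite (_ : _ `&` _ = set0)//; apply/seteqP; split => x //= [_ gt].
by have := gauge_ge0 B_nbhs0 x; rewrite leNgt (le_lt_trans gt t0).
Qed.

Lemma finite_set_argmin (K : set 'rV[R]_d) (f : 'rV[R]_d -> R) : finite_set K -> K !=set0 ->
  exists2 x, K x & forall y, K y -> f x <= f y.
Proof.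
move=> /finite_seqP[s ->] [x0 /= x0s].
have [x xs xmin] : exists2 x, x \in s & forall y, y \in s -> f x <= f y.
  elim: s x0 x0s => // z s IH x0 _.
  have [->|] := eqVneq s [::]; first by exists z; rewrite ?mem_head// => y; rewrite inE => /eqP ->.
  case: s IH => // z' s IH _; have [x xs xmin] := IH z' (mem_head _ _).
  have [zx|xz] := leP (f z) (f x).
    exists z; first exact: mem_head.
    move=> y; rewrite in_cons => /orP[/eqP ->//|/xmin]; exact: le_trans.
  exists x; first by rewrite in_cons xs orbT.
  by move=> y; rewrite in_cons => /orP[/eqP ->|/xmin//]; exact: ltW.
by exists x.
Qed.

(** By local finiteness only finitely many points compete, so the distance is attained. *)
Lemma gauge_dist_minimizer K t : locally_finite K -> K `&` [set x | g x <= t] !=set0 ->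
  exists x, [/\ K x, g x <= t, forall y, K y -> g x <= g y & gauge_dist B 0 K = (g x)%:E].
Proof.
move=> lK Kt.
have [x [Kx gx] xmin] := finite_set_argmin g (finite_gauge_ball t lK) Kt.
have xmin' y : K y -> g x <= g y.
  move=> Ky; have [gy|gy] := leP (g y) t; first exact: xmin.
  exact: le_trans gx (ltW gy).
exists x; split => //; apply/eqP; rewrite eq_le; apply/andP; split.
  apply: ereal_inf_lbound; exists (g x) => //; split; first exact: gauge_ge0.
  by exists x; split => //; exact: homothet_gauge.
apply: le_ereal_inf_tmp => _ [s [s0 [y [ys Ky]]] <-]; rewrite lee_fin.
apply: le_trans (xmin' _ Ky) _; exact: gauge_le_homothet.
Qed.

Lemma gauge_dist_le K t : locally_finite K -> 0 <= t ->
  (gauge_dist B 0 K <= t%:E)%E <-> K `&` [set x | g x <= t] !=set0.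
Proof.
move=> lK t0; split; last first.
  by move=> /(gauge_dist_minimizer lK)[x [_ gx _ ->]]; rewrite lee_fin.
(* The infimum is not yet known to be attained. The radius [t + 1] provides some point of [K], after
   which [gauge_dist_minimizer] applies. *)
move=> dt; have : (gauge_dist B 0 K < (t + 1)%:E)%E.
  by apply: le_lt_trans dt _; rewrite lte_fin ltrDl.
move=> /ereal_inf_lt[_ [s [s0 [y [ys Ky]]] <-]]; rewrite lte_fin => st.
have : K `&` [set x | g x <= t + 1] !=set0.
  by exists y; split => //=; apply: le_trans (ltW st); exact: gauge_le_homothet.
move=> /(gauge_dist_minimizer lK)[x [Kx _ _ dx]]; exists x; split => //=.
by rewrite -lee_fin -dx.
Qed.

Definition nearest K x := K x /\ forall y, K y -> y <> x -> g x < g y.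

(** The contact direction points from the contact point back to the origin; hence the sign here and
    the use of [opposite] below. *)
Lemma contact_dir_nearest K x : locally_finite K -> nearest K x -> x != 0 ->
  contact_dir B u0 K 0 = - direction B x.
Proof.
move=> lK [Kx xmin] x0.
have Kt : K `&` [set y | g y <= g x] !=set0 by exists x; split => //=.
have [x' [Kx' gx' _ dx']] := gauge_dist_minimizer lK Kt.
have xx' : x' = x by apply: contrapT => /(xmin _ Kx'); rewrite ltNge gx'.
rewrite xx' in dx'.
have cp : contact_point B 0 K x.
  rewrite /contact_point dx' /=; apply/seteqP; split => y /=.
    move=> [/(gauge_le_homothet B_nbhs0 (gauge_ge0 B_nbhs0 x)) gy Ky].
    by apply: contrapT => /(xmin _ Ky); rewrite ltNge gy.
  by move=> ->; split => //; exact: homothet_gauge.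
rewrite /contact_dir; case: pselect => [h|]; last first.
  case; split; last by exists x.
  by rewrite dx' lte_fin gauge_gt0// x0 ltry.
have : contact_point B 0 K (xget 0 (contact_point B 0 K)) by apply: xgetPex; exists x.
set y := xget 0 _; rewrite /contact_point => E.
have -> : y = x.
  have : [set y] y by [].
  by rewrite -E; move: cp; rewrite /contact_point => ->.
by rewrite dx' /= sub0r scalerN.
Qed.

Lemma contact_dir_tie K : locally_finite K ->
  ~ (exists x, nearest K x /\ x != 0) -> contact_dir B u0 K 0 = u0.
Proof.
move=> lK nK; rewrite /contact_dir; case: pselect => // -[/andP[d0 dy] [x cp]].
exfalso; apply: nK; exists x.
have dfin : gauge_dist B 0 K \is a fin_num by rewrite fin_real// dy (lt_trans _ d0).
move: cp d0; rewrite /contact_point; set t := fine _ => cp.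
rewrite -(fineK dfin) -/t lte_fin => t0.
have [xt Kx] : (homothet B 0 t `&` K) x by rewrite cp.
have gxt : g x <= t by apply: gauge_le_homothet => //; exact: ltW.
have Kt : K `&` [set x | g x <= t] !=set0 by exists x.
have [y [Ky gy ymin dE]] := gauge_dist_minimizer lK Kt.
have tE : t = g y by rewrite /t dE.
have yx : y = x.
  have : (homothet B 0 t `&` K) y by split => //; rewrite tE; exact: homothet_gauge.
  by rewrite cp.
have gx : g x = t by rewrite tE yx.
split; last by rewrite -(gauge_gt0 B_compact B_convex B_nbhs0) gx.
split => // z Kz zx; rewrite lt_neqAle -{2}yx ymin// andbT; apply/eqP => xz.
apply: zx; have : (homothet B 0 t `&` K) z.
  by split => //; rewrite -gx xz; exact: homothet_gauge.
by rewrite cp.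
Qed.

End contact.

Section contact_events.
Context (R : realType) (d : nat) (B : set 'rV[R]_d) (u0 : 'rV[R]_d).
Local Notation g := (gauge B).
Hypothesis B_compact : compact B.
Hypothesis B_convex : convex_set (B : set (convex_lmodType 'rV[R]_d)).
Hypothesis B_nbhs0 : nbhs (0 : 'rV[R]_d) B.
Context disp (Omega : measurableType disp) (P : probability Omega R).
Context (N : {RV P >-> config R d}) (N_lf : forall w, locally_finite (N w)).
Context (C : set (borel R d)) (C_borel : measurable C).
Implicit Types (t a b : R).

Definition contact_event t : set Omega :=
  [set w | (gauge_dist B 0 (N w) <= t%:E)%E /\ C (contact_dir B u0 (N w) 0)].

Definition opposite : set 'rV[R]_d := [set u | C (- u)].

Lemma measurable_opposite : measurable (opposite : set (borel R d)).
Proof.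
have m : measurable_fun setT ((fun u : borel R d => - (u : 'rV[R]_d)) : _ -> borel R d).
  exact: measurable_rVN.
by rewrite -[X in measurable X]setTI; exact: (m measurableT _ C_borel).
Qed.

(** The process may be infinite, but its finitely many points in the ball decide whether a strictly
    nearest point lies there, since all others are farther away. *)
Let phi t w : config R d := (N w : set 'rV[R]_d) `&` [set x | g x <= t].

Let measurable_phi t : measurable_fun setT (phi t).
Proof.
apply: (@measurability _ _ _ (config R d) _ _ (@counting_event R d)) => //.
move=> _ [_ [A [k [mA ->]]] <-]; rewrite setTI.
have mBA : measurable ([set x | g x <= t] `&` A : set (borel R d)).
  by apply: measurableI => //; exact: measurable_gauge_ball.
have := measurableT_comp (measurable_counting_config mBA) (measurable_funPT N).
move=> /(_ measurableT [set k%:R%:E] (emeasurable_set1 _)); rewrite setTI.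
by congr measurable; apply/seteqP; split => w /=; rewrite /phi setIA.
Qed.

Let finite_phi t w : finite_set (phi t w : set 'rV[R]_d).
Proof. exact: finite_gauge_ball. Qed.

Let nearest_in t (D : set 'rV[R]_d) : set Omega :=
  [set w | exists x, [/\ nearest B (N w) x, g x <= t & D x]].

Let measurable_nearest_in t (D : set (borel R d)) : measurable D -> measurable (nearest_in t D).
Proof.
move=> mD.
have mphi1 : measurable_fun setT (fun p : Omega * borel R d => phi t p.1).
  by apply: measurableT_comp => //; exact: measurable_fst.
have mE : measurable ([set p : Omega * borel R d | D p.2 /\
    forall y, phi t p.1 y -> y <> p.2 -> g p.2 < g y]).
  apply: measurableI; first by rewrite -[X in measurable X]setTI; apply: measurable_snd.
  apply: (@measurable_forall_section R d _ _ _ mphi1 (fun p => finite_phi t p.1)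
    [set q | (q.2 : 'rV[R]_d) <> q.1.2 -> g q.1.2 < g q.2]).
  have m12 : measurable_fun setT (fun q : (Omega * borel R d) * borel R d => q.1.2).
    by apply: measurableT_comp; [exact: measurable_snd|exact: measurable_fst].
  have mg := measurable_gauge B_compact B_convex B_nbhs0.
  rewrite (_ : mkset _ = [set q : (Omega * borel R d) * borel R d | (q.2 : 'rV[R]_d) = q.1.2] `|`
      ~` [set q : (Omega * borel R d) * borel R d | g q.2 <= g q.1.2]).
    apply: measurableU; first by apply: measurable_eq_rV => //; exact: measurable_snd.
    apply: measurableC.
    have m1 := measurableT_comp mg m12.
    have m2 : measurable_fun setT (fun q : (Omega * borel R d) * borel R d => g q.2 : measurableTypeR R).
      by apply: (measurableT_comp mg); exact: measurable_snd.
    have := measurable_fun_ler m2 m1 measurableT (Y := [set true]) I; rewrite setTI.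
    by [].
  apply/seteqP; split => q /= H.
    by have [e|ne] := pselect ((q.2 : 'rV[R]_d) = q.1.2); [left|right; apply/negP; rewrite -ltNge; exact: H].
  by move=> ne; case: H => [//|/negP]; rewrite -ltNge.
have := measurable_exists_section (measurable_phi t) (finite_phi t) mE.
congr measurable; apply/seteqP; split => w /=.
  move=> [x [Nx gx] [Dx H]]; exists x; split => //; split => // y Ny yx.
  have [gy|gy] := leP (g y) t; first exact: H.
  exact: le_lt_trans gx gy.
by move=> [x [[Nx H] gx Dx]]; exists x => //; split => // y [Ny _]; exact: H.
Qed.

Let hit_ball t : set Omega := [set w | (N w : set 'rV[R]_d) `&` [set x | g x <= t] !=set0].

Let measurable_hit_ball t : measurable (hit_ball t).
Proof.
have := measurableC (measurable_void N (measurable_gauge_ball B_compact B_convex B_nbhs0 t)).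
by congr measurable; apply/seteqP; split => w /=; [move/eqP/set0P|move/set0P/eqP].
Qed.

Let neq0 : set 'rV[R]_d := [set x | x != 0].

Let measurable_neq0 : measurable (neq0 : set (borel R d)).
Proof.
have := measurableC (@set1_borel R d 0); congr measurable.
by apply/seteqP; split => x /=; [move/eqP|move/eqP].
Qed.

(** Two cases: a strictly nearest nonzero point determines the direction; otherwise the direction is
    the default [u0], and only hitting the ball and [C u0] matter. *)
Lemma measurable_contact_event t : 0 <= t -> measurable (contact_event t).
Proof.
move=> t0; pose D : set 'rV[R]_d := neq0 `&` [set x | C (- direction B x)].
have mD : measurable (D : set (borel R d)).
  apply: measurableI => //.
  have md := measurable_direction B_compact B_convex B_nbhs0.
  by rewrite -[X in measurable X]setTI; exact: (md measurableT _ measurable_opposite).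
rewrite (_ : contact_event t = nearest_in t D `|`
    (if `[< C u0 >] then hit_ball t `\` nearest_in t neq0 else set0)).
  apply: measurableU; first exact: measurable_nearest_in.
  by case: ifP => // _; apply: measurableD => //; exact: measurable_nearest_in.
apply/seteqP; split => w; rewrite /contact_event /=.
  move=> [/(gauge_dist_le B_compact B_convex B_nbhs0 (N_lf w) t0) hit Cdir].
  have [[x [xnear gx xn0]]|nn] := pselect (nearest_in t neq0 w).
    left; exists x; split => //; split => //=.
    by rewrite -(@contact_dir_nearest R d B u0 B_compact B_convex B_nbhs0 (N w)).
  have dirE : contact_dir B u0 (N w) 0 = u0.
    apply: contact_dir_tie => // -[x [xnear xn0]]; apply: nn; exists x; split => //.
    have [y [Ny gy]] := hit.
    have [->//|yx] := pselect (x = y).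
    by apply: le_trans gy; apply: ltW; apply: (xnear.2 y Ny) => e; apply: yx.
  by right; rewrite asboolT// -dirE.
case=> [[x [xnear gx [xn0 Cx]]]|].
  rewrite (@contact_dir_nearest R d B u0 B_compact B_convex B_nbhs0 (N w) x)//; split => //.
  apply/(gauge_dist_le B_compact B_convex B_nbhs0 (N_lf w) t0); exists x; split => //.
  by case: xnear.
case: ifPn => // /asboolP Cu0 [hit nn]; split.
  exact/(gauge_dist_le B_compact B_convex B_nbhs0 (N_lf w) t0).
rewrite contact_dir_tie// => -[x [xnear xn0]]; apply: nn; exists x; split => //.
have [y [Ny gy]] := hit.
have [->//|yx] := pselect (x = y).
by apply: le_trans gy; apply: ltW; apply: (xnear.2 y Ny) => e; apply: yx.
Qed.

Definition first_hit a (S : set 'rV[R]_d) : set Omega :=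
  [set w | (N w : set 'rV[R]_d) `&` [set x | g x <= a] = set0 /\
           (N w : set 'rV[R]_d) `&` S !=set0].

Definition double_hit a (S : set 'rV[R]_d) : set Omega :=
  [set w | (N w : set 'rV[R]_d) `&` [set x | g x <= a] = set0 /\
    exists x y, [/\ ((N w : set 'rV[R]_d) `&` S) x, ((N w : set 'rV[R]_d) `&` S) y & x <> y]].

Let nearest_of_single a b w x : 0 <= a ->
  (N w : set 'rV[R]_d) `&` [set x | g x <= a] = set0 -> ~ double_hit a (shell B setT a b) w ->
  (N w : set 'rV[R]_d) x -> g x <= b -> nearest B (N w) x /\ x != 0.
Proof.
move=> a0 miss nd Nx gx.
have ag y : (N w : set 'rV[R]_d) y -> a < g y.
  move=> Ny; rewrite ltNge; apply/negP => gy.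
  by have : (set0 : set 'rV[R]_d) y by rewrite -miss.
split; last by rewrite -(gauge_gt0 B_compact B_convex B_nbhs0) (le_lt_trans a0)// ag.
split => // y Ny yx; have [gy|gy] := leP (g y) b; last exact: le_lt_trans gx gy.
exfalso; apply: nd; split => //; exists x, y; split; [| |by move/esym].
- by split => //; split => //; rewrite ag.
- by split => //; split => //; rewrite ag.
Qed.

(** If the ball of radius [a] is missed and the shell contains a single point, that point is the
    nearest one and fixes the direction. Ties and competing points occur only in [double_hit]. *)
Lemma contact_event_sub a b : 0 <= a -> a < b ->
  contact_event b `\` contact_event a `<=`
  first_hit a (shell B opposite a b) `|` double_hit a (shell B setT a b).
Proof.
move=> a0 ab w [[db Cdir] na].
have b0 : 0 <= b by exact: le_trans (ltW ab).
have [h|nd] := pselect (double_hit a (shell B setT a b) w); [by right|left].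
have miss : (N w : set 'rV[R]_d) `&` [set x | g x <= a] = set0.
  apply/eqP; rewrite -[_ == _]negbK; apply/negP => /set0P h; apply: na; split => //.
  exact/(gauge_dist_le B_compact B_convex B_nbhs0 (N_lf w) a0).
move: db => /(gauge_dist_le B_compact B_convex B_nbhs0 (N_lf w) b0)[x [Nx gx]].
have [xnear x0] := nearest_of_single a0 miss nd Nx gx.
split => //; exists x; split => //; split.
  rewrite gx andbT ltNge; apply/negP => ga.
  by have : (set0 : set 'rV[R]_d) x by rewrite -miss.
by rewrite /opposite /= -(@contact_dir_nearest R d B u0 B_compact B_convex B_nbhs0 (N w)).
Qed.

Lemma sub_contact_event a b : 0 <= a -> a < b ->
  first_hit a (shell B opposite a b) `<=`
  (contact_event b `\` contact_event a) `|` double_hit a (shell B setT a b).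
Proof.
move=> a0 ab w [miss [x [Nx [/andP[ag gb] Cx]]]].
have b0 : 0 <= b by exact: le_trans (ltW ab).
have [h|nd] := pselect (double_hit a (shell B setT a b) w); [by right|left].
have [xnear x0] := nearest_of_single a0 miss nd Nx gb.
split; last first.
  move=> [/(gauge_dist_le B_compact B_convex B_nbhs0 (N_lf w) a0) + _].
  by rewrite miss => -[].
split; last by rewrite (@contact_dir_nearest R d B u0 B_compact B_convex B_nbhs0 (N w) x).
by apply/(gauge_dist_le B_compact B_convex B_nbhs0 (N_lf w) b0); exists x.
Qed.

Lemma contact_event_mono a b : a <= b -> contact_event a `<=` contact_event b.
Proof. by move=> ab w [da Cd]; split => //; apply: le_trans da _; rewrite lee_fin. Qed.

End contact_events.

(** * Tools for double hits *)

Section pairs_of_events.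
Context dT (T : measurableType dT) (R : realType) (P : probability T R).
Local Open Scope ereal_scope.

(** Pointwise, the number of events that occur is at least the indicator of one occurring plus that
    of two occurring. The probability of two events is thus at most the sum of all minus the
    probability of the union. *)
Lemma probability_pairs (I : finType) (E : I -> set T) : (forall i, measurable (E i)) ->
  P [set w | exists i, E i w] + P [set w | exists i j, [/\ i != j, E i w & E j w]] <=
  \sum_(i : I) P (E i).
Proof.
move=> mE.
have mU : measurable [set w | exists i, E i w].
  rewrite (_ : mkset _ = \bigcup_(i in [set: I]) E i).
    by apply: fin_bigcup_measurable => [|i _]; [exact: finite_finset|exact: mE].
  by apply/seteqP; split => w /=; [move=> [i Ei]; exists i|move=> [i _ Ei]; exists i].
have mV : measurable [set w | exists i j, [/\ i != j, E i w & E j w]].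
  rewrite (_ : mkset _ = \bigcup_(p in [set p : I * I | p.1 != p.2]) (E p.1 `&` E p.2)).
    apply: fin_bigcup_measurable => [|p _]; first exact: finite_finset.
    exact: measurableI.
  apply/seteqP; split => w /=; first by move=> [i [j [ij Ei Ej]]]; exists (i, j).
  by move=> [[i j] /= ij [Ei Ej]]; exists i, j.
set U := [set w | exists i, E i w] in mU *; set V := [set w | _] in mV *.
rewrite -[U]setIT -[V]setIT -!integral_indic// -ge0_integralD//; last 2 first.
- by apply/measurable_EFinP; exact: measurable_indic.
- by apply/measurable_EFinP; exact: measurable_indic.
under [leRHS]eq_bigr do rewrite -[E _]setIT -integral_indic//.
rewrite -ge0_integral_sum//; last first.
  by move=> i; apply/measurable_EFinP; exact: measurable_indic.
apply: ge0_le_integral_nm => w; first by rewrite adde_ge0// lee_fin.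
rewrite sumEFin -EFinD lee_fin !indicE.
case: (boolP (w \in V)) => [|_].
  rewrite inE => -[i [j [ij Ei Ej]]].
  rewrite mem_set; last by exists i.
  rewrite (bigD1 i)//= (bigD1 j) 1?eq_sym//= !indicE !mem_set// addrA lerDl.
  exact: sumr_ge0.
case: (boolP (w \in U)) => [|_]; last by rewrite addr0; exact: sumr_ge0.
by rewrite inE => -[i Ei]; rewrite addr0 (bigD1 i)//= indicE mem_set// lerDl sumr_ge0.
Qed.
End pairs_of_events.

Section half_spaces.
Context (R : realType) (d : nat).

(** A sequence of coordinate half-spaces with rational offsets that separates points; codes that
    decode to nothing give the empty set. *)
Definition half_space (j : nat) (x : 'rV[R]_d) : bool :=
  if @choice.unpickle ('I_d * rat)%type j is Some p then x ord0 p.1 < ratr p.2 else false.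

Lemma half_space_separates (x y : 'rV[R]_d) : x <> y -> exists j, half_space j x != half_space j y.
Proof.
have sep (z z' : 'rV[R]_d) k : z ord0 k < z' ord0 k -> exists j, half_space j z && ~~ half_space j z'.
  move=> /rat_in_itvoo[q]; rewrite in_itv/= => /andP[h1 h2].
  exists (choice.pickle (k, q)); rewrite /half_space choice.pickleK /= h1/= -leNgt; exact: ltW.
move=> xy; have [k xyk] : exists k, x ord0 k <> y ord0 k.
  apply: contrapT => /forallNP H; apply: xy; apply/rowP => k.
  exact: (contrapT (H k)).
have [lt|lt|//] := ltgtP (x ord0 k) (y ord0 k).
  by have [j /andP[jx /negbTE jy]] := sep _ _ _ lt; exists j; rewrite jx jy.
by have [j /andP[jx /negbTE jy]] := sep _ _ _ lt; exists j; rewrite jx jy.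
Qed.

Definition atom (m : nat) (beta : {ffun 'I_m -> bool}) : set 'rV[R]_d :=
  [set x | forall j : 'I_m, half_space j x = beta j].

Lemma measurable_atom m (beta : {ffun 'I_m -> bool}) : measurable (atom beta : set (borel R d)).
Proof.
rewrite (_ : atom beta = \bigcap_(j in [set: 'I_m]) [set x | half_space j x = beta j]).
  apply: fin_bigcap_measurable => [|j _]; first exact: finite_finset.
  rewrite /half_space; case: (@choice.unpickle ('I_d * rat)%type j) => [[k q]|].
    have mk := @measurable_coord R d k.
    have := measurable_fun_ltr mk (@measurable_cst _ _ _ _ setT (ratr q : R)) measurableT
      (Y := [set beta j]) I; rewrite setTI.
    by [].
  case: (beta j); first by rewrite (_ : mkset _ = set0)//; apply/seteqP; split.
  by rewrite (_ : mkset _ = setT)//; apply/seteqP; split.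
by apply/seteqP; split => x /= H j => [_|]; [exact: H|exact: (H j I)].
Qed.

Lemma atom_of m (x : 'rV[R]_d) : atom [ffun j : 'I_m => half_space j x] x.
Proof. by move=> j; rewrite ffunE. Qed.

Lemma atom_uniq m (beta : {ffun 'I_m -> bool}) x : atom beta x ->
  beta = [ffun j : 'I_m => half_space j x].
Proof. by move=> H; apply/ffunP => j; rewrite ffunE H. Qed.
End half_spaces.

(** * Hazards *)

Section first_hit_probability.
Context (R : realType) (d : nat) (B : set 'rV[R]_d).
Local Notation g := (gauge B).
Hypothesis d_gt0 : (0 < d)%N.
Hypothesis B_compact : compact B.
Hypothesis B_convex : convex_set (B : set (convex_lmodType 'rV[R]_d)).
Hypothesis B_nbhs0 : nbhs (0 : 'rV[R]_d) B.
Context disp (Omega : measurableType disp) (P : probability Omega R).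
Context (lambda : R) (lambda_gt0 : (0 < lambda)%R).
Context (Pi : {RV P >-> config R d}) (Pi_poisson : stationary_poisson lambda Pi).
Context (L0 N : {RV P >-> config R d}) (L0_cluster : typical_cluster L0).
Context (N_pcp : poisson_cluster_process Pi L0 N).
Local Open Scope ereal_scope.
Let leb := @lebesgue_rV R d.
Let L0_finite : finite_point_process L0. Proof. by case: L0_cluster. Qed.
Let mball a : measurable ([set x | (g x <= a)%R] : set (borel R d)).
Proof. exact: measurable_gauge_ball. Qed.

(** The probability of a hit is at most the mean number of hits, whose integral over the centres is
    computed by translation invariance. *)
Lemma integral_hit_prob_le (A : set (borel R d)) : measurable A ->
  \int[leb]_z hit_prob L0 A z <= mean_card L0 * leb A.
Proof.
move=> mA; have mH := measurable_hit L0_finite mA.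
have mI : measurable_fun setT (fun p : borel R d * Omega =>
    (\1_[set p : borel R d * Omega | exists2 y, L0 p.2 y & A (y + p.1)%R] p)%:E : \bar R).
  by apply/measurable_EFinP; exact: measurable_indic.
have FT := @fubini_tonelli _ _ _ _ R leb P _ mI (fun p => _).
have -> : \int[leb]_z hit_prob L0 A z = \int[leb]_z \int[P]_w
    (\1_[set p : borel R d * Omega | exists2 y, L0 p.2 y & A (y + p.1)%R] (z, w))%:E.
  apply: eq_integral => z _; rewrite /hit_prob -[X in P X]setIT -integral_indic//.
  exact: measurable_hit_at.
rewrite FT; last by move=> p; rewrite lee_fin.
apply: (@le_trans _ _ (\int[P]_w (counting (L0 w : set 'rV[R]_d) * leb A))).
  apply: ge0_le_integral_nm => w; first by apply: integral_ge0 => z _; rewrite lee_fin.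
  have mE : measurable ([set p | A p.1] : set (borel R d * borel R d)).
    by rewrite -[X in measurable X]setTI; apply: measurable_fst.
  apply: (@le_trans _ _ (\int[leb]_z counting ((L0 w : set 'rV[R]_d) `&` [set y | A ((z : 'rV[R]_d) + y)%R]))).
    apply: ge0_le_integral_nm => z; first by rewrite lee_fin.
    rewrite indicE; case: (boolP (_ \in _)) => [|_]; last exact: counting_ge0.
    rewrite inE => -[y /= Ly Ay]; apply: counting_ge1; exists y; split => //=.
    by rewrite addrC.
  have := tonelli_counting (L0_finite w) mE; rewrite /= => ->.
  rewrite (eq_integral (fun x => counting (L0 w : set 'rV[R]_d) * (\1_A x)%:E)).
    rewrite ge0_integralZl ?counting_ge0//; last first.
      by apply/measurable_EFinP; exact: measurable_indic.
    by rewrite integral_indic// setIT.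
  move=> x _; rewrite indicE; have [xA|xA] := boolP (x \in A).
    rewrite mule1; congr counting; apply/seteqP; split => y /=; first by case.
    by move=> Ly; split => //; move: xA; rewrite inE.
  rewrite mule0 (_ : _ `&` _ = set0) ?counting_finite ?fset_set0//.
  by apply/seteqP; split => y //= [_ /mem_set]; rewrite (negbTE xA).
rewrite ge0_integralZr//.
- have := measurableT_comp (measurable_counting_config (@measurableT _ (borel R d))) (measurable_funPT L0).
  by apply: eq_measurable_fun => w _; rewrite /= setIT.
- by move=> w _; exact: counting_ge0.
Qed.

Definition ball_hits a : \bar R := \int[leb]_z hit_prob L0 [set x | (g x <= a)%R] z.

Lemma ball_hits_lty a : ball_hits a < +oo.
Proof.
have [_ /andP[c0 c1] _] := L0_cluster.
apply: le_lt_trans (integral_hit_prob_le (mball a)) _.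
apply: lte_mul_pinfty; [exact: ltW|by rewrite ge0_fin_numE// ltW|].
exact: lebesgue_gauge_ball.
Qed.

Definition void_ball a : R := expR (- (lambda * fine (ball_hits a))).

Lemma void_ball_gt0 a : (0 < void_ball a)%R. Proof. exact: expR_gt0. Qed.

Lemma prob_void_ball a :
  P [set w | (N w : set 'rV[R]_d) `&` [set x | (g x <= a)%R] = set0] = (void_ball a)%:E.
Proof.
by rewrite (void_probability lambda_gt0 Pi_poisson L0_finite N_pcp (mball a))//; exact: ball_hits_lty.
Qed.

Lemma hit_gain_ge0 S a : 0 <= hit_gain B L0 S a.
Proof. by apply: integral_ge0 => z _; exact: measure_ge0. Qed.

(** The event is the difference of two nested void events, for the ball and for its union with [S];
    their exponents differ by [lambda] times the gain. *)
Lemma prob_first_hit (S : set (borel R d)) a : measurable S -> hit_gain B L0 S a < +oo ->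
  P (first_hit B N a S) = (void_ball a * (1 - expR (- (lambda * fine (hit_gain B L0 S a)))))%:E.
Proof.
move=> mS glty; pose V (A : set 'rV[R]_d) : set Omega := [set w | (N w : set 'rV[R]_d) `&` A = set0].
have mBS : measurable ([set x | (g x <= a)%R] `|` S : set (borel R d)) by exact: measurableU.
have -> : first_hit B N a S = V [set x | (g x <= a)%R] `\` V ([set x | (g x <= a)%R] `|` S).
  apply/seteqP; split => w; rewrite /first_hit /V /= setIUr.
    by move=> [-> /set0P/eqP h]; rewrite set0U.
  by move=> [->]; rewrite set0U => h; split => //; apply/set0P/eqP.
have sub : V ([set x | (g x <= a)%R] `|` S) `<=` V [set x | (g x <= a)%R].
  by move=> w; rewrite /V /= setIUr setU_eq0 => -[].
have mV1 := measurable_void N (mball a).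
have mV2 := measurable_void N mBS.
rewrite measureD//; last first.
  by rewrite (le_lt_trans (probability_le1 _ mV1))// ltry.
rewrite setIidr// [X in X - _](prob_void_ball a).
have hE := hit_gainE B_compact B_convex B_nbhs0 L0_finite a mS.
have gfin : hit_gain B L0 S a \is a fin_num by rewrite ge0_fin_numE ?hit_gain_ge0.
have bfin : ball_hits a \is a fin_num.
  rewrite ge0_fin_numE ?ball_hits_lty//; apply: integral_ge0 => z _; exact: measure_ge0.
rewrite [X in _ - X](void_probability lambda_gt0 Pi_poisson L0_finite N_pcp mBS); last first.
  by rewrite hE; apply: lte_add_pinfty => //; exact: ball_hits_lty.
rewrite hE fineD// -EFinB; congr EFin.
by rewrite mulrDr opprD expRD /void_ball; ring.
Qed.

Let shellT a b := shell B setT a b.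
Let mshell C a b : measurable (C : set (borel R d)) -> measurable (shell B C a b : set (borel R d)).
Proof. exact: measurable_shell. Qed.
Let shell_sub C a b : shell B C a b `<=` [set x | (a < g x <= b)%R].
Proof. by move=> x []. Qed.

Lemma hit_gain_shell (C : set (borel R d)) a b : measurable C -> (0 <= a)%R -> (a < b)%R ->
  [/\ hit_gain B L0 (shell B C a b) a < +oo,
      ((b ^+ d - a ^+ d) * fine (exposed_flux B L0 C b b) <= fine (hit_gain B L0 (shell B C a b) a))%R &
      (fine (hit_gain B L0 (shell B C a b) a) <=
         (b ^+ d - a ^+ d) * fine (exposed_flux B L0 C a (2 * a - b)))%R].
Proof.
move=> mC a0 ab.
have flux_fin s c : exposed_flux B L0 C s c \is a fin_num.
  by rewrite ge0_fin_numE ?exposed_flux_ge0//; exact: exposed_flux_lty.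
have up : hit_gain B L0 (shell B C a b) a <= ((b ^+ d - a ^+ d) * fine (exposed_flux B L0 C a (2 * a - b)))%:E.
  rewrite EFinM fineK// -integral_shell_exposed//.
  exact: (hit_gain_le B_compact B_convex B_nbhs0 L0_finite (mshell a b mC) a0 (@shell_sub C a b)).
have lo : ((b ^+ d - a ^+ d) * fine (exposed_flux B L0 C b b))%:E <= hit_gain B L0 (shell B C a b) a.
  rewrite EFinM fineK// -integral_shell_exposed//.
  exact: (hit_gain_ge B_compact B_convex B_nbhs0 L0_finite (mshell a b mC) a0 (@shell_sub C a b)).
have lty : hit_gain B L0 (shell B C a b) a < +oo by rewrite (le_lt_trans up)// ltry.
have gfin : hit_gain B L0 (shell B C a b) a \is a fin_num by rewrite ge0_fin_numE ?hit_gain_ge0.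
by split => //; rewrite -lee_fin fineK.
Qed.

Let pairs a b m : set Omega := [set w | exists i j : {ffun 'I_m -> bool},
  [/\ i != j, first_hit B N a (shellT a b `&` atom i) w & first_hit B N a (shellT a b `&` atom j) w]].

Let matom a b m (i : {ffun 'I_m -> bool}) : measurable (shellT a b `&` atom i : set (borel R d)).
Proof. by apply: measurableI; [exact: mshell|exact: measurable_atom]. Qed.

Lemma measurable_first_hit (S : set (borel R d)) a : measurable S -> measurable (first_hit B N a S).
Proof.
move=> mS; apply: measurableI; first exact: measurable_void.
have := measurableC (measurable_void N mS).
by congr measurable; apply/seteqP; split => w /=; [move/eqP/set0P|move/set0P/eqP].
Qed.

Let pairsE a b m : pairs a b m = [set w | (N w : set 'rV[R]_d) `&` [set x | (g x <= a)%R] = set0 /\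
  exists x y, [/\ ((N w : set 'rV[R]_d) `&` shellT a b) x, ((N w : set 'rV[R]_d) `&` shellT a b) y &
    exists j : 'I_m, half_space j x != half_space j y]].
Proof.
apply/seteqP; split => w /=.
  move=> [i [j [ij [miss [x [Nx [Sx ix]]]] [_ [y [Ny [Sy jy]]]]]]]; split => //.
  exists x, y; split => //; apply: contrapT => /forallNP H; move/negP: ij; apply; apply/eqP/ffunP => k.
  by rewrite -ix -jy; apply/eqP; rewrite -[_ == _]negbK; apply/negP; exact: H.
move=> [miss [x [y [[Nx Sx] [Ny Sy] [k xy]]]]].
exists [ffun k : 'I_m => half_space k x], [ffun k : 'I_m => half_space k y]; split.
- by apply: contra xy => /eqP/ffunP/(_ k); rewrite !ffunE => ->.
- by split => //; exists x; split => //; split => //; exact: atom_of.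
- by split => //; exists y; split => //; split => //; exact: atom_of.
Qed.

Let measurable_pairs a b m : measurable (pairs a b m).
Proof.
rewrite (_ : pairs a b m = \bigcup_(p in [set p : {ffun 'I_m -> bool} * {ffun 'I_m -> bool} | p.1 != p.2])
   (first_hit B N a (shellT a b `&` atom p.1) `&` first_hit B N a (shellT a b `&` atom p.2))).
  apply: fin_bigcup_measurable => [|p _]; first exact: finite_finset.
  by apply: measurableI; apply: measurable_first_hit; exact: matom.
apply/seteqP; split => w /=; first by move=> [i [j [ij Ei Ej]]]; exists (i, j).
by move=> [[i j] /= ij [Ei Ej]]; exists i, j.
Qed.

Let double_hitE a b : double_hit B N a (shellT a b) = \bigcup_m pairs a b m.
Proof.
apply/seteqP; split => w.
  move=> [miss [x [y [Sx Sy /half_space_separates[j xy]]]]].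
  exists j.+1 => //; rewrite pairsE; split => //; exists x, y; split => //.
  by exists (Ordinal (ltnSn j)).
move=> [m _]; rewrite pairsE => -[miss [x [y [Sx Sy [j xy]]]]]; split => //.
by exists x, y; split => // e; move: xy; rewrite e eqxx.
Qed.

Lemma measurable_double_hit a b : measurable (double_hit B N a (shellT a b)).
Proof. by rewrite double_hitE; exact: bigcupT_measurable. Qed.

(** The upper bound of [hit_gain_le] is an integral, hence additive over the disjoint atoms. The
    total does not depend on [m], which allows arbitrarily fine partitions. *)
Let sum_hit_gain a b m : (0 <= a)%R -> (a < b)%R ->
  \sum_(i : {ffun 'I_m -> bool}) hit_gain B L0 (shellT a b `&` atom i) a <=
  ((b ^+ d - a ^+ d) * fine (exposed_flux B L0 setT a (2 * a - b)))%:E.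
Proof.
move=> a0 ab.
have fin : exposed_flux B L0 setT a (2 * a - b) \is a fin_num.
  by rewrite ge0_fin_numE ?exposed_flux_ge0//; exact: exposed_flux_lty.
rewrite EFinM fineK// -integral_shell_exposed//.
pose psi (x : borel R d) := mean_exposed B L0 a (2 * a - b) (direction B x).
have mpsi : measurable_fun setT psi.
  exact: (measurableT_comp (measurable_mean_exposed B_compact B_convex B_nbhs0 L0_cluster _ _)
    (measurable_direction B_compact B_convex B_nbhs0)).
have psi0 x : 0 <= psi x by exact: mean_exposed_ge0.
apply: (@le_trans _ _ (\sum_(i : {ffun 'I_m -> bool}) \int[leb]_(x in shellT a b `&` atom i) psi x)).
  apply: lee_sum => i _.
  apply: (hit_gain_le B_compact B_convex B_nbhs0 L0_finite (matom a b i) a0).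
  by move=> x [[]].
under eq_bigr do rewrite integral_mkcond.
rewrite -ge0_integral_sum//; last 2 first.
- move=> i; apply/(measurable_restrictT _ (matom a b i)); exact: measurable_funTS.
- by move=> i x _; rewrite patchE; case: ifP.
rewrite [leRHS]integral_mkcond; apply: ge0_le_integral_nm => x.
  by apply: sume_ge0 => i _; rewrite patchE; case: ifP.
rewrite [leRHS]patchE; pose i0 := [ffun j : 'I_m => half_space j x].
rewrite (bigD1 i0)//= big1 ?adde0.
  rewrite patchE in_setI; case: (x \in shellT a b) => /=; last exact: lexx.
  by case: (x \in atom i0); [exact: lexx|exact: psi0].
move=> i ii0; rewrite patchE; case: (boolP (x \in _)) => // /set_mem[_ /atom_uniq ix].
by move/eqP: ii0 => -[]; exact: ix.
Qed.

(* Two distinct points of the shell lie in different atoms of a fine enough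
   finite partition, and the probabilities of hitting the atoms add up to at
   most the first order term of the probability of hitting the shell. *)
Lemma prob_double_hit a b : (0 <= a)%R -> (a < b)%R ->
  P (double_hit B N a (shellT a b)) <=
  (void_ball a * (lambda * ((b ^+ d - a ^+ d) * fine (exposed_flux B L0 setT a (2 * a - b)))) -
   void_ball a * (1 - expR (- (lambda * fine (hit_gain B L0 (shellT a b) a)))))%:E.
Proof.
move=> a0 ab; have [glty _ _] := hit_gain_shell (@measurableT _ (borel R d)) a0 ab.
set Y := (_ - _)%R.
have PM m : P (pairs a b m) <= Y%:E.
  pose E (i : {ffun 'I_m -> bool}) := first_hit B N a (shellT a b `&` atom i).
  have mE i : measurable (E i) by apply: measurable_first_hit; exact: matom.
  have UE : [set w | exists i, E i w] = first_hit B N a (shellT a b).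
    apply/seteqP; split => w /=.
      by move=> [i [miss [x [Nx [Sx _]]]]]; split => //; exists x.
    move=> [miss [x [Nx Sx]]]; exists [ffun j : 'I_m => half_space j x]; split => //.
    by exists x; split => //; split => //; exact: atom_of.
  have := probability_pairs P mE; rewrite UE -/(pairs a b m).
  rewrite prob_first_hit//; last exact: mshell.
  move=> H; rewrite /Y EFinB leeBrDl//; apply: le_trans H _.
  have gi i : hit_gain B L0 (shellT a b `&` atom (i : {ffun 'I_m -> bool})) a < +oo.
    apply: le_lt_trans (ltry _).
    apply: le_trans (@sum_hit_gain a b m a0 ab).
    rewrite (bigD1 i)//= leeDl// sume_ge0// => j _; exact: hit_gain_ge0.
  have gifin i : hit_gain B L0 (shellT a b `&` atom (i : {ffun 'I_m -> bool})) a \is a fin_num.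
    by rewrite ge0_fin_numE ?hit_gain_ge0.
  apply: (@le_trans _ _ (\sum_(i : {ffun 'I_m -> bool}) (void_ball a * (lambda * fine (hit_gain B L0 (shellT a b `&` atom i) a)))%:E)).
    apply: lee_sum => i _; rewrite /E (prob_first_hit (matom a b i) (gi i)).
    (* The bound [1 - exp (- x) <= x] linearises the probability of hitting each cell. *)
    rewrite lee_fin ler_pM2l ?void_ball_gt0// lerBlDl -lerBlDr.
    by have := expR_ge1Dx (- (lambda * fine (hit_gain B L0 (shellT a b `&` atom i) a)))%R; lra.
  rewrite sumEFin lee_fin -!mulr_sumr ler_pM2l ?void_ball_gt0// ler_pM2l//.
  rewrite -lee_fin -sumEFin; under eq_bigr do rewrite fineK//.
  exact: sum_hit_gain.
rewrite double_hitE.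
have ndp : nondecreasing_seq (pairs a b).
  move=> m m' mm'; apply/subsetPset => w; rewrite !pairsE => -[miss [x [y [Sx Sy [j xy]]]]].
  by split => //; exists x, y; split => //; exists (widen_ord mm' j).
have mU : measurable (\bigcup_m pairs a b m) by exact: bigcupT_measurable.
have := nondecreasing_cvg_mu (mu := P) (fun m => measurable_pairs a b m) mU ndp.
move=> c; rewrite -(cvg_lim _ c)//; apply: lime_le; first by apply/cvg_ex; eexists; exact: c.
by apply: nearW => m; exact: PM.
Qed.

End first_hit_probability.

(** The lower bound is rational, so the limit of difference quotients below involves no exponential
    of the increment. *)
Lemma one_sub_expRN_bounds (R : realType) (x y : R) : 0 <= x -> x <= y ->
  x / (1 + x) <= 1 - expR (- y) <= y.
Proof.
move=> x0 xy; apply/andP; split; last by have := expR_ge1Dx (- y); lra.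
have x1 : 0 < 1 + x by rewrite ltr_wpDr.
rewrite (_ : x / (1 + x) = 1 - (1 + x)^-1); last by field; rewrite gt_eqF.
rewrite lerD2l lerN2 expRN lef_pV2 ?posrE ?expR_gt0//.
by apply: le_trans (expR_ge1Dx x) _; rewrite ler_expR.
Qed.

Section hazard.
Context (R : realType) (d : nat) (B : set 'rV[R]_d) (u0 : 'rV[R]_d).
Local Notation g := (gauge B).
Hypothesis d_gt0 : (0 < d)%N.
Hypothesis B_compact : compact B.
Hypothesis B_convex : convex_set (B : set (convex_lmodType 'rV[R]_d)).
Hypothesis B_nbhs0 : nbhs (0 : 'rV[R]_d) B.
Context disp (Omega : measurableType disp) (P : probability Omega R).
Context (lambda : R) (lambda_gt0 : 0 < lambda).
Context (Pi : {RV P >-> config R d}) (Pi_poisson : stationary_poisson lambda Pi).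
Context (L0 N : {RV P >-> config R d}) (L0_cluster : typical_cluster L0).
Context (N_pcp : poisson_cluster_process Pi L0 N).

Let N_lf : forall w, locally_finite (N w). Proof. by case: N_pcp. Qed.
Let flux C s c := fine (exposed_flux B L0 C s c).
Let void := void_ball B lambda L0.
(** With [X = lambda * (delta * x)], [lambda * loss delta x] is the lower bound [X / (1 + X)] for
    [1 - exp (- X)]. To first order [loss] is [delta * x]. *)
Let loss (delta x : R) := delta * x / (1 + lambda * (delta * x)).

Let flux_ge0 C s c : 0 <= flux C s c.
Proof. by apply: fine_ge0; exact: exposed_flux_ge0. Qed.

Let void_gt0 a : 0 < void a. Proof. exact: void_ball_gt0. Qed.

Let prob_first_hit_bounds (C : set (borel R d)) a b : measurable C -> 0 <= a -> a < b ->
  void a * (lambda * loss (b ^+ d - a ^+ d) (flux C b b)) <=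
  fine (P (first_hit B N a (shell B C a b))) <=
  void a * (lambda * ((b ^+ d - a ^+ d) * flux C a (2 * a - b))).
Proof.
move=> mC a0 ab.
have [glty lo up] := hit_gain_shell d_gt0 B_compact B_convex B_nbhs0 L0_cluster mC a0 ab.
rewrite (prob_first_hit B_compact B_convex B_nbhs0 lambda_gt0 Pi_poisson L0_cluster N_pcp) //=; last first.
  exact: measurable_shell.
have dl0 : 0 <= b ^+ d - a ^+ d.
  by rewrite subr_ge0; apply: lerXn2r => //; rewrite ?nnegrE ?(le_trans a0)// ltW.
have x0 : 0 <= lambda * ((b ^+ d - a ^+ d) * flux C b b) by rewrite !mulr_ge0// ltW.
have := @one_sub_expRN_bounds R _ (lambda * fine (hit_gain B L0 (shell B C a b) a)) x0.
rewrite ler_pM2l// => /(_ lo)/andP[h1 h2].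
rewrite !(ler_pM2l (void_gt0 a)) /loss [lambda * (_ / _)]mulrA h1.
by apply: (le_trans h2); rewrite (ler_pM2l lambda_gt0).
Qed.

Let prob_double_hit_le a b : 0 <= a -> a < b ->
  fine (P (double_hit B N a (shell B setT a b))) <=
  void a * (lambda * ((b ^+ d - a ^+ d) * flux setT a (2 * a - b) -
                      loss (b ^+ d - a ^+ d) (flux setT b b))).
Proof.
move=> a0 ab.
have mM := measurable_double_hit B_compact B_convex B_nbhs0 N a b.
have := prob_double_hit d_gt0 B_compact B_convex B_nbhs0 lambda_gt0 Pi_poisson L0_cluster N_pcp a0 ab.
rewrite -[X in (X <= _)%E]fineK ?lee_fin; last first.
  by rewrite ge0_fin_numE// (le_lt_trans (probability_le1 _ mM))// ltry.
move=> H; apply: (le_trans H); rewrite -mulrBr (ler_pM2l (void_gt0 a)).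
rewrite mulrBr lerD2l lerN2.
have [_ lo _] := hit_gain_shell d_gt0 B_compact B_convex B_nbhs0 L0_cluster (@measurableT _ (borel R d)) a0 ab.
have dl0 : 0 <= b ^+ d - a ^+ d.
  by rewrite subr_ge0; apply: lerXn2r => //; rewrite ?nnegrE ?(le_trans a0)// ltW.
have x0 : 0 <= lambda * ((b ^+ d - a ^+ d) * flux setT b b) by rewrite !mulr_ge0// ltW.
have := @one_sub_expRN_bounds R _ (lambda * fine (hit_gain B L0 (shell B setT a b) a)) x0.
by rewrite (ler_pM2l lambda_gt0) => /(_ lo)/andP[h1 _]; rewrite /loss [lambda * (_ / _)]mulrA.
Qed.

Section increments.
Context (C : set (borel R d)) (C_borel : measurable C).
Let F a := empty_space_fun P B u0 N a C.

Let increment_bounds a b : 0 <= a -> a < b ->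
  void a * lambda * (loss (b ^+ d - a ^+ d) (flux (opposite C) b b) -
    ((b ^+ d - a ^+ d) * flux setT a (2 * a - b) - loss (b ^+ d - a ^+ d) (flux setT b b))) <=
  F b - F a <=
  void a * lambda * ((b ^+ d - a ^+ d) * flux (opposite C) a (2 * a - b) +
    ((b ^+ d - a ^+ d) * flux setT a (2 * a - b) - loss (b ^+ d - a ^+ d) (flux setT b b))).
Proof.
move=> a0 ab; have b0 : 0 <= b by rewrite (le_trans a0)// ltW.
have mO := measurable_opposite C_borel.
have mE t (t0 : 0 <= t) := measurable_contact_event u0 B_compact B_convex B_nbhs0 N_lf C_borel t0.
have mA := mE a a0; have mB := mE b b0.
have mM := measurable_double_hit B_compact B_convex B_nbhs0 N a b.
have mF := measurable_first_hit B_compact B_convex B_nbhs0 N a (measurable_shell B_compact B_convex B_nbhs0 a b mO).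
have Pfin (E : set Omega) : measurable E -> P E \is a fin_num.
  by move=> mE'; rewrite ge0_fin_numE// (le_lt_trans (probability_le1 _ mE'))// ltry.
have mD : measurable (contact_event B u0 N C b `\` contact_event B u0 N C a) by exact: measurableD.
have FE : F b - F a = fine (P (contact_event B u0 N C b `\` contact_event B u0 N C a)).
  rewrite measureD//; last by rewrite -ge0_fin_numE// Pfin.
  rewrite setIidr; last by apply: contact_event_mono; exact: ltW.
  by rewrite fineB// Pfin.
have /andP[f1 f2] := prob_first_hit_bounds mO a0 ab.
have m1 := prob_double_hit_le a0 ab.
have U1 : F b - F a <= fine (P (first_hit B N a (shell B (opposite C) a b))) +
    fine (P (double_hit B N a (shell B setT a b))).
  rewrite FE -fineD ?Pfin// fine_le ?fin_numD ?Pfin//.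
  apply: le_trans (measureU2 _ _ _) => //; apply: le_measure; rewrite ?inE//; first exact: measurableU.
  exact: (contact_event_sub B_compact B_convex B_nbhs0 N_lf).
have U2 : fine (P (first_hit B N a (shell B (opposite C) a b))) <=
    F b - F a + fine (P (double_hit B N a (shell B setT a b))).
  rewrite FE -fineD ?Pfin// fine_le ?fin_numD ?Pfin//.
  apply: le_trans (measureU2 _ _ _) => //; apply: le_measure; rewrite ?inE//; first exact: measurableU.
  exact: (@sub_contact_event _ _ _ u0 B_compact B_convex B_nbhs0 _ _ _ N N_lf C a b a0 ab).
rewrite -!mulrA; apply/andP; split.
  rewrite mulrBr mulrBr lerBlDr; apply: le_trans f1 _; apply: le_trans U2 _.
  by rewrite lerD2l.
by rewrite mulrDr mulrDr; apply: le_trans U1 _; exact: lerD.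
Qed.

(** The quotient of [b ^+ d - a ^+ d] by [b - a] as a polynomial; at [b = a] it equals
    [d * a^(d-1)]. *)
Let geom a b : R := \sum_(i < d) b ^+ (d.-1 - i) * a ^+ i.

Let geomE a h : h != 0 -> (a + h) ^+ d - a ^+ d = h * geom a (a + h).
Proof. by move=> h0; rewrite subrXX [a + h - a]addrAC subrr add0r. Qed.

Let cvg_flux_inner D a (b : nat -> R) : measurable (D : set (borel R d)) ->
  (forall n, a < b n) -> b n @[n --> \oo] --> a ->
  flux D (b n) (b n) @[n --> \oo] --> flux D a a.
Proof.
move=> mD ab ba; apply: fine_cvg; rewrite fineK; last first.
  by rewrite ge0_fin_numE ?exposed_flux_ge0//; exact: exposed_flux_lty.
exact: cvg_exposed_flux_inner.
Qed.

Let cvg_flux_outer D a (b : nat -> R) : measurable (D : set (borel R d)) -> 0 <= a ->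
  (forall n, a < b n) -> b n @[n --> \oo] --> a ->
  flux D a (2 * a - b n) @[n --> \oo] --> flux D a a.
Proof.
move=> mD a0 ab ba; apply: fine_cvg; rewrite fineK; last first.
  by rewrite ge0_fin_numE ?exposed_flux_ge0//; exact: exposed_flux_lty.
exact: cvg_exposed_flux_outer.
Qed.

(** Squeeze of the difference quotient. The double hit term is a difference of outer and inner
    fluxes over all directions; after division by the step both have the same limit, so it
    disappears. *)
Lemma empty_space_density_cluster a : 0 <= a ->
  empty_space_density P B u0 N a C =
  void_ball B lambda L0 a * lambda *
    ((\sum_(i < d) a ^+ (d.-1 - i) * a ^+ i) * fine (exposed_flux B L0 (opposite C) a a)).
Proof.
move=> a0; apply: cvg_lim; first exact: norm_hausdorff.
(* Sequences suffice, and the dominated convergence behind the flux limits is stated for them. *)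
apply/cvg_at_rightP => h [h0 hc].
pose b n := a + h n.
have ab n : a < b n by rewrite ltrDl h0.
have bc : b n @[n --> \oo] --> a.
  by rewrite -[X in _ --> X]addr0; apply: cvgD => //; exact: cvg_cst.
have mO := measurable_opposite C_borel.
have gc : geom a (b n) @[n --> \oo] --> geom a a.
  apply: cvg_big => [|i _]; first exact: add_continuous.
  apply: cvgMl; exact: (cvg_comp _ _ bc (@exprn_continuous _ _ _)).
have dc : (b n) ^+ d - a ^+ d @[n --> \oo] --> 0.
  rewrite -(subrr (a ^+ d)); apply: cvgB; last exact: cvg_cst.
  exact: (cvg_comp _ _ bc (@exprn_continuous _ _ _)).
have lossE n x : (h n)^-1 * loss ((b n) ^+ d - a ^+ d) x =
    geom a (b n) * x / (1 + lambda * (((b n) ^+ d - a ^+ d) * x)).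
  rewrite /loss {1}/b geomE ?gt_eqF// -!mulrA mulKf// gt_eqF//.
have lossc (D : set (borel R d)) : measurable D ->
    (h n)^-1 * loss ((b n) ^+ d - a ^+ d) (flux D (b n) (b n)) @[n --> \oo] -->
    geom a a * flux D a a.
  move=> mD; under eq_cvg do rewrite lossE.
  rewrite -[geom a a * _]divr1; apply: cvgM.
    by apply: cvgM => //; exact: cvg_flux_inner.
  apply: cvgV => //; rewrite -[1 in X in _ --> X]addr0; apply: cvgD; first exact: cvg_cst.
  rewrite -(mulr0 lambda); apply: cvgMr.
  by rewrite -(mul0r (flux D a a)); apply: cvgM => //; exact: cvg_flux_inner.
have outc (D : set (borel R d)) : measurable D ->
    (h n)^-1 * (((b n) ^+ d - a ^+ d) * flux D a (2 * a - b n)) @[n --> \oo] -->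
    geom a a * flux D a a.
  move=> mD; rewrite (_ : (fun n => _) = (fun n => geom a (b n) * flux D a (2 * a - b n))).
    by apply: cvgM => //; exact: cvg_flux_outer.
  by apply/funext => n; rewrite {1}/b geomE ?gt_eqF// -!mulrA mulKf// gt_eqF.
have mT := @measurableT _ (borel R d).
apply: (@squeeze_cvgr _ _ _ _
  (fun n => void a * lambda * ((h n)^-1 * loss ((b n) ^+ d - a ^+ d) (flux (opposite C) (b n) (b n)) -
    ((h n)^-1 * (((b n) ^+ d - a ^+ d) * flux setT a (2 * a - b n)) -
     (h n)^-1 * loss ((b n) ^+ d - a ^+ d) (flux setT (b n) (b n)))))
  (fun n => void a * lambda * ((h n)^-1 * (((b n) ^+ d - a ^+ d) * flux (opposite C) a (2 * a - b n)) +
    ((h n)^-1 * (((b n) ^+ d - a ^+ d) * flux setT a (2 * a - b n)) -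
     (h n)^-1 * loss ((b n) ^+ d - a ^+ d) (flux setT (b n) (b n)))))).
- apply: nearW => n.
  have scaleB (k v x y z : R) : v * (k * x - (k * y - k * z)) = k * (v * (x - (y - z))) by ring.
  have scaleD (k v x y z : R) : v * (k * x + (k * y - k * z)) = k * (v * (x + (y - z))) by ring.
  have hn : 0 < (h n)^-1 by rewrite invr_gt0.
  have /andP[h1 h2] := increment_bounds a0 (ab n).
  rewrite scaleB scaleD; apply/andP.
  by split; rewrite (ler_pM2l hn); [exact: h1|exact: h2].
- apply: cvgMr; rewrite -[X in _ --> X]subr0; apply: cvgB; first exact: lossc.
  by rewrite -(subrr (geom a a * flux setT a a)); apply: cvgB; [exact: outc|exact: lossc].
- apply: cvgMr; rewrite -[X in _ --> X]addr0; apply: cvgD; first exact: outc.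
  by rewrite -(subrr (geom a a * flux setT a a)); apply: cvgB; [exact: outc|exact: lossc].
Qed.
End increments.

Lemma empty_space_fun_setT a : 0 <= a ->
  1 - empty_space_fun P B u0 N a setT = void_ball B lambda L0 a.
Proof.
move=> a0; rewrite /empty_space_fun.
have mE := measurable_contact_event u0 B_compact B_convex B_nbhs0 N_lf (@measurableT _ (borel R d)) a0.
have Pfin : P (contact_event B u0 N setT a) \is a fin_num.
  by rewrite ge0_fin_numE// (le_lt_trans (probability_le1 _ mE))// ltry.
have := prob_void_ball B_compact B_convex B_nbhs0 lambda_gt0 Pi_poisson L0_cluster N_pcp a.
rewrite (_ : [set w | (N w : set 'rV[R]_d) `&` [set x | g x <= a] = set0] =
    ~` contact_event B u0 N setT a).
  rewrite probability_setC// => H; apply: EFin_inj.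
  by rewrite -[RHS]H EFinB fineK.
apply/seteqP; split => w /=.
  move=> miss [/(gauge_dist_le B_compact B_convex B_nbhs0 (N_lf w) a0)].
  by rewrite miss => -[].
move=> nE; apply/eqP; rewrite -[_ == _]negbK; apply/negP => /set0P h; apply: nE; split => //.
exact/(gauge_dist_le B_compact B_convex B_nbhs0 (N_lf w) a0).
Qed.

Lemma empty_space_hazard_cluster (C : set (borel R d)) a : measurable C -> 0 <= a ->
  empty_space_hazard P B u0 N a C =
  lambda * ((\sum_(i < d) a ^+ (d.-1 - i) * a ^+ i) * fine (exposed_flux B L0 (opposite C) a a)).
Proof.
move=> mC a0; rewrite /empty_space_hazard empty_space_density_cluster// empty_space_fun_setT//.
by rewrite mulrC !mulrA mulVf ?mul1r// gt_eqF// void_ball_gt0.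
Qed.

End hazard.

(** * Comparison of the numbers of exposed points *)

Lemma counting_image (T U : choiceType) (R : realType) (f : T -> U) (K : set T) :
  injective f -> finite_set K -> counting (f @` K) = counting K :> \bar R.
Proof.
move=> finj fK; rewrite !counting_finite//; last exact: finite_image.
by rewrite fset_set_image// card_imfset.
Qed.

Section exposed_scaling.
Context (R : realType) (d : nat) (B : set 'rV[R]_d).
Local Notation g := (gauge B).
Hypothesis B_compact : compact B.
Hypothesis B_convex : convex_set (B : set (convex_lmodType 'rV[R]_d)).
Hypothesis B_nbhs0 : nbhs (0 : 'rV[R]_d) B.
Implicit Types (K : set 'rV[R]_d) (a s t w : R) (u v : 'rV[R]_d).

Lemma exposed_dilated K a w u : 0 < w ->
  exposed B [set w *: x | x in K] a a u = [set w *: x | x in exposed B K (a / w) (a / w) u].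
Proof.
move=> w0; have winj (x y : 'rV[R]_d) : w *: x = w *: y -> x = y.
  by apply: scalerI; rewrite gt_eqF.
have key x y : (a < g (a *: u + (w *: y - w *: x))) = (a / w < g ((a / w) *: u + (y - x))).
  rewrite (_ : a *: u + _ = w *: ((a / w) *: u + (y - x))).
    by rewrite gaugeZ ?ltW// ltr_pdivrMr// mulrC.
  by rewrite scalerDr scalerA scalerBr [w * _]mulrC divfK// gt_eqF.
apply/seteqP; split => [_ [[x Kx <-] H]|_ [x [Kx H] <-]].
  exists x => //; split => // y Ky yx; rewrite -key; apply: H; first by exists y.
  by move/winj.
split; first by exists x.
by move=> _ [y Ky <-] yx; rewrite key; apply: H => // e; apply: yx; rewrite e.
Qed.

Lemma exposed_anti K s t u : s <= t -> g u <= 1 -> exposed B K t t u `<=` exposed B K s s u.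
Proof.
move=> st gu y [Ky H]; split => // y' Ky' yy'.
have := gauge_ray B_compact B_convex B_nbhs0 (y' - y) st gu.
by have := H y' Ky' yy'; lra.
Qed.

(** By subadditivity, [n.+1] successive steps telescope while their [a *: u] terms accumulate. *)
Let cycle_lt (z : nat -> 'rV[R]_d) a u i n :
  (forall k, g (a *: u + (z k.+1 - z k)) < a) ->
  g ((n.+1%:R * a) *: u + (z (i + n.+1)%N - z i)) < n.+1%:R * a.
Proof.
move=> H; elim: n => [|n IH]; first by rewrite addn1 !mul1r.
rewrite (_ : _ + _ = ((n.+1%:R * a) *: u + (z (i + n.+1)%N - z i)) +
  (a *: u + (z (i + n.+1).+1 - z (i + n.+1)%N))); last first.
  by rewrite [(i + n.+2)%N]addnS; apply/rowP => j; rewrite !mxE; ring.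
apply: le_lt_trans (gaugeD B_compact B_convex B_nbhs0 _ _) _.
by rewrite [n.+2%:R]mulrSr mulrDl mul1r; exact: ltrD.
Qed.

(* Following non-exposed points would close up into a cycle; the displacements
   along it sum to zero, and convexity would give [g (a *: u) < a]. *)
Lemma exposed_nonempty K a u : finite_set K -> K !=set0 -> 0 <= a -> g u = 1 ->
  (forall y y', K y -> K y' -> y' <> y -> g (a *: u + (y' - y)) <> a) ->
  exposed B K a a u !=set0.
Proof.
move=> fK [y0 Ky0] a0 gu tie; apply: contrapT => nex.
(* Without ties, a point that is not exposed has another one at gauge strictly below [a]; the
   strictness survives along the cycle. *)
have step y : exists y', K y -> K y' /\ g (a *: u + (y' - y)) < a.
  have [Ky|nKy] := pselect (K y); last by exists y => /nKy.
  apply: contrapT => /forallNP H; apply: nex; exists y; split => // y' Ky' yy'.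
  rewrite lt_neqAle; apply/andP; split; first by apply/eqP => /esym; exact: tie.
  by rewrite leNgt; apply/negP => lt; apply: (H y').
have [f fP] := choice step.
pose z k := iter k f y0.
have Kz k : K (z k) by elim: k => // k /fP[].
have zP k : g (a *: u + (z k.+1 - z k)) < a by have [] := fP _ (Kz k).
(* The orbit stays in a finite set, so it revisits a point; [n.+1] makes the cycle nonempty. *)
have [i [n zin]] : exists i n, z (i + n.+1)%N = z i.
  apply: contrapT => H.
  have zinj : injective z.
    move=> i j zij; apply: contrapT => ij; apply: H.
    have [lt|lt|e] := ltngtP i j; last by case: (ij e).
      by exists i, (j - i.+1)%N; rewrite addnS -addSn subnKC.
    by exists j, (i - j.+1)%N; rewrite addnS -addSn subnKC.
  move/finite_seqP: fK => [s sE].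
  have := @uniq_leq_size _ [seq z k | k <- iota 0 (size s).+1] s.
  rewrite map_inj_uniq// iota_uniq size_map size_iota ltnn => /(_ isT) H'.
  suff : false by []. apply: H' => _ /mapP[k _ ->].
  by have := Kz k; rewrite sE.
(* The displacements cancel and [n.+1%:R * a < n.+1%:R * a] remains. *)
have := cycle_lt i n zP; rewrite zin subrr addr0 gaugeZ// ?gu ?mulr1 ?ltxx//.
by rewrite mulr_ge0.
Qed.

End exposed_scaling.

(** * Stochastic order and independent dilations *)

Section stochastic_order.
Context disp (Omega : measurableType disp) (R : realType) (P : probability Omega R).
Local Open Scope ereal_scope.

(** On the nonnegative reals an up-set is empty or a half-line from its infimum [c]. The open
    half-line is the hypothesis; the closed one is a decreasing limit of open ones. *)
Lemma stochastic_order_upset (X Y : {RV P >-> R}) (U : set (measurableTypeR R)) :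
  (forall w, (0 <= X w)%R) -> (forall w, (0 <= Y w)%R) ->
  (forall t : R, (0 <= t)%R -> P [set w | (t < X w)%R] <= P [set w | (t < Y w)%R]) ->
  measurable U -> (forall s t : R, (0 <= s)%R -> (s <= t)%R -> U s -> U t) ->
  P (X @^-1` U) <= P (Y @^-1` U).
Proof.
move=> X0 Y0 XY mU up.
have mX (Z : {RV P >-> R}) (c : R) : measurable [set w | (c < Z w)%R].
  have := measurable_funPT Z measurableT `]c, +oo[%classic (measurable_itv _).
  by rewrite setTI; congr measurable; apply/seteqP; split => w /=; rewrite in_itv/= andbT.
pose V : set R := U `&` [set t | (0 <= t)%R].
have [V0|V0] := pselect (V !=set0); last first.
  rewrite (_ : X @^-1` U = set0) ?measure0//.
  by apply/seteqP; split => w //= Uw; apply: V0; exists (X w); split => //=; exact: X0.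
have Vlb : has_lbound V by exists 0%R => t [].
pose c := inf V.
have c0 : (0 <= c)%R by apply: lb_le_inf => // t [].
have Uc t : (c < t)%R -> U t.
  by move=> /(inf_lt V0)[s [Us s0] st]; exact: (up s t s0 (ltW st) Us).
have cU t : (0 <= t)%R -> U t -> (c <= t)%R by move=> t0 Ut; apply: ge_inf.
have [Ucc|nUc] := pselect (U c); last first.
  have E (Z : {RV P >-> R}) : (forall w, (0 <= Z w)%R) -> Z @^-1` U = [set w | (c < Z w)%R].
    move=> Z0; apply/seteqP; split => w /=; last exact: Uc.
    move=> UZ; rewrite lt_neqAle cU// andbT; apply/eqP => e; apply: nUc; rewrite e.
    exact: UZ.
  by rewrite !E//; exact: XY.
have E (Z : {RV P >-> R}) : (forall w, (0 <= Z w)%R) -> Z @^-1` U = [set w | (c <= Z w)%R].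
  move=> Z0; apply/seteqP; split => w /=; first by move=> UZ; exact: cU.
  by move=> cZ; exact: (up _ _ c0 cZ Ucc).
rewrite !E//.
move: c0; rewrite le_eqVlt => /orP[/eqP c0|c0].
  rewrite -c0 (_ : [set w | (0 <= Y w)%R] = setT); last first.
    by apply/seteqP; split => w //= _; exact: Y0.
  rewrite (_ : [set w | (0 <= X w)%R] = setT) //.
  by apply/seteqP; split => w //= _; exact: X0.
(* These thresholds increase to [c] and remain nonnegative, as [XY] requires. *)
pose cn (n : nat) := (c - c * n.+1%:R^-1)%R.
have cnc n : (cn n < c)%R by rewrite ltrBlDr ltrDl mulr_gt0// invr_gt0.
have cn0 n : (0 <= cn n)%R by rewrite subr_ge0 (ler_piMr (ltW c0))// invf_le1 ?ler1n ?ltr0n.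
have FE (Z : {RV P >-> R}) : [set w | (c <= Z w)%R] = \bigcap_n [set w | (cn n < Z w)%R].
  apply/seteqP; split => w /=; first by move=> cZ n _; exact: lt_le_trans cZ.
  move=> H; rewrite leNgt; apply/negP => Zc.
  have [n] : exists n : nat, ((c / (c - Z w)) < n.+1%:R)%R.
    exists (Num.truncn (c / (c - Z w))); exact: truncnS_gt.
  rewrite ltr_pdivrMr ?subr_gt0// => h.
  have h' : (c * n.+1%:R^-1 < c - Z w)%R by rewrite ltr_pdivrMr ?ltr0n// mulrC.
  have := H n I; rewrite /= /cn; move: h'; set q := (c * _)%R; move: q => q; lra.
rewrite (FE Y).
have cY : P [set w | (cn n < Y w)%R] @[n --> \oo] --> P (\bigcap_n [set w | (cn n < Y w)%R]).
  apply: nonincreasing_cvg_mu => //.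
  - by rewrite (le_lt_trans (probability_le1 _ _)) ?ltry.
  - exact: bigcapT_measurable.
  - move=> n m nm; apply/subsetPset => w /=; apply: le_lt_trans.
    by rewrite lerD2l lerN2 ler_pM2l// lef_pV2 ?posrE// ler_nat.
rewrite -(cvg_lim _ cY)//; apply: lime_ge; first by apply/cvg_ex; eexists; exact: cY.
apply: nearW => n; apply: le_trans (XY _ (cn0 n)).
apply: le_measure; rewrite ?inE//.
  by rewrite FE; exact: bigcapT_measurable.
by move=> w /=; exact: lt_le_trans.
Qed.

(** Independence identifies the joint law with the product of the marginal laws on rectangles, hence
    everywhere; the rest is the definition of the product measure. *)
Lemma independent_section d1 d2 (T1 : measurableType d1) (T2 : measurableType d2)
    (X : {RV P >-> T1}) (Y : {RV P >-> T2}) (G : set (T1 * T2)) :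
  independent2 P X Y -> measurable G ->
  P [set w | G (X w, Y w)] = \int[distribution P X]_x P (Y @^-1` xsection G x).
Proof.
move=> XY mG.
have mpair : measurable_fun setT (fun w => (X w, Y w)) by apply: measurable_fun_pair.
have := @product_measure_unique _ _ _ _ R (distribution P X) (distribution P Y)
  (image_measure P mpair) _ G mG.
move=> H; transitivity (image_measure P mpair G) => //; rewrite -H// => A A' mA mA'; exact: XY.
Qed.

(** The tail-sum formula. It reduces the comparison of means to level events, which for a fixed
    cluster are up-sets in the dilation factor. *)
Lemma integral_nat_valued (f : Omega -> \bar R) : measurable_fun setT f ->
  (forall w, exists k : nat, f w = k%:R%:E) ->
  \int[P]_w f w = \sum_(k <oo) P [set w | k.+1%:R%:E <= f w].
Proof.
move=> mf fnat.
have mk k : measurable [set w | k.+1%:R%:E <= f w].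
  by rewrite -[mkset _]setTI; exact: (emeasurable_fun_c_infty measurableT mf).
transitivity (\int[P]_w \sum_(k <oo) (\1_[set v : Omega | (k.+1%:R%:E <= f v)%E] w)%:E).
  apply: eq_integral => w _; have [k fk] := fnat w.
  apply/esym/lim_near_cst => //; exists k => // n /= kn.
  rewrite sumEFin fk; congr EFin.
  rewrite (eq_bigr (fun j => (j < k)%N%:R)); last first.
    move=> j _; rewrite indicE; congr ((_ : bool)%:R).
    by apply/idP/idP => [/set_mem/=|jk]; [|apply/mem_set => /=]; rewrite fk lee_fin ler_nat.
  rewrite -natr_sum; congr (_%:R); rewrite (big_cat_nat _ kn)//=.
  rewrite big_nat (eq_bigr (fun=> 1%N)); last by move=> j /andP[_ ->].
  rewrite -big_nat sum_nat_const_nat subn0 muln1 big_nat big1 ?addn0//.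
  by move=> j /andP[kj _]; rewrite ltnNge kj.
rewrite integral_nneseries//.
- by apply: eq_eseriesr => k _; rewrite integral_indic// setIT.
- by move=> k; apply/measurable_EFinP; exact: measurable_indic.
Qed.

End stochastic_order.

Section comparison.
Context (R : realType) (d : nat) (B : set 'rV[R]_d).
Local Notation g := (gauge B).
Hypothesis d_gt0 : (0 < d)%N.
Hypothesis B_compact : compact B.
Hypothesis B_convex : convex_set (B : set (convex_lmodType 'rV[R]_d)).
Hypothesis B_nbhs0 : nbhs (0 : 'rV[R]_d) B.
Context disp (Omega : measurableType disp) (P : probability Omega R).
Context (L : {RV P >-> config R d}) (L_finite : finite_point_process L).
Context (a : R) (a0 : (0 <= a)%R) (u : 'rV[R]_d) (gu : g u = 1%R).
Local Open Scope ereal_scope.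

Let m (K : set 'rV[R]_d) (s : R) : \bar R := counting (exposed B K s s u).

Let H k : set (config R d) := [set K | k.+1%:R%:E <= m (finite_part K) a].

Let measurable_H k : measurable (H k).
Proof.
rewrite /H -[mkset _]setTI; apply: (emeasurable_fun_c_infty measurableT).
exact: (@measurable_count_exposed R d B B_compact B_convex B_nbhs0 _ _ _
  (@measurable_finite_part R d) (@finite_finite_part R d) a (fun=> a) (@measurable_cst _ _ _ _ setT a)
  (fun=> u) (@measurable_cst _ _ _ _ setT (u : borel R d))).
Qed.

Let count_gt0 (K : set 'rV[R]_d) : 1%:R%:E <= m K a -> K !=set0.
Proof.
move=> h; apply/set0P/eqP => K0; have e : exposed B K a a u = set0.
  by apply/seteqP; split => // y [+ _]; rewrite K0.
by move: h; rewrite /m e counting_finite// fset_set0 lee_fin ler10.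
Qed.

Let occupied : set (config R d) := [set K | (K : set 'rV[R]_d) !=set0].

Let measurable_occupied : measurable occupied.
Proof.
rewrite (_ : occupied = ~` [set K : config R d | counting ((K : set 'rV[R]_d) `&` setT) = 0%:R%:E :> \bar R]).
  by apply: measurableC; apply: sub_sigma_algebra; exists setT, 0%N.
apply/seteqP; split => K /=; rewrite setIT.
  by move=> /set0P/eqP K0 /counting_eq0.
by move=> K0; apply/set0P/eqP => e; apply: K0; apply/counting_eq0.
Qed.

Let mean_exposed_series (X : {RV P >-> config R d}) : finite_point_process X ->
  mean_exposed B X a a u = \sum_(k <oo) P (X @^-1` H k).
Proof.
move=> fX; rewrite /mean_exposed integral_nat_valued.
- by apply: eq_eseriesr => k _; congr (P _); apply/seteqP; split => w; rewrite /H /m /= finite_partE.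
- have := @measurable_count_exposed R d B B_compact B_convex B_nbhs0 _ _ _
    (measurable_funPT X) fX a (fun=> a) (@measurable_cst _ _ _ _ setT a)
    (fun=> u) (@measurable_cst _ _ _ _ setT (u : borel R d)).
  exact.
- move=> w; rewrite counting_finite; first by eexists.
  by apply: sub_finite_set (fX w) => y [].
Qed.

(* [a / t] for [t > 0], written so that it is measurable in [t]. *)
Let ratio (t : R) : R := (a * expR (- ln t))%R.

Let ratioE t : (0 < t)%R -> ratio t = (a / t)%R.
Proof. by move=> t0; rewrite /ratio expRN lnK. Qed.

Let G k : set (config R d * measurableTypeR R) :=
  [set p | (0 < p.2)%R /\ k.+1%:R%:E <= m (finite_part p.1) (ratio p.2)].

Let measurable_G k : measurable (G k).
Proof.
have m2 : measurable_fun setT (fun p : config R d * measurableTypeR R => p.2) by exact: measurable_snd.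
have mr : measurable_fun setT (fun p : config R d * measurableTypeR R => ratio p.2 : measurableTypeR R).
  apply: measurable_funM => //; apply: (measurableT_comp (@measurable_expR R)).
  by apply: measurable_funN; exact: (measurableT_comp (@measurable_ln R)).
apply: measurableI.
  have := m2 measurableT `]0%R, +oo[%classic (measurable_itv _); rewrite setTI.
  by congr measurable; apply/seteqP; split => p /=; rewrite in_itv/= andbT.
rewrite -[X in measurable X]setTI; apply: (emeasurable_fun_c_infty measurableT).
have mphi : measurable_fun setT (fun p : config R d * measurableTypeR R => finite_part p.1).
  by apply: (measurableT_comp (@measurable_finite_part R d)); exact: measurable_fst.
have mh : measurable_fun setT (fun p : config R d * measurableTypeR R => (ratio p.2 *: u)%R : borel R d).
  exact: (@measurable_rVZ _ _ _ d (fun p : config R d * measurableTypeR R => ratio p.2) (fun=> u : borel R d)).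
have := @measurable_count_exposed R d B B_compact B_convex B_nbhs0 _ _ _ mphi
  (fun p => finite_finite_part p.1) 1%R _ mr _ mh.
by apply: eq_measurable_fun => p _; rewrite /m /exposed scale1r.
Qed.

Let finite_dilated (W : Omega -> R) w : finite_set (dilated W L w : set 'rV[R]_d).
Proof. exact: finite_image. Qed.

Let count_dilated (W : Omega -> R) w : (0 < W w)%R -> m (dilated W L w) a = m (L w) (ratio (W w)).
Proof.
move=> w0; rewrite /m /dilated exposed_dilated// ratioE// counting_image//.
  by move=> x y /scalerI; apply; rewrite gt_eqF.
by apply: sub_finite_set (L_finite w) => y [].
Qed.

(** For [k > 0] at least two exposed points are required, which excludes the factor [0], where all
    points collapse to the origin. The event is then expressed with positive factors only. *)
Let dilated_H (W : {RV P >-> R}) k : (forall w, (0 <= W w)%R) -> (0 < k)%N ->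
  dilated W L @^-1` H k = [set w | G k (L w, W w)].
Proof.
move=> W0 k0; apply/seteqP; split => w; rewrite /H /G /= !finite_partE//; last first.
  by move=> [w0]; rewrite count_dilated.
have := W0 w; rewrite le_eqVlt => /orP[/eqP w0|w0]; last by rewrite count_dilated.
suff le1 : m (dilated W L w) a <= 1%:R%:E.
  by move=> h; have := le_trans h le1; rewrite lee_fin ler_nat ltnS leqn0 => /eqP e; rewrite e in k0.
apply: (@le_trans _ _ (counting [set (0%R : 'rV[R]_d)])).
  by apply: le_counting => _ [[x _ <-] _]; rewrite -w0 scale0r.
by rewrite counting_finite// fset_set1 cardfs1.
Qed.

Let prob_H (X : {RV P >-> config R d}) (W : {RV P >-> R}) k : (forall w, (0 <= W w)%R) ->
  (0 < k)%N -> independent2 P W L -> same_law P X (dilated W L) ->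
  P (X @^-1` H k) = \int[distribution P L]_l P (W @^-1` xsection (G k) l).
Proof.
move=> W0 k0 WL XWL; rewrite (XWL _ (measurable_H k)) dilated_H//.
apply: independent_section; last exact: measurable_G.
by move=> E F mE mF; rewrite setIC WL// muleC.
Qed.

Let prob_occupied (X : {RV P >-> config R d}) (W : Omega -> R) :
  same_law P X (dilated W L) -> P (X @^-1` occupied) = P (L @^-1` occupied).
Proof.
move=> XWL; rewrite (XWL _ measurable_occupied); congr (P _).
apply/seteqP; split => w; rewrite /occupied /=; first by move=> [_ [x Lx _]]; exists x.
by move=> [x Lx]; exists (W w *: x)%R; exists x.
Qed.

Context (L0 tL0 : {RV P >-> config R d}).
Hypotheses (L0_cluster : typical_cluster L0) (tL0_cluster : typical_cluster tL0).
Context (W tW : {RV P >-> R}).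
Hypotheses (W_ge0 : forall w, (0 <= W w)%R) (tW_ge0 : forall w, (0 <= tW w)%R).
Hypotheses (W_indep : independent2 P W L) (tW_indep : independent2 P tW L).
Hypotheses (L0_law : same_law P L0 (dilated W L)) (tL0_law : same_law P tL0 (dilated tW L)).
Hypothesis W_stoch : forall t : R, (0 <= t)%R ->
  P [set w | (t < tW w)%R] <= P [set w | (t < W w)%R].

Lemma mean_exposed_stochastic_order :
  mean_exposed B tL0 a a u <= mean_exposed B L0 a a u.
Proof.
have [fL0 _ _] := L0_cluster; have [ftL0 _ _] := tL0_cluster.
have mpre (X : {RV P >-> config R d}) E : measurable E -> measurable (X @^-1` E).
  by move=> mE; rewrite -[X in measurable X]setTI; exact: measurable_funPT.
rewrite !mean_exposed_series//; apply: lee_nneseries => [k _ _|k _]; first exact: measure_ge0.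
(* Having at least two exposed points is monotone in the factor for each cluster. Having at least
   one is monotone only up to a null set and is compared through [occupied]. *)
have [->|] := posnP k; last first.
  move=> k0; rewrite (prob_H tW_ge0 k0 tW_indep tL0_law) (prob_H W_ge0 k0 W_indep L0_law).
  apply: ge0_le_integral_nm => l; first exact: measure_ge0.
  have mU : measurable (xsection (G k) l) by apply: measurable_xsection; exact: measurable_G.
  apply: (stochastic_order_upset tW_ge0 W_ge0 W_stoch mU) => s t s0 st.
  rewrite !xsectionE => -[/= s1 h]; have t1 := lt_le_trans s1 st.
  split; first exact: t1.
  apply: (le_trans h); apply: le_counting; apply: (exposed_anti B_compact B_convex B_nbhs0); last by rewrite gu.
  by rewrite (ratioE s1) (ratioE t1); apply: (ler_wpM2l a0); rewrite lef_pV2 ?posrE.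
(* Almost surely [L0] has no ties, so a nonempty [L0] has an exposed point. *)
have -> : P (L0 @^-1` H 0) = P (L0 @^-1` occupied).
  apply: ae_eq_probability; [exact: mpre|exact: mpre|].
  have tie : {ae P, forall w, forall y y', (L0 w : set 'rV[R]_d) y -> (L0 w : set 'rV[R]_d) y' ->
     y' <> y -> (g (a *: u + (y' - y)) <> a)%R}.
    (* At level [0] a tie would mean two equal points. *)
    move: a0; rewrite le_eqVlt => /orP[/eqP a1|a1]; last exact: (tie_null d_gt0 B_compact B_convex B_nbhs0 L0_cluster).
    apply: aeW => w y y' _ _ yy'; rewrite -a1 scale0r add0r; apply/eqP.
    by rewrite gauge_eq0// subr_eq0; exact/eqP.
  apply: filterS tie => w tie; rewrite /H /occupied /= finite_partE//; split.
    exact: count_gt0.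
  by move=> L0w; apply: counting_ge1; exact: exposed_nonempty.
(* Dilation, even by [0], does not change whether a cluster is empty, so both occupation
   probabilities are that of [L]. For [tL0] an inclusion suffices. *)
rewrite (prob_occupied L0_law) -(prob_occupied tL0_law).
apply: le_measure; rewrite ?inE; [exact: mpre|exact: mpre|move=> w].
by rewrite /H /occupied /= finite_partE//; exact: count_gt0.
Qed.

End comparison.

Theorem proposition3p14
  (disp : measure_display) (Omega : measurableType disp) (R : realType)
  (P : probability Omega R) (d : nat) (d_gt0 : (0 < d)%N)
  (B : set 'rV[R]_d) (B_compact : compact B)
  (B_convex : convex_set (B : set (convex_lmodType 'rV[R]_d)))
  (B_nbhs0 : nbhs (0 : 'rV[R]_d) B)
  (u0 : 'rV[R]_d)
  (u0_boundary : (closure (reflected B) `\` interior (reflected B)) u0)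
  (lambda : R) (lambda_gt0 : 0 < lambda)
  (Pi : {RV P >-> config R d}) (Pi_poisson : stationary_poisson lambda Pi)
  (L0 tL0 : {RV P >-> config R d})
  (L0_cluster : typical_cluster L0) (tL0_cluster : typical_cluster tL0)
  (N tN : {RV P >-> config R d})
  (N_pcp : poisson_cluster_process Pi L0 N)
  (tN_pcp : poisson_cluster_process Pi tL0 tN)
  (same_intensity : intensity N = intensity tN)
  (L : {RV P >-> config R d}) (L_finite : finite_point_process L)
  (W tW : {RV P >-> R})
  (W_gt0 : forall w, 0 < W w) (tW_ge0 : forall w, 0 <= tW w)
  (W_indep : independent2 P W L) (tW_indep : independent2 P tW L)
  (L0_law : same_law P L0 (dilated W L))
  (tL0_law : same_law P tL0 (dilated tW L))
  (W_stoch : forall t : R, 0 <= t ->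
     (P [set w | t < tW w]%R <= P [set w | t < W w]%R)%E)
  (t : R) (t_ge0 : 0 <= t)
  (C : set (borel R d)) (C_borel : measurable C) :
  empty_space_hazard P B u0 tN t C <= empty_space_hazard P B u0 N t C.
Proof.
rewrite (empty_space_hazard_cluster u0 d_gt0 B_compact B_convex B_nbhs0 lambda_gt0 Pi_poisson L0_cluster N_pcp C_borel t_ge0).
rewrite (empty_space_hazard_cluster u0 d_gt0 B_compact B_convex B_nbhs0 lambda_gt0 Pi_poisson tL0_cluster tN_pcp C_borel t_ge0).
have mO := measurable_opposite C_borel.
rewrite (ler_pM2l lambda_gt0); apply: ler_wpM2l.
  by apply: sumr_ge0 => i _; rewrite mulr_ge0 ?exprn_ge0.
have fin (X : {RV P >-> config R d}) : typical_cluster X -> exposed_flux B X (opposite C) t t \is a fin_num.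
  by move=> X_cluster; rewrite ge0_fin_numE ?exposed_flux_ge0//; exact: exposed_flux_lty.
apply: fine_le; [exact: fin|exact: fin|].
(* The hazards differ only in their fluxes, which are compared pointwise on the cone; there
   [direction B x] has gauge [1], as the order of mean exposed numbers requires. *)
rewrite /exposed_flux integral_mkcond [leRHS]integral_mkcond.
apply: ge0_le_integral_nm => x; rewrite !patchE.
  by case: (x \in _) => //; exact: mean_exposed_ge0.
case: (boolP (x \in _)) => // /set_mem[/andP[x0 _] _].
apply: (mean_exposed_stochastic_order d_gt0 B_compact B_convex B_nbhs0 L_finite t_ge0 _
  L0_cluster tL0_cluster (fun w => ltW (W_gt0 w)) tW_ge0 W_indep tW_indep L0_law tL0_law W_stoch).
by rewrite gauge_direction// -(gauge_gt0 B_compact B_convex B_nbhs0).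
Qed.
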